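(* Let $\gamma>1$, $\gamma\ne3$, and let $p(\varrho)=\kappa\varrho^\gamma$ with $\kappa=\frac{(\gamma-1)^2}{4\gamma}$. Assume that the pair $(\varrho,u)$, $\varrho\ge0$, is a locally bounded entropy solution of the isentropic gas dynamics system $$\partial_t\varrho+\partial_x(\varrho u)=0,\qquad \partial_t(\varrho u)+\partial_x\bigl(\varrho u^2+p(\varrho)\bigr)=0,\qquad t\ge0,\ x\in\mathbb{R},$$ and that, for some $\beta>0$ and $r>1$, $u\in W^{\beta,r}_{\mathrm{loc}}([0,T]\times\mathbb{R})$ for every $T>0$. Then $\varrho\in W^{\bar\beta,\bar r}_{\mathrm{loc}}(\mathbb{R}^+\times\mathbb{R})$ for some exponents $\bar\beta>0$ and $\bar r>1$.
   Context: $\mathbb{R}^+=(0,\infty)$. Entropy solutions: $(\varrho,u)$ is considered with $\varrho\ge0$, $(\varrho,\varrho u)\in L^\infty(\mathbb{R}^+;L^1(\mathbb{R}))$, and finite energy, $\varrho u^2+\varrho^\gamma\in L^\infty(\mathbb{R}^+;L^1(\mathbb{R}))$. The notion of entropy solution is used through its kinetic characterization (Lions–Perthame–Tadmor): $(\varrho,u)$ is an entropy solution of the system if and only if there is a non-positive bounded measure $m$ on $\mathbb{R}^+\times\mathbb{R}^2$ such that the function $$\tilde\chi(t,x,\lambda)=\bigl(\varrho^{\gamma-1}-(\lambda-u)^2\bigr)_+^{\mu},\qquad \mu=\frac{3-\gamma}{2(\gamma-1)},\qquad (w)_+^\mu:=\max\{0,|w|^{\mu-1}w\},$$ satisfies in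 the sense of distributions $$\partial_t\tilde\chi+\partial_x\Bigl(\bigl(\theta\lambda+(1-\theta)u\bigr)\tilde\chi\Bigr)=\partial_\lambda^2m(t,x,\lambda),\qquad \theta=\frac{\gamma-1}{2}.$$ Locally bounded means $\varrho,u\in L^\infty_{\mathrm{loc}}(\mathbb{R}^+\times\mathbb{R})$. For $s\in(0,1)$, $q\in[1,\infty)$ and $\Omega\subseteq\mathbb{R}^2$ open, $W^{s,q}(\Omega)$ is the space of $v\in L^q(\Omega)$ with $\iint_{\Omega\times\Omega}|v(z)-v(w)|^q|z-w|^{-2-sq}\,dz\,dw<\infty$. The condition $v\in W^{s,q}_{\mathrm{loc}}([0,T]\times\mathbb{R})$ means $v\in W^{s,q}((0,T)\times(-R,R))$ for all $R>0$; $v\in W^{s,q}_{\mathrm{loc}}(\mathbb{R}^+\times\mathbb{R})$ means $\varphi v\in W^{s,q}(\mathbb{R}^2)$ for all $\varphi\in C_c^\infty(\mathbb{R}^+\times\mathbb{R})$. The regularity exponents $\beta,\bar\beta$ are understood to lie in $(0,1)$. *)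

(* Defs.v *)
From HB Require Import structures.
From mathcomp Require Import all_boot all_order all_algebra.
From mathcomp Require Import all_classical all_reals all_analysis.

Set Implicit Arguments.
Unset Strict Implicit.
Unset Printing Implicit Defensive.

Import Order.TTheory GRing.Theory Num.Theory.
Import numFieldNormedType.Exports.

Local Open Scope classical_set_scope.
Local Open Scope ring_scope.

(** Points of [R+ x R] are pairs [(t, x)] and points of [R+ x R^2] are triples
    [(t, x, lambda)].  Functions on these domains are total functions whose
    values at [t <= 0] are never used. *)

(* [R^2] and [R^3] with the sigma-algebras on which Lebesgue measure lives. *)
Notation mplane R := (measurableTypeR R * measurableTypeR R)%type.
Notation mspace R := (mplane R * measurableTypeR R)%type.

Section Lebesgue.
Context {R : realType}.

Definition leb1 : set (measurableTypeR R) -> \bar R := @lebesgue_measure R.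
HB.instance Definition _ := SigmaFiniteMeasure.on leb1.

Definition leb2 : set (mplane R) -> \bar R := (leb1 \x leb1)%E.
HB.instance Definition _ := Measure.on leb2.

(* The library proves this for every product of sigma-finite measures, but its
   canonical instance is shadowed by the one for subprobabilities. *)
Lemma leb2_sigma_finite : sigma_finite setT leb2.
Proof.
have /sigma_finiteP[F [TF ndF Foo]] := sigma_finiteT leb1.
exists (fun n => F n `*` F n).
  rewrite -setXTT TF predeqE => -[x y]; split.
    move=> [/= [n _ Fnx] [k _ Fky]]; exists (maxn n k) => //; split.
    - by move: x Fnx; exact/subsetPset/ndF/leq_maxl.
    - by move: y Fky; exact/subsetPset/ndF/leq_maxr.
  by move=> [n _ []/= ? ?]; split; exists n.
move=> k; have [? ?] := Foo k.
split; first exact: measurableX.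
by rewrite /leb2 product_measure1E// lte_mul_pinfty// ge0_fin_numE.
Qed.

HB.instance Definition _ :=
  Measure_isSigmaFinite.Build _ _ _ leb2 leb2_sigma_finite.

Definition leb3 : set (mspace R) -> \bar R := (leb2 \x leb1)%E.
HB.instance Definition _ := Measure.on leb3.

Definition leb4 : set (mplane R * mplane R) -> \bar R := (leb2 \x leb2)%E.
HB.instance Definition _ := Measure.on leb4.

Definition halfplane : set (R * R) := [set z | 0 < z.1].

Definition halfspace : set (R * R * R) := [set y | halfplane y.1].

Definition rect (T L : R) : set (R * R) :=
  [set z | 0 < z.1 < T /\ - L < z.2 < L].

End Lebesgue.

Section TestFunctions.
Context {R : realType}.

Fixpoint iter_derive (V : normedModType R) (vs : seq V) (f : V -> R) : V -> R :=
  if vs is v :: vs' then fun x => 'D_v (iter_derive vs' f) x else f.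

Definition smooth (V : normedModType R) (f : V -> R) : Prop :=
  forall (vs : seq V) (x : V), differentiable (iter_derive vs f) x.

Definition supp (V : normedModType R) (f : V -> R) : set V :=
  closure [set x | f x != 0].

(* [C_c^oo(Omega)], each function being extended by [0] outside [Omega]. *)
Definition test_function (V : normedModType R) (Omega : set V) (f : V -> R) :
    Prop :=
  [/\ smooth f, compact (supp f) & supp f `<=` Omega].

Definition dt2 (f : R * R -> R) (z : R * R) : R := 'D_((1, 0) : R * R) f z.
Definition dx2 (f : R * R -> R) (z : R * R) : R := 'D_((0, 1) : R * R) f z.

Definition dt3 (f : R * R * R -> R) (y : R * R * R) : R :=
  'D_((1, 0, 0) : R * R * R) f y.
Definition dx3 (f : R * R * R -> R) (y : R * R * R) : R :=
  'D_((0, 1, 0) : R * R * R) f y.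
Definition dl3 (f : R * R * R -> R) (y : R * R * R) : R :=
  'D_((0, 0, 1) : R * R * R) f y.

End TestFunctions.

Section FunctionSpaces.
Context {R : realType}.

(* The library norm on [R * R] is the max norm. *)
Definition edist (z w : R * R) : R :=
  Num.sqrt ((z.1 - w.1) ^+ 2 + (z.2 - w.2) ^+ 2).

(* [W^{s,q}(Omega)]; the integrand of the double integral vanishes on the
   diagonal, whatever the value given to the kernel there. *)
Definition sobolev (s q : R) (Omega : set (R * R)) (v : R * R -> R) : Prop :=
  [/\ measurable_fun Omega v,
      (\int[leb2]_(z in Omega) ((`|v z| `^ q)%:E) < +oo)%E &
      (\int[leb4]_(zw in Omega `*` Omega)
         ((`|v zw.1 - v zw.2| `^ q * edist zw.1 zw.2 `^ (- 2 - s * q))%:E)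
       < +oo)%E].

(* [W^{s,q}_loc([0,T] x R)]: up to the boundary in [t], unlike [sobolev_loc]. *)
Definition sobolev_loc_strip (T s q : R) (v : R * R -> R) : Prop :=
  forall L : R, 0 < L -> sobolev s q (rect T L) v.

Definition sobolev_loc (s q : R) (v : R * R -> R) : Prop :=
  forall phi : R * R -> R, test_function halfplane phi ->
    sobolev s q setT (fun z => phi z * v z).

Definition locally_bounded (f : R * R -> R) : Prop :=
  measurable_fun halfplane f /\
  forall K : set (R * R), compact K -> K `<=` halfplane ->
    exists M : R, {ae leb2, forall z, K z -> `|f z| <= M}.

Definition Linfty_L1 (f : R * R -> R) : Prop :=
  measurable_fun halfplane f /\
  exists C : R, {ae leb1, forall t, 0 < t ->
    (\int[leb1]_x (`|f (t, x)|%:E) <= C%:E)%E}.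

End FunctionSpaces.

Section GasDynamics.
Context {R : realType}.

Definition kappa (gamma : R) : R := (gamma - 1) ^+ 2 / (4 * gamma).

Definition pressure (gamma a : R) : R := kappa gamma * a `^ gamma.

Definition theta (gamma : R) : R := (gamma - 1) / 2.

Definition mu_exp (gamma : R) : R := (3 - gamma) / (2 * (gamma - 1)).

(* [(w)_+^mu]; it is [0] at [w = 0], also when [mu < 0]. *)
Definition pos_pow (mu w : R) : R := Num.max 0 (`|w| `^ (mu - 1) * w).

Definition chi (gamma : R) (rho u : R * R -> R) (y : R * R * R) : R :=
  pos_pow (mu_exp gamma)
    (rho y.1 `^ (gamma - 1) - (y.2 - u y.1) ^+ 2).

(* The two conservation laws in the sense of distributions on [R+ x R]. *)
Definition weak_solution (p : R -> R) (rho u : R * R -> R) : Prop :=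
  forall phi : R * R -> R, test_function halfplane phi ->
    \int[leb2]_(z in halfplane)
       (rho z * dt2 phi z + rho z * u z * dx2 phi z) = 0 /\
    \int[leb2]_(z in halfplane)
       (rho z * u z * dt2 phi z +
        (rho z * u z ^+ 2 + p (rho z)) * dx2 phi z) = 0.

(* The kinetic equation in the sense of distributions on [R+ x R^2].  The
   non-positive bounded measure is [m = - n] with [n] a finite measure; only
   the restriction of [n] to [R+ x R^2] matters.  Both sides of
     - \int chi (d_t phi + a d_x phi) = \int d_lambda^2 phi dm
   have been multiplied by [-1]. *)
Definition kinetic_equation (gamma : R) (rho u : R * R -> R)
    (n : {finite_measure set
      (mspace R) -> \bar R}) : Prop :=
  forall phi : R * R * R -> R, test_function halfspace phi ->
    \int[leb3]_(y in halfspace)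
       (chi gamma rho u y *
        (dt3 phi y +
         (theta gamma * y.2 + (1 - theta gamma) * u y.1) * dx3 phi y))
    = \int[n]_(y in halfspace) dl3 (dl3 phi) y.

(* For locally bounded [(rho, u)] the field [es_weak] is redundant: the two
   conservation laws are the moments of order 0 and 1 in [lambda] of the
   kinetic equation.  It is kept so that the system itself, with its pressure
   law, appears in the definition. *)
Record entropy_solution (gamma : R) (rho u : R * R -> R) : Prop := {
  es_rho_meas : measurable_fun halfplane rho;
  es_u_meas : measurable_fun halfplane u;
  es_rho_ge0 : {ae leb2, forall z, halfplane z -> 0 <= rho z};
  es_mass : Linfty_L1 rho;
  es_momentum : Linfty_L1 (fun z => rho z * u z);
  es_energy : Linfty_L1 (fun z => rho z * u z ^+ 2 + rho z `^ gamma);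
  es_weak : weak_solution (pressure gamma) rho u;
  es_kinetic : exists n : {finite_measure set
      (mspace R) -> \bar R},
    kinetic_equation gamma rho u n
}.

End GasDynamics.

(* Main.v *)
Require Import Defs.
From mathcomp Require Import all_boot all_order all_algebra.
From mathcomp Require Import all_classical all_reals all_analysis.
From mathcomp Require Import measurable_realfun ring lra.

(* For locally bounded (rho, u) the two conservation laws suffice; entropies play
   no role.  Write A = (rho, rho u) and B = (rho u, rho u^2 + p(rho)) for the two
   weakly divergence-free fields, and d for the increment z |-> z + y.  In
   dimension two a div-curl argument shows that the integral of phi^2 (A(. + y) x B)
   is Lipschitz in y: one mollifies with a kernel eta(w - z - s y), differentiates in
   s, and moves each derivative onto the test function by means of the two equations.
   Hence the integral of phi^2 (dA x dB) is O(|y|).  On the other hand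
     dA x dB = d(rho) d(p) - rho(. + y) rho (d u)^2,
   and d(rho) d(p) >= kappa |d rho|^(gamma + 1).  So
     \int phi^2 |d rho|^(gamma + 1) <= C (|y| + \int phi^2 (d u)^2).
   Dividing by |y|^(2 + beta/2) and integrating over y, the last term is controlled
   by the W^(beta, r) seminorm of u, since u is bounded.  This gives
   rho in W^(betabar, gamma + 1) with betabar (gamma + 1) = beta / 2. *)

(** The solution is given up to null sets and is bounded only locally, so the argument runs on
    clipped, cut-off copies of [rho] and [u]. These satisfy the equations only against test
    functions supported in a box; hence the nested boxes with margins in [d], and the restriction to
    shifts shorter than [d / 2]. For longer shifts crude bounds suffice, the weight being integrable
    at infinity. Expanding dA x dB gives four terms. The mixed ones are correlations of A with B and
    of B with A, Lipschitz by the div-curl argument; in the shifted unmixed one the shift passes to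
    the cut-off. The mollifier can be removed because the slope bound involves it only through its
    L1 norm. Half of [beta] is spent on exchanging (du)^2 for |du|^r, where r may exceed 2. Where
    |du| <= |y|^beta, one factor |du| supplies |y|^beta, and |y|^(-2 + beta/2) is integrable at 0.
    Where |du| is larger, |du| <= |du|^r |y|^(beta (1 - r)), which leaves the Gagliardo kernel of
    [u] times the bounded factor |y|^(beta/2). *)

Set Implicit Arguments.
Unset Strict Implicit.
Unset Printing Implicit Defensive.

Import Order.TTheory GRing.Theory Num.Theory.
Import numFieldNormedType.Exports.

Local Open Scope classical_set_scope.
Local Open Scope ring_scope.

(** * Closure properties of smooth functions *)

Section Smooth.
Context {R : realType} {V : normedModType R}.
Implicit Types (f g : V -> R) (vs : seq V).

Lemma iter_derive_rcons vs v f :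
  iter_derive (rcons vs v) f = iter_derive vs ('D_v f).
Proof. by elim: vs => //= w vs ->. Qed.

Lemma smooth_differentiable f x : smooth f -> differentiable f x.
Proof. by move/(_ [::] x). Qed.

Lemma smooth_derive v f : smooth f -> smooth ('D_v f).
Proof. by move=> sf vs x; rewrite -iter_derive_rcons; exact: sf. Qed.

Lemma smooth_continuous f : smooth f -> continuous f.
Proof. by move=> sf x; apply/differentiable_continuous/smooth_differentiable. Qed.

(** A coinduction principle: [smooth] quantifies over all iterated derivatives, so it suffices to
    place [f] in some class of differentiable functions that is stable under every ['D_v]. *)
Lemma smooth_ind (S : (V -> R) -> Prop) :
  (forall f, S f -> forall x, differentiable f x) ->
  (forall f v, S f -> S ('D_v f)) -> forall f, S f -> smooth f.
Proof.
move=> Sd SD f Sf vs; apply: Sd.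
by elim: vs => //= v vs IH; exact: SD.
Qed.

(** Products alone are not stable under differentiation, since the Leibniz rule yields a sum of two
    products; the generated algebra is. *)
Inductive smooth_alg : (V -> R) -> Prop :=
| smooth_alg_base f of smooth f : smooth_alg f
| smooth_alg_add f g of smooth_alg f & smooth_alg g : smooth_alg (f + g)
| smooth_alg_mul f g of smooth_alg f & smooth_alg g : smooth_alg (f * g).

Lemma smooth_alg_differentiable f : smooth_alg f ->
  forall x, differentiable f x.
Proof.
elim=> [{}f sf x|{}f g _ df _ dg x|{}f g _ df _ dg x].
- exact: smooth_differentiable.
- exact: differentiableD.
- exact: differentiableM.
Qed.

Lemma smooth_alg_smooth f : smooth_alg f -> smooth f.
Proof.
apply: smooth_ind => [|{}f v]; first exact: smooth_alg_differentiable.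
have der g : smooth_alg g -> forall x, derivable g x v.
  by move=> sg x; apply/diff_derivable/smooth_alg_differentiable.
elim=> [{}f sf|{}f g sf IHf sg IHg|{}f g sf IHf sg IHg].
- exact/smooth_alg_base/smooth_derive.
- rewrite (_ : 'D_v _ = 'D_v f + 'D_v g); first exact: smooth_alg_add.
  by apply/funext => x; rewrite deriveD//; exact: der.
- rewrite (_ : 'D_v _ = f * 'D_v g + g * 'D_v f).
    by apply: smooth_alg_add; exact: smooth_alg_mul.
  by apply/funext => x; rewrite deriveM//; exact: der.
Qed.

Lemma smoothM f g : smooth f -> smooth g -> smooth (f * g).
Proof.
by move=> sf sg; apply/smooth_alg_smooth/smooth_alg_mul; exact: smooth_alg_base.
Qed.

Lemma differentiable_affine f (c : V) (a : R) x :
  differentiable f (c + a *: x) -> differentiable (fun z => f (c + a *: z)) x.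
Proof.
move=> df; apply: (differentiable_comp (f := fun z => c + a *: z)) => //.
Qed.

Lemma derive_affine f (c : V) (a : R) v x : differentiable f (c + a *: x) ->
  'D_v (fun z => f (c + a *: z)) x = a * 'D_v f (c + a *: x).
Proof.
move=> df; rewrite !deriveE//; last exact: differentiable_affine.
have dl : differentiable (fun z : V => c + a *: z) x by [].
rewrite (_ : 'd _ x = 'd f (c + a *: x) \o 'd (fun z => c + a *: z) x :> (V -> R)).
  have -> : ('d f (c + a *: x) \o 'd (fun z => c + a *: z) x) v =
      'd f (c + a *: x) ('D_v (fun z => c + a *: z) x) by rewrite /= deriveE.
  by rewrite deriveD// derive_cst add0r deriveZ// derive_id linearZ.
exact: diff_comp.
Qed.

Lemma smooth_affine f (c : V) (a : R) : smooth f ->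
  smooth (fun z => f (c + a *: z)).
Proof.
(* The chain rule in an affine argument emits only the scalar [a], so the functions
   [b * g (c + a *: z)] with [g] smooth form a stable class. *)
move=> sf; pose S h := exists g b, smooth g /\ h = (fun z => b * g (c + a *: z)).
apply: (@smooth_ind S) => [_ [g [b [sg ->]]] x|_ v [g [b [sg ->]]]|].
- apply: differentiableM => //.
  exact/differentiable_affine/smooth_differentiable.
- exists ('D_v g), (b * a); split; first exact: smooth_derive.
  apply/funext => x; rewrite -mulrA -derive_affine; last exact: smooth_differentiable.
  rewrite (_ : (fun z => _) = b *: (fun z => g (c + a *: z)))// deriveZ//.
  exact/diff_derivable/differentiable_affine/smooth_differentiable.
- by exists f, 1; split => //; apply/funext => x; rewrite mul1r.
Qed.

End Smooth.

(** * Lebesgue measure on the plane *)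

Section Lebesgue_facts.
Context {R : realType}.
Local Notation leb1 := (@leb1 R).
Local Notation leb2 := (@leb2 R).

(** Balls of the max norm are products of intervals, so the balls with rational centre and radius
    1/(n + 1) are measurable rectangles, and there are countably many of them. *)
Lemma open_measurable2 (U : set (R * R)) : open U -> measurable U.
Proof.
move=> oU.
pose B (q : rat * rat * nat) : set (R * R) :=
  ball ((ratr q.1.1, ratr q.1.2) : R * R) (q.2.+1%:R^-1).
have -> : U = \bigcup_(q in [set q | B q `<=` U]) B q.
  apply/seteqP; split=> [z Uz|z [q qU]]; last exact: qU.
  have : nbhs z U by exact: open_nbhs_nbhs.
  rewrite -nbhs_ballE => -[e /= e0 zU].
  (* A rational centre within 1/(n + 1) of [z] and a radius 1/(n + 1) < e/2 keep the whole ball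
     within [e] of [z]. *)
  have [n ne] : exists n : nat, n.+1%:R^-1 < e / 2.
    exists (Num.truncn (e / 2)^-1).
    by rewrite invf_plt ?posrE ?divr_gt0// truncnS_gt.
  have rn (x : R) : exists q : rat, `|ratr q - x| < n.+1%:R^-1.
    have n0 : 0 < n.+1%:R^-1 :> R by [].
    have /rat_in_itvoo[q] : x - n.+1%:R^-1 < x + n.+1%:R^-1.
      by rewrite ltrD2l gtrN.
    by rewrite in_itv/= => ?; exists q; rewrite ltr_distl.
  have [q1 hq1] := rn z.1; have [q2 hq2] := rn z.2.
  exists (q1, q2, n) => /=; last by split.
  move=> w [/= hw1 hw2]; apply: zU; split => /=.
  - rewrite [e]splitr; apply: (@lt_trans _ _ (n.+1%:R^-1 + n.+1%:R^-1)).
      apply: le_lt_trans (ler_distD (ratr q1) _ _) _; rewrite ltrD//.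
      by rewrite distrC.
    by rewrite ltrD.
  - rewrite [e]splitr; apply: (@lt_trans _ _ (n.+1%:R^-1 + n.+1%:R^-1)).
      apply: le_lt_trans (ler_distD (ratr q2) _ _) _; rewrite ltrD//.
      by rewrite distrC.
    by rewrite ltrD.
rewrite bigcup_mkcond; apply: countable_bigcupT_measurable => // q.
case: ifPn => // _.
rewrite (_ : B q = ball (ratr q.1.1 : R) q.2.+1%:R^-1 `*` ball (ratr q.1.2 : R) q.2.+1%:R^-1) //.
by apply: measurableX; apply: open_measurable; exact: ball_open.
Qed.

Lemma continuous_measurable_fun2 (f : R * R -> R) :
  continuous f -> measurable_fun setT f.
Proof.
move=> cf; apply: (measurability _ (RGenOpens.measurableE R)).
move=> _ [_ [a [b ->] <-]]; rewrite setTI.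
apply: open_measurable2; apply: open_comp; last exact: interval_open.
by move=> x _; exact: cf.
Qed.

End Lebesgue_facts.

Section Lebesgue_affine.
Context {R : realType}.
Local Notation leb1 := (@leb1 R).
Local Notation leb2 := (@leb2 R).
Local Open Scope ereal_scope.

Definition aff1 (c e : R) (x : measurableTypeR R) : measurableTypeR R :=
  (c + e * x)%R.

Lemma measurable_aff1 c e : measurable_fun setT (aff1 c e).
Proof.
rewrite /aff1; apply: measurable_funD; first exact: measurable_cst.
by apply: measurable_funM; [exact: measurable_cst|exact: measurable_id].
Qed.

Lemma preimage_aff1 (c e a b : R) : (0 < e)%R ->
  aff1 c e @^-1` `]a, b]%classic = `]((a - c) / e)%R, ((b - c) / e)%R]%classic.
Proof.
move=> e0; apply/seteqP; split => x /=; rewrite /aff1 !in_itv /=.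
- by rewrite ltr_pdivrMr// ler_pdivlMr// ltrBlDl lerBrDl (mulrC e).
- by rewrite ltr_pdivrMr// ler_pdivlMr// ltrBlDl lerBrDl (mulrC e).
Qed.

(** Uniqueness of Lebesgue measure: the push-forward scaled by [e] has the right value on half-open
    intervals. The planar version argues alike on rectangles, by uniqueness of product measures. *)
Lemma leb1_affine (c e : R) (e0 : (0 < e)%R) (A : set (measurableTypeR R)) :
  measurable A -> leb1 A = e%:E * leb1 (aff1 c e @^-1` A).
Proof.
move=> mA.
pose nu0 : {measure set (measurableTypeR R) -> \bar R} :=
  pushforward leb1 (aff1 c e : _ -> measurableTypeR R).
pose nu := nu0 (measurable_aff1 c e).
apply: (@lebesgue_measure_unique R (mscale (NngNum (ltW e0)) nu)) => //.
move=> X [[a b] _ <-].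
change (lebesgue_measure `]a, b]%classic =
  e%:E * leb1 (aff1 c e @^-1` `]a, b]%classic)).
rewrite preimage_aff1//.
rewrite /leb1 !lebesgue_measure_itv/= !lte_fin ltr_pM2r ?invr_gt0// ltrD2r.
case: ifPn => _; last by rewrite mule0.
by rewrite -!EFinB -EFinM -mulrBl mulrCA divff ?gt_eqF// mulr1; congr _%:E; ring.
Qed.

Definition aff2 (c : R * R) (e : R) (z : mplane R) : mplane R :=
  (c.1 + e * z.1, c.2 + e * z.2)%R.

Lemma measurable_aff2 c e : measurable_fun setT (aff2 c e).
Proof.
apply/measurable_fun_pairP; split.
- exact: (measurableT_comp (measurable_aff1 c.1 e)).
- exact: (measurableT_comp (measurable_aff1 c.2 e)).
Qed.

Lemma leb2_affine (c : R * R) (e : R) (e0 : (0 < e)%R) (A : set (mplane R)) :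
  measurable A -> leb2 A = (e ^+ 2)%:E * leb2 (aff2 c e @^-1` A).
Proof.
move=> mA.
pose nu0 : {measure set (mplane R) -> \bar R} :=
  pushforward leb2 (aff2 c e : _ -> mplane R).
pose nu := nu0 (measurable_aff2 c e).
have e20 : (0 <= e ^+ 2)%R by exact: sqr_ge0.
have nuE B : mscale (NngNum e20) nu B = (e ^+ 2)%:E * leb2 (aff2 c e @^-1` B).
  by [].
rewrite -nuE /leb2.
apply: product_measure_unique mA => X Y mX mY.
transitivity ((e ^+ 2)%:E * leb2 ((aff1 c.1 e @^-1` X) `*` (aff1 c.2 e @^-1` Y))).
  exact: nuE.
have mXe : measurable (aff1 c.1 e @^-1` X).
  by rewrite -[X in measurable X]setTI; exact: measurable_aff1.
have mYe : measurable (aff1 c.2 e @^-1` Y).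
  by rewrite -[X in measurable X]setTI; exact: measurable_aff1.
transitivity ((e ^+ 2)%:E *
    (leb1 (aff1 c.1 e @^-1` X) * leb1 (aff1 c.2 e @^-1` Y))).
  by congr (_ * _); exact: product_measure1E.
have := leb1_affine c.1 e0 mX; have := leb1_affine c.2 e0 mY.
move: (leb1 (aff1 c.1 e @^-1` X)) (leb1 (aff1 c.2 e @^-1` Y)) => a b Yb Xa.
transitivity ((e%:E * a) * (e%:E * b)); last by rewrite -Yb -Xa.
by rewrite muleACA -EFinM -expr2.
Qed.

Lemma ge0_integral_leb2_affine (c : R * R) (e : R) (f : mplane R -> \bar R) :
  (0 < e)%R -> measurable_fun setT f -> (forall z, 0 <= f z) ->
  \int[leb2]_z f z = (e ^+ 2)%:E * \int[leb2]_z f (aff2 c e z).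
Proof.
move=> e0 mf f0.
have e20 : (0 <= e ^+ 2)%R by exact: sqr_ge0.
pose nu0 : {measure set (mplane R) -> \bar R} :=
  pushforward leb2 (aff2 c e : _ -> mplane R).
pose nu := nu0 (measurable_aff2 c e).
transitivity (\int[mscale (NngNum e20) nu]_z f z).
  apply: eq_measure_integral => A mA _.
  exact: (leb2_affine c e0 mA).
transitivity ((e ^+ 2)%:E * \int[nu]_z f z).
  exact: (@ge0_integral_mscale _ _ _ nu setT measurableT (NngNum e20) f mf).
pose H := @ge0_integral_pushforward _ _ _ _ R _ (measurable_aff2 c e) leb2 setT f.
have -> : \int[nu]_z f z = \int[leb2]_z f (aff2 c e z).
  exact: (H measurableT mf (fun z _ => f0 z)).
by [].
Qed.

Lemma ge0_integral_leb2_shift (c : R * R) (f : mplane R -> \bar R) :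
  measurable_fun setT f -> (forall z, 0 <= f z) ->
  \int[leb2]_z f (c.1 + z.1, c.2 + z.2)%R = \int[leb2]_z f z.
Proof.
move=> mf f0; rewrite [RHS](ge0_integral_leb2_affine c ltr01)//.
rewrite expr1n mul1e; apply: eq_integral => z _.
by rewrite /aff2 !mul1r.
Qed.

End Lebesgue_affine.

(** * Bounded functions of finite support *)

Section Bounded_finite_support.
Context d (T : measurableType d) {R : realType}.
Variable mu : {measure set T -> \bar R}.
Implicit Types f g : T -> R.

(* Unlike integrability, membership in this class passes to all sections of a
   function of two variables (see [bfs2]). *)
Definition bfs f := [/\ measurable_fun setT f,
  exists M, forall x, `|f x| <= M &
  exists2 S, measurable S /\ (mu S < +oo)%E & forall x, ~ S x -> f x = 0].

Lemma bfs_integrable f : bfs f -> mu.-integrable setT (EFin \o f).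
Proof.
move=> [mf [M fM] [S [mS Soo] fS]].
have -> : EFin \o f = (EFin \o f) \_ S.
  apply/funext => x; rewrite patchE; case: ifPn => // /negP xS.
  by rewrite /= fS// => Sx; apply: xS; exact/mem_set.
apply/(integrable_mkcond _ mS); apply: measurable_bounded_integrable => //.
- exact: measurable_funTS.
- exists M; split; rewrite ?num_real // => m Mm x _.
  exact: le_trans (fM x) (ltW Mm).
Qed.

Lemma bfsD f g : bfs f -> bfs g -> bfs (fun x => f x + g x).
Proof.
move=> [mf [M fM] [S [mS Soo] fS]] [mg [N gN] [U [mU Uoo] gU]]; split.
- exact: measurable_funD.
- by exists (M + N) => x; rewrite (le_trans (ler_normD _ _))// lerD.
- exists (S `|` U); first split; first exact: measurableU.
    rewrite (le_lt_trans (measureU2 _ mS mU))//.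
    by rewrite lte_add_pinfty.
  by move=> x /not_orP[/fS -> /gU ->]; rewrite addr0.
Qed.

Lemma bfsMl f g : bfs f -> measurable_fun setT g ->
  (exists M, forall x, `|g x| <= M) -> bfs (fun x => f x * g x).
Proof.
move=> [mf [M fM] [S ? fS]] mg [N gN]; split.
- exact: measurable_funM.
- by exists (M * N) => x; rewrite normrM ler_pM.
- by exists S => // x /fS ->; rewrite mul0r.
Qed.

Lemma bfsM f g : bfs f -> bfs g -> bfs (fun x => f x * g x).
Proof. by move=> bf [mg gb _]; exact: bfsMl. Qed.

Lemma bfsZ k f : bfs f -> bfs (fun x => k * f x).
Proof.
move=> [mf [M fM] [S ? fS]]; split.
- by apply: measurable_funM => //; exact: measurable_cst.
- by exists (`|k| * M) => x; rewrite normrM ler_wpM2l.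
- by exists S => // x /fS ->; rewrite mulr0.
Qed.

Lemma bfsB f g : bfs f -> bfs g -> bfs (fun x => f x - g x).
Proof.
move=> bf bg; rewrite (_ : (fun x => _) = (fun x => f x + (-1) * g x)).
  by apply: bfsD => //; exact: bfsZ.
by apply/funext => x; rewrite mulN1r.
Qed.

Lemma bfs_norm f : bfs f -> bfs (fun x => `|f x|).
Proof.
move=> [mf [M fM] [S ? fS]]; split.
- exact: measurableT_comp.
- by exists M => x; rewrite normr_id.
- by exists S => // x /fS ->; rewrite normr0.
Qed.

Lemma bfs_Rintegral f M S : measurable_fun setT f ->
  measurable S -> (mu S < +oo)%E -> (forall x, ~ S x -> f x = 0) ->
  (forall x, `|f x| <= M) -> `|\int[mu]_x f x| <= M * fine (mu S).
Proof.
move=> mf mS Soo fS fM.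
have bf : bfs f by split => //; [exists M|exists S].
apply: le_trans (le_normr_Rintegral measurableT (bfs_integrable bf)) _.
rewrite -Rintegral_cst//.
rewrite [leRHS]Rintegral_mkcond.
apply: le_Rintegral => //.
- exact/bfs_integrable/bfs_norm.
- apply: bfs_integrable; split.
  + by apply/(measurable_restrictT _ mS); exact: measurable_cst.
  + exists `|M| => x; rewrite patchE; case: ifP => // _; by rewrite normr0.
  + by exists S => // x nSx; rewrite patchE memNset.
- move=> x _; rewrite patchE; case: ifPn => [_|/negP xS]; first exact: fM.
  by rewrite fS ?normr0// => Sx; apply: xS; exact/mem_set.
Qed.

End Bounded_finite_support.

Section Bounded_finite_support_product.
Context d1 d2 (T1 : measurableType d1) (T2 : measurableType d2) {R : realType}.
Variable m1 : {sigma_finite_measure set T1 -> \bar R}.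
Variable m2 : {sigma_finite_measure set T2 -> \bar R}.
Implicit Types F G : T1 * T2 -> R.

(** The support lies in a rectangle with sides of finite measure: a set of finite product measure
    may have some sections of infinite measure, such a rectangle has none. *)
Definition bfs2 F := [/\ measurable_fun setT F,
  exists M, forall x, `|F x| <= M &
  exists S1 S2, [/\ measurable S1, measurable S2, (m1 S1 < +oo)%E,
    (m2 S2 < +oo)%E & forall x, ~ (S1 x.1 /\ S2 x.2) -> F x = 0]].

Lemma bfs2_bfs F : bfs2 F -> bfs (m1 \x m2)%E F.
Proof.
move=> [mF FM [S1 [S2 [mS1 mS2 oo1 oo2 FS]]]]; split => //.
exists (S1 `*` S2); last by move=> x nS; exact: FS.
split; first exact: measurableX.
change ((m1 \x m2)%E (S1 `*` S2) < +oo)%E.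
by rewrite product_measure1E// lte_mul_pinfty// ge0_fin_numE.
Qed.

Lemma bfs2_l F x : bfs2 F -> bfs m2 (fun y => F (x, y)).
Proof.
move=> [mF [M FM] [S1 [S2 [mS1 mS2 oo1 oo2 FS]]]]; split.
- exact: measurable_fun_pair2.
- by exists M.
- by exists S2 => // y S2y; apply: FS => -[].
Qed.

Lemma bfs2_r F y : bfs2 F -> bfs m1 (fun x => F (x, y)).
Proof.
move=> [mF [M FM] [S1 [S2 [mS1 mS2 oo1 oo2 FS]]]]; split.
- exact: measurable_fun_pair1.
- by exists M.
- by exists S1 => // x S1x; apply: FS => -[].
Qed.

Lemma bfs2_EFin_l F x : bfs2 F ->
  (\int[m2]_y F (x, y))%:E = (\int[m2]_y (F (x, y))%:E)%E.
Proof.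
by move=> bF; rewrite fineK//; apply/integrable_fin_num/bfs_integrable/bfs2_l.
Qed.

Lemma bfs2_EFin_r F y : bfs2 F ->
  (\int[m1]_x F (x, y))%:E = (\int[m1]_x (F (x, y))%:E)%E.
Proof.
by move=> bF; rewrite fineK//; apply/integrable_fin_num/bfs_integrable/bfs2_r.
Qed.

Lemma bfs2_int F : bfs2 F -> bfs m1 (fun x => \int[m2]_y F (x, y)).
Proof.
move=> bF; have [mF [M FM] [S1 [S2 [mS1 mS2 oo1 oo2 FS]]]] := bF; split.
- apply/measurable_EFinP.
  rewrite (_ : _ \o _ = fubini_F m2 (EFin \o F)).
    exact/measurable_fubini_F/bfs_integrable/bfs2_bfs.
  by apply/funext => x; rewrite /= bfs2_EFin_l.
- exists (M * fine (m2 S2)) => x; apply: bfs_Rintegral => //.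
  + exact: measurable_fun_pair2.
  + by move=> y S2y; apply: FS => -[].
- exists S1 => // x S1x; rewrite (@eq_Rintegral _ _ _ _ _ (cst 0)).
    by rewrite Rintegral_cst// mul0r.
  by move=> y _; apply: FS => -[].
Qed.

Lemma bfs2_fubini1 F : bfs2 F ->
  \int[m1]_x \int[m2]_y F (x, y) = \int[(m1 \x m2)%E]_z F z.
Proof.
move=> bF; congr fine; rewrite -integral12_prod_meas1; last first.
  exact/bfs_integrable/bfs2_bfs.
by apply: eq_integral => x _; rewrite bfs2_EFin_l.
Qed.

Lemma bfs2_fubini2 F : bfs2 F ->
  \int[m2]_y \int[m1]_x F (x, y) = \int[(m1 \x m2)%E]_z F z.
Proof.
move=> bF; congr fine; rewrite -integral21_prod_meas1; last first.
  exact/bfs_integrable/bfs2_bfs.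
by apply: eq_integral => x _; rewrite bfs2_EFin_r.
Qed.

Lemma bfs2_swap F : bfs2 F ->
  \int[m1]_x \int[m2]_y F (x, y) = \int[m2]_y \int[m1]_x F (x, y).
Proof. by move=> bF; rewrite bfs2_fubini1// bfs2_fubini2. Qed.

Lemma bfs2M (f : T1 -> R) (g : T2 -> R) (k : T1 * T2 -> R) :
  bfs m1 f -> bfs m2 g -> measurable_fun setT k ->
  (exists M, forall x, `|k x| <= M) ->
  bfs2 (fun x => f x.1 * g x.2 * k x).
Proof.
move=> [mf [M1 fM] [S1 [mS1 oo1] fS]] [mg [M2 gM] [S2 [mS2 oo2] gS]] mk [M kM].
split.
- apply: measurable_funM => //; apply: measurable_funM.
  + exact: measurableT_comp.
  + exact: measurableT_comp.
- exists (M1 * M2 * M) => x; rewrite !normrM.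
  by rewrite ler_pM// ?mulr_ge0// ler_pM.
- exists S1, S2; split => // x /not_andP[/fS ->|/gS ->].
    by rewrite !mul0r.
  by rewrite mulr0 mul0r.
Qed.

Lemma bfs2D F G : bfs2 F -> bfs2 G -> bfs2 (fun x => F x + G x).
Proof.
move=> [mF [M FM] [S1 [S2 [mS1 mS2 oo1 oo2 FS]]]].
move=> [mG [N GN] [U1 [U2 [mU1 mU2 u1 u2 GU]]]]; split.
- exact: measurable_funD.
- by exists (M + N) => x; rewrite (le_trans (ler_normD _ _))// lerD.
- exists (S1 `|` U1), (S2 `|` U2); split.
  + exact: measurableU.
  + exact: measurableU.
  + by rewrite (le_lt_trans (measureU2 _ mS1 mU1))// lte_add_pinfty.
  + by rewrite (le_lt_trans (measureU2 _ mS2 mU2))// lte_add_pinfty.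
  + move=> x nx; rewrite FS ?GU ?addr0//.
    * by move=> [u v]; apply: nx; split; right.
    * by move=> [u v]; apply: nx; split; left.
Qed.

Lemma bfs2_norm F : bfs2 F -> bfs2 (fun x => `|F x|).
Proof.
move=> [mf [M fM] [S1 [S2 [? ? ? ? fS]]]]; split.
- exact: measurableT_comp.
- by exists M => x; rewrite normr_id.
- by exists S1, S2; split => // x /fS ->; rewrite normr0.
Qed.

End Bounded_finite_support_product.

Section Bounded_convergence.
Context d (T : measurableType d) {R : realType}.
Variable mu : {measure set T -> \bar R}.

Lemma bfs_le (f g : T -> R) : bfs mu f -> bfs mu g -> (forall x, f x <= g x) ->
  \int[mu]_x f x <= \int[mu]_x g x.
Proof.
by move=> bf bg fg; apply: le_Rintegral => //; exact: bfs_integrable.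
Qed.

Lemma bfs_RintegralD (f g : T -> R) : bfs mu f -> bfs mu g ->
  \int[mu]_x (f x + g x) = \int[mu]_x f x + \int[mu]_x g x.
Proof. by move=> bf bg; apply: RintegralD => //; exact: bfs_integrable. Qed.

Lemma bfs_RintegralB (f g : T -> R) : bfs mu f -> bfs mu g ->
  \int[mu]_x (f x - g x) = \int[mu]_x f x - \int[mu]_x g x.
Proof. by move=> bf bg; apply: RintegralB => //; exact: bfs_integrable. Qed.

Lemma bfs_EFin (f : T -> R) : bfs mu f ->
  (\int[mu]_x f x)%:E = (\int[mu]_x (f x)%:E)%E.
Proof.
by move=> bf; rewrite fineK//; apply/integrable_fin_num => //; exact: bfs_integrable.
Qed.

Lemma bfs_dominated (f g : T -> R) : measurable_fun setT f -> bfs mu g ->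
  (forall x, `|f x| <= g x) -> bfs mu f.
Proof.
move=> mf [mg [M gM] [S ? gS]] fg; split => //.
- by exists M => x; rewrite (le_trans (fg x))// (le_trans _ (gM x))// ler_norm.
- by exists S => // x /gS gx; apply/eqP; rewrite -normr_le0 -gx.
Qed.

Lemma bfs_cvg0 (f_ : nat -> T -> R) (g : T -> R) :
  (forall n, measurable_fun setT (f_ n)) -> bfs mu g ->
  (forall n x, `|f_ n x| <= g x) -> (forall x, f_ n x @[n --> \oo] --> 0) ->
  \int[mu]_x f_ n x @[n --> \oo] --> 0.
Proof.
move=> mf bg fg f0.
have : (\int[mu]_x (f_ n x)%:E)%E @[n --> \oo] --> (\int[mu]_x cst 0 x)%E.
  have [|||||_ _ //] := @dominated_convergence _ _ _ mu setT measurableT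
    (fun n x => (f_ n x)%:E) (cst 0%E) (EFin \o g).
  - by move=> n; exact/measurable_EFinP.
  - exact: measurable_cst.
  - by apply: aeW => x _; apply: cvg_EFin; [exact: nearW|exact: f0].
  - exact: bfs_integrable.
  - by apply: aeW => x n _; rewrite lee_fin.
by rewrite integral0 => /fine_cvg.
Qed.

End Bounded_convergence.

(** * Continuity of translations in L1 *)

Section Shift_L1.
Context {R : realType}.
Local Notation leb1 := (@leb1 R).
Local Notation leb2 := (@leb2 R).

Lemma ge0_integral_leb1_shift (a : R) (f : measurableTypeR R -> \bar R) :
  measurable_fun setT f -> (forall x, (0 <= f x)%E) ->
  (\int[leb1]_x f (a + x)%R = \int[leb1]_x f x)%E.
Proof.
move=> mf f0.
transitivity (\int[pushforward leb1 (aff1 a 1)]_x f x)%E.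
  rewrite ge0_integral_pushforward//; last exact: measurable_aff1.
  by apply: eq_integral => x _; rewrite /aff1 /= mul1r.
apply: eq_measure_integral => [|m A mA _]; first exact: measurable_aff1.
exact/esym/(etrans (leb1_affine a ltr01 mA) (mul1e _)).
Qed.

Definition seg (L : R) : set (measurableTypeR R) := [set` `[(- L)%R, L%R]].

Lemma segP L x : seg L x <-> `|x| <= L.
Proof. by rewrite /seg /= in_itv/= ler_norml. Qed.

Lemma leb1_seg (L : R) : measurable (seg L) /\ (leb1 (seg L) < +oo)%E.
Proof.
split; first exact: measurable_itv.
by rewrite /seg /Defs.leb1 lebesgue_measure_itv/=; case: ifP; rewrite ?ltry// -EFinB ltry.
Qed.

Lemma measurable_shift1 (f : measurableTypeR R -> R) (a : R) :
  measurable_fun setT f -> measurable_fun setT (fun x => f (a + x)).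
Proof.
move=> mf; rewrite (_ : (fun x => _) = f \o aff1 a 1).
  by apply: measurableT_comp => //; exact: measurable_aff1.
by apply/funext => x; rewrite /= /aff1 mul1r.
Qed.

Lemma bfs_shift1 (f : measurableTypeR R -> R) (a M L : R) :
  measurable_fun setT f -> (forall x, `|f x| <= M) ->
  (forall x, L < `|x| -> f x = 0) -> bfs leb1 (fun x => f (a + x)).
Proof.
move=> mf fM fL; split.
- exact: measurable_shift1.
- by exists M.
- exists (seg (L + `|a|)); first exact: leb1_seg.
  move=> x /segP/negP; rewrite -ltNge => Lx.
  apply: fL; rewrite -(ltrD2r `|a|) (lt_le_trans Lx)//.
  by rewrite -{1}[x](addKr a) (le_trans (ler_normD _ _))// normrN addrC.
Qed.

(** [f] is replaced by a continuous [g] close to it in L1 on the segment [E]. The two replacement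
    errors are equal by translation invariance, and dominated convergence handles the increment of
    [g]. *)
Lemma shift_L1_1 (f : R -> R) (u : nat -> R) (M L : R) :
  measurable_fun setT (f : measurableTypeR R -> R) -> (forall x, `|f x| <= M) ->
  (forall x, L < `|x| -> f x = 0) ->
  (forall n, `|u n| <= 1) -> u n @[n --> \oo] --> 0 ->
  \int[leb1]_x `|f (u n + x) - f x| @[n --> \oo] --> 0.
Proof.
move=> mf fM fL u1 u0.
(* Shifts have length at most 1: outside [E1] both [f] and its shift vanish, and from [E1] a shift
   leads into [E], where [g] is bounded and close to [f]. *)
pose E : set R := seg (L + 2).
pose E1 : set R := seg (L + 1).
have bf : bfs leb1 f.
  rewrite (_ : f = fun x => f (0 + x)); first exact: (bfs_shift1 _ mf fM fL).
  by apply/funext => x; rewrite add0r.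
have [mE Eoo] := leb1_seg (L + 2).
have [mE1 E1oo] := leb1_seg (L + 1).
have [g_ [cg ig gf]] := @approximation_continuous_integrable R E f mE Eoo
  (integrableS measurableT mE (@subsetT _ _) (bfs_integrable bf)).
apply/cvgrPdist_le => e e0.
have e30 : 0 < e / 3 by rewrite divr_gt0.
have [g [gc gI]] : exists g, continuous g /\
    (\int[leb1]_(z in E) `|(f z - g z)%:E| < (e / 3)%:E)%E.
  have /fine_cvgP[fi /cvgrPdist_lt/(_ _ e30) gf'] := gf.
  near \oo => n; exists (g_ n); split => //.
  have fin : (\int[leb1]_(z in E) `|(f z - g_ n z)%:E| \is a fin_num)%E.
    by near: n; exact: fi.
  rewrite -(fineK fin) lte_fin.
  have : `|0 - fine (\int[leb1]_(z in E) `|(f z - g_ n z)%:E|)%E| < e / 3.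
    by near: n; exact: gf'.
  by rewrite sub0r normrN; apply: le_lt_trans; exact: ler_norm.
have cE : compact E by exact: segment_compact.
have [N [N0 gN]] : exists N, 0 <= N /\ forall x, E x -> `|g x| <= N.
  have cgE : {within E, continuous g} by exact: continuous_subspaceT.
  have /compact_bounded[N [_ hN]] := continuous_compact cgE cE.
  exists `|N + 1|; split => // x Ex; rewrite (le_trans _ (ler_norm _))//.
  by apply: (hN (N + 1)); rewrite ?ltrDl//; exists x.
have mg : measurable_fun setT (g : measurableTypeR R -> R).
  exact: continuous_measurable_fun.
pose h x := `|f x - g x| * \1_E x.
pose k n x := `|g (u n + x) - g x| * \1_E1 x.
have m1 (A : set R) : measurable A -> measurable_fun setT (\1_A : measurableTypeR R -> R).
  by move=> mA; exact: measurable_indic.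
have mh : measurable_fun setT (h : measurableTypeR R -> R).
  apply: measurable_funM; last exact: m1.
  by apply: measurableT_comp => //; exact: measurable_funB.
have M0 : 0 <= M by exact: le_trans (fM 0).
have hM x : `|h x| <= M + N.
  rewrite /h indicE; case: (boolP (x \in E)) => [/set_mem Ex|_].
    rewrite mulr1 normr_id (le_trans (ler_normB _ _))// lerD//; exact: gN.
  by rewrite mulr0 normr0 addr_ge0.
have h0 x : 0 <= h x by rewrite mulr_ge0.
have hL x : L + 2 < `|x| -> h x = 0.
  move=> Lx; rewrite /h indicE memNset ?mulr0// => /segP.
  by apply/negP; rewrite -ltNge.
have bh : bfs leb1 (h : measurableTypeR R -> R).
  rewrite (_ : h = fun x => h (0 + x)); first exact: (bfs_shift1 _ mh hM hL).
  by apply/funext => x; rewrite add0r.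
have Ih : \int[leb1]_x h x < e / 3.
  rewrite -lte_fin bfs_EFin//; apply: le_lt_trans gI.
  rewrite [leRHS]integral_mkcond le_eqVlt; apply/orP; left; apply/eqP.
  apply: eq_integral => x _; rewrite patchE /h indicE.
  by case: ifPn => _ /=; rewrite ?mulr1 ?mulr0// EFin_normr.
have Ihs a : \int[leb1]_x h (a + x) = \int[leb1]_x h x.
  congr fine; apply: (@ge0_integral_leb1_shift a (fun x => (h x)%:E)) => //.
  exact/measurable_EFinP.
have mk n : measurable_fun setT (k n : measurableTypeR R -> R).
  apply: measurable_funM; last exact: m1.
  apply: measurableT_comp => //; apply: measurable_funB => //.
  exact: measurable_shift1.
have E1E x a : E1 x -> `|a| <= 1 -> E (a + x).
  move=> /segP xL a1; apply/segP.
  by rewrite (le_trans (ler_normD _ _))// addrC -[2]/(1 + 1) addrA lerD.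
have bE1 : bfs leb1 (fun x : measurableTypeR R => (N + N) * \1_E1 x).
  split.
  - by apply: measurable_funM; [exact: measurable_cst|exact: m1].
  - exists (N + N) => x; rewrite normrM ger0_norm ?addr_ge0//.
    by rewrite indicE; case: (x \in E1); rewrite ?normr1 ?normr0 ?mulr1 ?mulr0 ?addr_ge0.
  - by exists E1 => // x nE; rewrite indicE memNset ?mulr0.
have kN n x : `|k n x| <= (N + N) * \1_E1 x.
  rewrite /k indicE; case: (boolP (x \in E1)) => [/set_mem xE|_].
    rewrite !mulr1 normr_id (le_trans (ler_normB _ _))// lerD//; apply: gN.
      exact: E1E.
    by rewrite -[x]add0r; apply: E1E => //; rewrite normr0.
  by rewrite !mulr0 normr0.
have bk n : bfs leb1 (k n : measurableTypeR R -> R).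
  exact: bfs_dominated (mk n) bE1 (kN n).
have k0 : \int[leb1]_x k n x @[n --> \oo] --> 0.
  apply: (bfs_cvg0 mk bE1 kN) => x.
  rewrite -[X in _ --> X](mul0r (\1_E1 x)); apply: cvgM; last exact: cvg_cst.
  rewrite -[X in _ --> X](normr0 R); apply: cvg_norm.
  rewrite -[X in _ --> X](subrr (g x)); apply: cvgB; last exact: cvg_cst.
  rewrite -[X in _ --> g X]add0r.
  apply: continuous_cvg; first by rewrite add0r; exact: gc.
  by apply: cvgD => //; exact: cvg_cst.
have bfu n : bfs leb1 (fun x => f (u n + x)) by exact: (bfs_shift1 _ mf fM fL).
have bhu n : bfs leb1 (fun x => h (u n + x)) by exact: (bfs_shift1 _ mh hM hL).
move/cvgrPdist_lt/(_ _ e30) : k0 => kk.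
near=> n; rewrite sub0r normrN ger0_norm; last by apply: Rintegral_ge0 => x _.
have kn : \int[leb1]_x k n x < e / 3.
  have : `|0 - \int[leb1]_x k n x| < e / 3 by near: n; exact: kk.
  by rewrite sub0r normrN; apply: le_lt_trans; exact: ler_norm.
apply: (@le_trans _ _ (\int[leb1]_x (h (u n + x) + h x + k n x))).
  apply: bfs_le.
  - by apply: bfs_norm; exact: bfsB.
  - by apply: bfsD => //; exact: bfsD.
  move=> x; have [E1x|E1x] := pselect (E1 x).
    have Ex : E x by rewrite -[x]add0r; apply: E1E => //; rewrite normr0.
    rewrite /h /k !indicE !mem_set//; last exact: E1E.
    rewrite !mulr1 [X in `|X|](_ : _ = (f (u n + x) - g (u n + x)) +
      (g x - f x) + (g (u n + x) - g x)); last by ring.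
    rewrite (le_trans (ler_normD _ _))// lerD2r.
    by rewrite (le_trans (ler_normD _ _))// lerD2l distrC.
  have Lx : L + 1 < `|x|.
    by rewrite ltNge; apply/negP => xL; exact/E1x/segP.
  rewrite fL ?fL ?subrr ?normr0.
  - by rewrite !addr_ge0// mulr_ge0.
  - by apply: lt_trans Lx; rewrite ltrDl.
  - rewrite -(ltrD2r 1) (lt_le_trans Lx)//.
    rewrite -[x in leLHS](addKr (u n)) (le_trans (ler_normD _ _))// normrN addrC.
    by rewrite lerD2l.
rewrite !bfs_RintegralD//; last by exact: bfsD.
by rewrite Ihs [leRHS](_ : e = e / 3 + e / 3 + e / 3) ?lerD 1?ltW//; field.
Unshelve. all: by end_near. Qed.

End Shift_L1.

Section Shift_L1_plane.
Context {R : realType}.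
Local Notation leb1 := (@leb1 R).
Local Notation leb2 := (@leb2 R).

(** A version of [bfs2] with explicit constants: a shift by [c] keeps [M] and adds the max norm of
    [c] to [L]. *)
Definition bbox (M L : R) (f : mplane R -> R) := [/\ measurable_fun setT f,
  forall z, `|f z| <= M & forall z, ~ (`|z.1| <= L /\ `|z.2| <= L) -> f z = 0].

Lemma bbox_bfs2 M L f : bbox M L f -> bfs2 leb1 leb1 f.
Proof.
move=> [mf fM fL]; split => //; first by exists M.
have [mS Soo] := leb1_seg L.
exists (seg L), (seg L); split => // -[t x] /= ns; apply: fL => -[/segP ? /segP ?].
exact: ns.
Qed.

Lemma bbox_bfs M L f : bbox M L f -> bfs leb2 f.
Proof. by move=> /bbox_bfs2 /bfs2_bfs. Qed.

Lemma measurable_shift2 (f : mplane R -> R) (c : R * R) :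
  measurable_fun setT f -> measurable_fun setT (fun z => f (c + z)).
Proof.
move=> mf; rewrite (_ : (fun z => _) = f \o aff2 c 1).
  by apply: measurableT_comp => //; exact: measurable_aff2.
by apply/funext => -[t x]; rewrite /= /aff2 !mul1r.
Qed.

Lemma bbox_shift M L f (c : R * R) : bbox M L f ->
  bbox M (L + `|c|) (fun z => f (c + z)).
Proof.
move=> [mf fM fL]; split => //; first exact: measurable_shift2.
have E (a b : R) : `|a + b| <= L -> `|a| <= `|c| -> `|b| <= L + `|c|.
  move=> ab ac; rewrite -[b](addKr a) (le_trans (ler_normD _ _))// normrN addrC.
  by rewrite lerD.
move=> z nz; apply: fL => -[/= z1 z2]; apply: nz.
have [c1 c2] : `|c.1| <= `|c| /\ `|c.2| <= `|c|.
  by rewrite prod_normE !le_max !lexx orbT.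
by split; [exact: E z1 c1|exact: E z2 c2].
Qed.

Lemma Rintegral_leb2_shift (f : mplane R -> R) (c : R * R) : bfs leb2 f ->
  \int[leb2]_z f (c + z) = \int[leb2]_z f z.
Proof.
move=> bf.
have ge0 (g : mplane R -> \bar R) : measurable_fun setT g -> (forall z, 0 <= g z)%E ->
    (\int[leb2]_z g (c + z)%R = \int[leb2]_z g z)%E.
  by move=> mg g0; rewrite -[RHS](ge0_integral_leb2_shift c mg g0).
have mf : measurable_fun setT (EFin \o f) by case: bf => mf _ _; exact/measurable_EFinP.
congr fine; rewrite integralE [RHS]integralE; congr (_ - _)%E.
- rewrite -[RHS]ge0; first by apply: eq_integral => z _; rewrite !funeposE.
    exact: measurable_funepos.
  by move=> z; exact: funepos_ge0.
- rewrite -[RHS]ge0; first by apply: eq_integral => z _; rewrite !funenegE.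
    exact: measurable_funeneg.
  by move=> z; exact: funeneg_ge0.
Qed.

(** The one-dimensional result applies on every line of constant [t]. The inner integrals are
    bounded by [K] and vanish for [|t| > L + 1], so dominated convergence in [t] concludes. *)
Lemma shift_snd_L1 M L f (u : nat -> R) : bbox M L f ->
  (forall n, `|u n| <= 1) -> u n @[n --> \oo] --> 0 ->
  \int[leb1]_t \int[leb1]_x `|f (t, u n + x) - f (t, x)| @[n --> \oo] --> 0.
Proof.
move=> bf u1 u0; have [mf fM fL] := bf.
have bu n : bbox M (L + 1) (fun z => f ((0, u n) + z)).
  have [mg gM gL] := bbox_shift (0, u n) bf; split => // z nz; apply: gL => -[z1 z2].
  have l1 : `|(0, u n) : R * R| <= 1 by rewrite prod_normE ge_max normr0 ler01 u1.
  by apply: nz; split; rewrite (le_trans _ (lerD (lexx L) l1)).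
pose F n (z : mplane R) := `|f ((0, u n) + z) - f z|.
have bF n : bfs2 leb1 leb1 (F n).
  apply: bfs2_norm; apply: bfs2D; first exact: bbox_bfs2 (bu n).
  have := bbox_bfs2 bf; move=> [m [K mK] [S1 [S2 [? ? ? ? fS]]]]; split.
  - exact: measurableT_comp.
  - by exists K => z; rewrite normrN.
  - by exists S1, S2; split => // z /fS ->; rewrite oppr0.
have FE n t x : `|f (t, u n + x) - f (t, x)| = F n (t, x).
  by rewrite /F (_ : (0, u n) + (t, x) = (t, u n + x))//; congr pair; rewrite /= add0r.
under eq_fun do (under eq_Rintegral do (under eq_Rintegral do rewrite FE)).
have [mS Soo] := leb1_seg (L + 1).
have M0 : 0 <= M by exact: le_trans (fM (0, 0)).
pose K := (M + M) * fine (leb1 (seg (L + 1))).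
have K0 : 0 <= K by rewrite mulr_ge0 ?addr_ge0// fine_ge0.
have FM n z : `|F n z| <= M + M.
  by rewrite normr_id (le_trans (ler_normB _ _))// lerD.
have FL n z : ~ (`|z.1| <= L + 1 /\ `|z.2| <= L + 1) -> F n z = 0.
  move=> nz; rewrite /F; have [_ _ ->//] := bu n; rewrite fL ?subrr ?normr0// => -[z1 z2].
  by apply: nz; split; rewrite (le_trans z1, le_trans z2)// lerDl.
apply: (@bfs_cvg0 _ _ _ leb1 _ (fun t => K * \1_(seg (L + 1)) t)).
- by move=> n; have [] := bfs2_int (bF n).
- split.
  + by apply: measurable_funM; [exact: measurable_cst|exact: measurable_indic].
  + exists K => t; rewrite normrM ger0_norm// indicE.
    by case: (_ \in _); rewrite ?normr1 ?normr0 ?mulr1 ?mulr0.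
  + by exists (seg (L + 1)) => // t nt; rewrite indicE memNset ?mulr0.
- move=> n t; rewrite indicE; case: (boolP (t \in _)) => [/set_mem tS|tS].
    rewrite mulr1; apply: bfs_Rintegral => //.
      by case: (bF n) => mF _ _; exact: measurable_fun_pair2.
    by move=> x nx; apply: FL => -[/= _ /segP].
  rewrite mulr0 (@eq_Rintegral _ _ _ _ _ (cst 0)) ?Rintegral_cst// ?mul0r ?normr0//.
  move=> x _; apply: FL => -[/= /segP tS' _].
  by move/negP: tS; apply; exact/mem_set.
- move=> t; under eq_fun do (under eq_Rintegral do rewrite -FE).
  apply: (@shift_L1_1 _ (fun x => f (t, x)) u M L) => //.
  + exact: measurable_fun_pair2.
  + move=> x Lx; apply: fL => -[_ /=]; by rewrite leNgt Lx.
Qed.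

Lemma swap_fst_L1 M L f (u : nat -> R) : bbox M L f ->
  (forall n, `|u n| <= 1) -> u n @[n --> \oo] --> 0 ->
  \int[leb1]_x \int[leb1]_t `|f (u n + t, x) - f (t, x)| @[n --> \oo] --> 0.
Proof.
move=> [mf fM fL] u1 u0.
apply: (@shift_snd_L1 M L (f \o (fun z => (z.2, z.1))) u) => //; split.
- by apply: measurableT_comp => //; 
  apply/measurable_fun_pairP; split => //=; [exact: measurable_snd|exact: measurable_fst].
- by move=> z; exact: fM.
- by move=> z nz; apply: fL => -[z1 z2]; exact: nz.
Qed.

(** One coordinate is shifted at a time; translation invariance reduces the first step to a shift of
    [f] itself in the first coordinate. *)
Lemma shift_L1 M L f (u : nat -> R * R) : bbox M L f ->
  (forall n, `|u n| <= 1) ->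
  (u n).1 @[n --> \oo] --> 0 -> (u n).2 @[n --> \oo] --> 0 ->
  \int[leb2]_z `|f (u n + z) - f z| @[n --> \oo] --> 0.
Proof.
move=> bf u1 cvg1 cvg2; have [mf fM fL] := bf.
have le1 n : `|(u n).1| <= 1 /\ `|(u n).2| <= 1.
  by move: (u1 n); rewrite prod_normE ge_max => /andP[].
have I1 := swap_fst_L1 bf (fun n => (le1 n).1) cvg1.
have I2 := shift_snd_L1 bf (fun n => (le1 n).2) cvg2.
have bs c : `|c| <= 1 -> bbox M (L + 1) (fun z => f (c + z)).
  move=> c1; have [mg gM gL] := bbox_shift c bf; split => // z nz.
  apply: gL => -[z1 z2].
  by apply: nz; split; rewrite (le_trans _ (lerD (lexx L) c1)).
have bd c : `|c| <= 1 -> bfs2 leb1 leb1 (fun z => `|f (c + z) - f z|).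
  move=> c1; apply: bfs2_norm; apply: bfs2D; first exact: bbox_bfs2 (bs _ c1).
  apply: (@bbox_bfs2 M L); split => [|z|z nz].
  - exact: measurableT_comp.
  - by rewrite normrN.
  - by rewrite fL ?oppr0.
have n1 n : `|(((u n).1, 0) : R * R)| <= 1.
  by rewrite prod_normE ge_max normr0 ler01 (le1 n).1.
have n2 n : `|((0, (u n).2) : R * R)| <= 1.
  by rewrite prod_normE ge_max normr0 ler01 (le1 n).2.
have addE (a b : R) z : (a, b) + z = (a + z.1, b + z.2) by [].
have uE n : ((u n).1, 0) + (0, (u n).2) = u n.
  by rewrite addE /= addr0 add0r; case: (u n).
have E1 n : \int[leb2]_z `|f (u n + z) - f ((0, (u n).2) + z)| =
    \int[leb1]_x \int[leb1]_t `|f ((u n).1 + t, x) - f (t, x)|.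
  transitivity (\int[leb2]_z `|f (((u n).1, 0) + z) - f z|).
    rewrite -[RHS](@Rintegral_leb2_shift _ (0, (u n).2)); last exact/bfs2_bfs/bd.
    by apply: eq_Rintegral => z _; rewrite addrA uE.
  rewrite -[LHS](bfs2_fubini2 (bd _ (n1 n))).
  by apply: eq_Rintegral => x _; apply: eq_Rintegral => t _; rewrite addE /= add0r.
have E2 n : \int[leb2]_z `|f ((0, (u n).2) + z) - f z| =
    \int[leb1]_t \int[leb1]_x `|f (t, (u n).2 + x) - f (t, x)|.
  rewrite -[LHS](bfs2_fubini1 (bd _ (n2 n))).
  by apply: eq_Rintegral => x _; apply: eq_Rintegral => t _; rewrite addE /= add0r.
have I12 := cvgD I1 I2; rewrite addr0 in I12.
apply: squeeze_cvgr; [|exact: (@cvg_cst _ 0)|exact: I12].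
apply: nearW => n; apply/andP; split.
  by apply: Rintegral_ge0.
change (\int[leb2]_z `|f (u n + z) - f z| <=
  \int[leb1]_x \int[leb1]_t `|f ((u n).1 + t, x) - f (t, x)| +
  \int[leb1]_t \int[leb1]_x `|f (t, (u n).2 + x) - f (t, x)|).
rewrite -E1 -E2 -bfs_RintegralD.
- apply: bfs_le; first exact/bfs2_bfs/bd.
  + apply: bfsD; last exact/bfs2_bfs/bd.
    by apply/bfs_norm/bfsB; exact/bbox_bfs/bs.
  + by move=> z; rewrite -{1}[f (u n + z)](subrK (f ((0, (u n).2) + z))) -addrA ler_normD.
- by apply/bfs_norm/bfsB; exact/bbox_bfs/bs.
- exact/bfs2_bfs/bd.
Qed.

End Shift_L1_plane.

(** * Test functions on the plane *)

Section Test_functions.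
Context {R : realType}.
Implicit Types f g : R * R -> R.

(** [d] is a margin: the cut-off lives in [box a L 0], the equations hold in [box a L (2 * d)], and
    for [a > 2 * d] the enlarged box still avoids [t = 0]. *)
Definition box (a L d : R) : set (R * R) :=
  [set z | a - d <= z.1 <= L + d /\ - L - d <= z.2 <= L + d].

Lemma compact_box a L d : compact (box a L d).
Proof.
rewrite (_ : box _ _ _ = `[a - d, L + d] `*` `[- L - d, L + d]); last first.
  by apply/seteqP; split => -[t x] /=; rewrite !in_itv.
by apply: compact_setX; exact: segment_compact.
Qed.

Lemma supp_sub f (C : set (R * R)) : compact C -> (forall z, f z != 0 -> C z) ->
  supp f `<=` C.
Proof.
move=> cC fC; have : closed C by apply: compact_closed => //; exact: norm_hausdorff.
by move=> /closure_id ->; exact: closure_subset.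
Qed.

Lemma test_functionI f (C Q : set (R * R)) : smooth f -> compact C ->
  (forall z, f z != 0 -> C z) -> C `<=` Q -> test_function Q f.
Proof.
move=> sf cC fC CQ; have fsC := supp_sub cC fC; split => //.
- by apply: subclosed_compact cC fsC; exact: closed_closure.
- exact: subset_trans CQ.
Qed.

Lemma test_function_neq0 Q f z : test_function Q f -> f z != 0 -> Q z.
Proof. by move=> [_ _ fQ] fz; apply/fQ/subset_closure. Qed.

Lemma derive_supp f v z : ~ supp f z -> 'D_v f z = 0.
Proof.
move=> nz; have oC : open (~` supp f) by exact/closed_openC/closed_closure.
transitivity ('D_v (cst 0) z : R); last exact: derive_cst.
apply: near_eq_derive.
have : nbhs z (~` supp f) by exact: open_nbhs_nbhs.
apply: filterS => w nw; apply/eqP/negPn/negP => fw.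
by apply: nw; exact: subset_closure.
Qed.

Lemma test_function_derive Q f v : test_function Q f -> test_function Q ('D_v f).
Proof.
move=> [sf cf fQ]; apply: (@test_functionI _ (supp f)) => //.
- exact: smooth_derive.
- by move=> z; apply: contra_neqP => /derive_supp.
Qed.

Lemma test_function_cont Q f : test_function Q f -> continuous f.
Proof. by move=> [/smooth_continuous]. Qed.

Lemma test_function_bbox Q f : test_function Q f -> exists M L, bbox M L f.
Proof.
move=> tf; have cf := test_function_cont tf; have [sf cK fQ] := tf.
have [M [_ hM]] : bounded_set (f @` supp f).
  by apply: compact_bounded; apply: continuous_compact => //; exact: continuous_subspaceT.
have [L [_ hL]] := compact_bounded cK.
exists `|M + 1|, (L + 1); split; first exact: continuous_measurable_fun2.
- move=> z; have [->|fz] := eqVneq (f z) 0; first by rewrite normr0.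
  rewrite (le_trans _ (ler_norm _))//; apply: (hM (M + 1)); first by rewrite ltrDl.
  by exists z => //; exact: subset_closure.
- move=> z nz; apply/eqP/negPn/negP => fz; apply: nz.
  have : `|z| <= L + 1 by apply: hL; [rewrite ltrDl|exact: subset_closure].
  by rewrite prod_normE ge_max => /andP[].
Qed.

Lemma test_functionM Q f g : test_function Q f -> smooth g ->
  test_function Q (fun z => f z * g z).
Proof.
move=> [sf cf fQ] sg; apply: (@test_functionI _ (supp f)) => //.
- exact: smoothM.
- move=> z; apply: contra_neqP => nz; rewrite (_ : f z = 0) ?mul0r//.
  by apply/eqP/negPn/negP => fz; apply: nz; exact: subset_closure.
Qed.

Lemma derive_dir f (v z : R * R) : differentiable f z ->
  'D_v f z = v.1 * dt2 f z + v.2 * dx2 f z.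
Proof.
move=> df; rewrite /dt2 /dx2 !deriveE//.
rewrite -[v.1 * _]linearZ -[v.2 * _]linearZ -linearD; congr ('d f z _).
by case: v => a b; congr pair; rewrite /= /GRing.scale/=; ring.
Qed.

Lemma derive_line f (p q : R * R) (s : R) : differentiable f (p + s *: q) ->
  is_derive s 1 (fun t => f (p + t *: q)) ('D_q f (p + s *: q)).
Proof.
move=> df; pose l (t : R) : R * R := p + t *: q.
have dl : differentiable l s by [].
have dc : differentiable (f \o l) s by exact: differentiable_comp.
have ids : is_diff s l ((0 : R -> R * R) + (fun t : R => t *: q)).
  exact: is_diffD.
apply: DeriveDef; first exact: diff_derivable.
rewrite deriveE//.
have -> : 'd (f \o l) s = 'd f (l s) \o 'd l s :> (R -> R) by exact: diff_comp.
by rewrite deriveE//= diff_val /= add0r scale1r.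
Qed.

End Test_functions.

(** * The interaction of two divergence-free fields *)

Section Interaction.
Context {R : realType}.
Local Notation leb2 := (@leb2 R).
Local Notation leb22 := ((@Defs.leb2 R) \x (@Defs.leb2 R))%E.

(** Integrals run over the whole plane while test functions are supported in [Q], so the fields may
    be altered freely outside [Q]. *)
Definition weak_div_free (Q : set (R * R)) (A1 A2 : R * R -> R) :=
  forall phi, test_function Q phi ->
    \int[leb2]_z (A1 z * dt2 phi z + A2 z * dx2 phi z) = 0.

Lemma measurable_diff_shift (eta : mplane R -> R) (c : R * R) :
  measurable_fun setT eta ->
  measurable_fun setT (fun x : mplane R * mplane R => eta (x.2 - x.1 - c)).
Proof.
move=> me.
have -> : (fun x : mplane R * mplane R => eta (x.2 - x.1 - c)) =
  eta \o (fun x : mplane R * mplane R =>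
    ((x.2.1 - x.1.1 - c.1, x.2.2 - x.1.2 - c.2) : mplane R)) by [].
apply: measurableT_comp => //.
apply/measurable_fun_pairP; split.
- apply: (@measurable_funB _ _ _ _ (fun x : mplane R * mplane R => x.2.1 - x.1.1)
    (cst c.1)); last exact: measurable_cst.
  apply: (@measurable_funB _ _ _ _ (fun x : mplane R * mplane R => x.2.1)
    (fun x => x.1.1)).
  + exact: (measurableT_comp measurable_fst measurable_snd).
  + exact: (measurableT_comp measurable_fst measurable_fst).
- apply: (@measurable_funB _ _ _ _ (fun x : mplane R * mplane R => x.2.2 - x.1.2)
    (cst c.2)); last exact: measurable_cst.
  apply: (@measurable_funB _ _ _ _ (fun x : mplane R * mplane R => x.2.2)
    (fun x => x.1.2)).
  + exact: (measurableT_comp measurable_snd measurable_snd).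
  + exact: (measurableT_comp measurable_snd measurable_fst).
Qed.

Lemma measurable_refl_shift (eta : mplane R -> R) (c : R * R) :
  measurable_fun setT eta -> measurable_fun setT (fun z : R * R => eta (c - z)).
Proof.
move=> me.
have -> : (fun z : R * R => eta (c - z)) =
  eta \o (fun z : mplane R => (c.1 - z.1, c.2 - z.2) : mplane R) by [].
apply: measurableT_comp => //; apply/measurable_fun_pairP; split.
- by apply: (@measurable_funB _ _ _ _ (cst c.1) fst).
- by apply: (@measurable_funB _ _ _ _ (cst c.2) snd).
Qed.

Section Slope.
Variables (Q : set (R * R)) (M : R) (A1 A2 B1 B2 phi eta : R * R -> R) (v : R * R).
Hypotheses (bA1 : bfs leb2 A1) (bA2 : bfs leb2 A2).
Hypotheses (bB1 : bfs leb2 B1) (bB2 : bfs leb2 B2).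
Hypotheses (A1M : forall z, `|A1 z| <= M) (A2M : forall z, `|A2 z| <= M).
Hypotheses (divA : weak_div_free Q A1 A2) (divB : weak_div_free Q B1 B2).
Hypotheses (tphi : test_function Q phi) (teta : test_function setT eta).
(** The bound 2 on [|s|] covers the open interval []-1, 2[] on which the derivative in [s] is taken.
    The points [z] with [phi z != 0] are those far enough inside [Q] to keep the shifted mollifier
    there. *)
Hypothesis teta_shift : forall z s, phi z != 0 -> `|s| <= 2 ->
  test_function Q (fun w => eta (w - z - s *: v)).

Let bphi : bfs leb2 phi.
Proof. by have [? [? /bbox_bfs]] := test_function_bbox tphi. Qed.

Let bdphi w : bfs leb2 ('D_w phi).
Proof. by have [? [? /bbox_bfs]] := test_function_bbox (test_function_derive w tphi). Qed.

Let beta : bfs leb2 eta.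
Proof. by have [? [? /bbox_bfs]] := test_function_bbox teta. Qed.

Let bdeta w : bfs leb2 ('D_w eta).
Proof. by have [? [? /bbox_bfs]] := test_function_bbox (test_function_derive w teta). Qed.

Let bk (f g h : R * R -> R) s : bfs leb2 f -> bfs leb2 g -> bfs leb2 h ->
  bfs2 leb2 leb2 (fun x => f x.1 * g x.2 * h (x.2 - x.1 - s *: v)).
Proof.
move=> bf bg [mh [K hK] _]; apply: bfs2M => //.
- exact: measurable_diff_shift.
- by exists K => x; exact: hK.
Qed.

(* With v, A, B as vectors, (v.grad) (A x B) = (v x B) (A.grad) - (v x A) (B.grad).
   So in the s-derivative of the integral of [moll s] the weak equation for A in w
   kills the first term, and the one for B in z turns the second into an integral
   of (v x A)(w) (B.grad phi)(z), without derivatives of eta. *)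
Definition moll s (x : mplane R * mplane R) :=
  phi x.1 * (A1 x.2 * B2 x.1 - A2 x.2 * B1 x.1) * eta (x.2 - x.1 - s *: v).

Let b := fun z => B1 z * dt2 phi z + B2 z * dx2 phi z.

Let bb : bfs leb2 b.
Proof. by apply: bfsD; apply: bfsM => //; exact: bdphi. Qed.

Let a := fun w => v.2 * A1 w - v.1 * A2 w.

Let ba : bfs leb2 a.
Proof. by apply: bfsB; exact: bfsZ. Qed.

Let bcross (k : mplane R * mplane R -> R) : measurable_fun setT k ->
  (exists K, forall x, `|k x| <= K) ->
  bfs2 leb2 leb2 (fun x => phi x.1 * (A1 x.2 * B2 x.1 - A2 x.2 * B1 x.1) * k x).
Proof.
move=> mk hk.
have -> : (fun x => phi x.1 * (A1 x.2 * B2 x.1 - A2 x.2 * B1 x.1) * k x) =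
  (fun x => (fun z => phi z * B2 z) x.1 * A1 x.2 * k x +
            (fun z => (-1) * (phi z * B1 z)) x.1 * A2 x.2 * k x).
  by apply/funext => x /=; ring.
apply: bfs2D.
- exact: bfs2M (bfsM bphi bB2) bA1 mk hk.
- exact: bfs2M (bfsZ (-1) (bfsM bphi bB1)) bA2 mk hk.
Qed.

Lemma bfs2_moll s : bfs2 leb2 leb2 (moll s).
Proof.
have [me [K hK] _] := beta; apply: bcross; first exact: measurable_diff_shift.
by exists K => x; exact: hK.
Qed.

Let dmoll (s : R) (x : (R * R) * (R * R)) :=
  phi x.1 * (A1 x.2 * B2 x.1 - A2 x.2 * B1 x.1) * 'D_(- v) eta (x.2 - x.1 - s *: v).

Let deta z : differentiable eta z.
Proof. by case: teta => /smooth_differentiable. Qed.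

Let dphi z : differentiable phi z.
Proof. by case: tphi => /smooth_differentiable. Qed.

Let moll_deriv (s : R) (x : (R * R) * (R * R)) :
  is_derive s (1 : R) (fun t : R => moll t x) (dmoll s x).
Proof.
have E (t : R) : x.2 - x.1 - t *: v = (x.2 - x.1) + t *: (- v) by rewrite scalerN.
rewrite /dmoll E (_ : (fun t : R => moll t x) =
  (phi x.1 * (A1 x.2 * B2 x.1 - A2 x.2 * B1 x.1)) \*:
    (fun t : R => eta (x.2 - x.1 + t *: (- v)))).
  by apply: is_deriveZ; apply: derive_line; exact: deta.
by apply/funext => t; rewrite /moll E.
Qed.

(** The factor [phi z] makes the identity hold for all [z]: where it is nonzero, the shifted
    mollifier is an admissible test function in [w]. *)
Let divA_shift (z : R * R) (s : R) : `|s| <= 2 ->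
  phi z * \int[leb2]_w (A1 w * dt2 eta (w - z - s *: v) + A2 w * dx2 eta (w - z - s *: v))
  = 0.
Proof.
move=> s2; have [->|phiz] := eqVneq (phi z) 0; first by rewrite mul0r.
suff -> : \int[leb2]_w (A1 w * dt2 eta (w - z - s *: v) +
    A2 w * dx2 eta (w - z - s *: v)) = 0 by rewrite mulr0.
have HA := divA (teta_shift phiz s2).
rewrite -[RHS]HA.
have E (w : R * R) : w - z - s *: v = (- z - s *: v) + 1 *: w.
  by rewrite scale1r -addrA [RHS]addrC.
have -> : (fun w => eta (w - z - s *: v)) = (fun w => eta ((- z - s *: v) + 1 *: w)).
  by apply/funext => w; rewrite E.
apply: eq_Rintegral => w _.
by rewrite /dt2 /dx2 !derive_affine// !mul1r -E.
Qed.

Let mrefl (w : R * R) (s : R) (h : R * R -> R) : bfs leb2 h ->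
  measurable_fun setT (fun z : R * R => h (w - z - s *: v)) /\
  exists K, forall z, `|h (w - z - s *: v)| <= K.
Proof.
move=> [mh [K hK] _]; split; last by exists K.
have -> : (fun z : R * R => h (w - z - s *: v)) = (fun z : R * R => h ((w - s *: v) - z)).
  by apply/funext => z; rewrite addrAC.
exact: measurable_refl_shift.
Qed.

Let mshift (z : R * R) (s : R) (h : R * R -> R) : bfs leb2 h ->
  measurable_fun setT (fun w : R * R => h (w - z - s *: v)) /\
  exists K, forall w, `|h (w - z - s *: v)| <= K.
Proof.
move=> [mh [K hK] _]; split; last by exists K.
have -> : (fun w : R * R => h (w - z - s *: v)) = (fun w : R * R => h ((- z - s *: v) + w)).
  by apply/funext => w; rewrite -addrA addrC.
exact: measurable_shift2.
Qed.

Let bB_refl (w : R * R) (s : R) : bfs leb2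
  (fun z => B1 z * dt2 eta (w - z - s *: v) + B2 z * dx2 eta (w - z - s *: v)).
Proof.
have [m1 h1] := mrefl w s (bdeta (1, 0)).
have [m2 h2] := mrefl w s (bdeta (0, 1)).
exact: bfsD (bfsMl bB1 m1 h1) (bfsMl bB2 m2 h2).
Qed.

Let bA_shift (z : R * R) (s : R) : bfs leb2
  (fun w => A1 w * dt2 eta (w - z - s *: v) + A2 w * dx2 eta (w - z - s *: v)).
Proof.
have [m1 h1] := mshift z s (bdeta (1, 0)).
have [m2 h2] := mshift z s (bdeta (0, 1)).
exact: bfsD (bfsMl bA1 m1 h1) (bfsMl bA2 m2 h2).
Qed.

(** The test function in [z] is [phi] times the reflected mollifier, supported where [phi] is.
    Reflection flips the sign of the gradient of [eta], so its term moves to the other side of the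
    equation. *)
Let divB_shift (w : R * R) (s : R) :
  \int[leb2]_z (phi z * (B1 z * dt2 eta (w - z - s *: v) + B2 z * dx2 eta (w - z - s *: v)))
  = \int[leb2]_z (b z * eta (w - z - s *: v)).
Proof.
have E (z : R * R) : w - z - s *: v = (w - s *: v) + (-1) *: z.
  by rewrite scaleN1r addrAC.
pose psi (z : R * R) := eta ((w - s *: v) + (-1) *: z).
have spsi : smooth psi by apply: smooth_affine; case: teta.
have dpsi z : differentiable psi z by exact: smooth_differentiable.
have := divB (test_functionM tphi spsi).
have -> : \int[leb2]_z (B1 z * dt2 (fun z => phi z * psi z) z +
    B2 z * dx2 (fun z => phi z * psi z) z) =
  \int[leb2]_z (b z * eta (w - z - s *: v) -
    phi z * (B1 z * dt2 eta (w - z - s *: v) + B2 z * dx2 eta (w - z - s *: v))).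
  apply: eq_Rintegral => z _.
  have D u : 'D_u (fun z => phi z * psi z) z =
      phi z * (- 'D_u eta (w - z - s *: v)) + eta (w - z - s *: v) * 'D_u phi z.
    rewrite (_ : (fun z => phi z * psi z) = phi * psi)// deriveM; last 2 first.
    - exact: diff_derivable.
    - exact: diff_derivable.
    by rewrite /psi derive_affine// mulN1r -E.
  by rewrite /dt2 /dx2 !D /b /dt2 /dx2; ring.
rewrite bfs_RintegralB.
- by move/eqP; rewrite subr_eq0 => /eqP.
- have [m h] := mrefl w s beta; exact: bfsMl bb m h.
- exact: bfsM bphi (bB_refl w s).
Qed.

Let slopeE s : `|s| <= 2 ->
  \int[leb22]_x dmoll s x = - \int[leb22]_x (b x.1 * a x.2 * eta (x.2 - x.1 - s *: v)).
Proof.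
move=> s2.
pose c z := phi z * (v.1 * B2 z - v.2 * B1 z).
have bc : bfs leb2 c by apply: bfsM => //; apply: bfsB; exact: bfsZ.
pose F1 (x : (R * R) * (R * R)) := phi x.1 * a x.2 *
  (B1 x.1 * dt2 eta (x.2 - x.1 - s *: v) + B2 x.1 * dx2 eta (x.2 - x.1 - s *: v)).
pose F2 (x : (R * R) * (R * R)) := c x.1 *
  (A1 x.2 * dt2 eta (x.2 - x.1 - s *: v) + A2 x.2 * dx2 eta (x.2 - x.1 - s *: v)).
pose F3 (x : (R * R) * (R * R)) := b x.1 * a x.2 * eta (x.2 - x.1 - s *: v).
have bF1 : bfs2 leb2 leb2 F1.
  have -> : F1 = (fun x : (R * R) * (R * R) =>
      (phi x.1 * B1 x.1) * a x.2 * dt2 eta (x.2 - x.1 - s *: v) +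
      (phi x.1 * B2 x.1) * a x.2 * dx2 eta (x.2 - x.1 - s *: v)).
    by apply/funext => x; rewrite /F1; ring.
  by apply: bfs2D; apply: (bk (f := fun z => phi z * _ z)) => //;
    [exact: bfsM|exact: bdeta|exact: bfsM|exact: bdeta].
have bF2 : bfs2 leb2 leb2 F2.
  have -> : F2 = (fun x : (R * R) * (R * R) =>
      c x.1 * A1 x.2 * dt2 eta (x.2 - x.1 - s *: v) +
      c x.1 * A2 x.2 * dx2 eta (x.2 - x.1 - s *: v)).
    by apply/funext => x; rewrite /F2; ring.
  by apply: bfs2D; apply: bk => //; exact: bdeta.
have bF3 : bfs2 leb2 leb2 F3 by exact: bk.
(* The planar identity stated at [moll], with [F2] carrying (A.grad) and [F1] carrying (B.grad); the
   factor -1 comes from the direction [- v]. *)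
have -> : \int[leb22]_x dmoll s x = \int[leb22]_x ((-1) * (F1 x + F2 x)).
  apply: eq_Rintegral => x _.
  rewrite /dmoll derive_dir// /F1 /F2 /c /a /=; ring.
have bF12 := bfs2D bF1 bF2.
rewrite RintegralZl//; last exact/bfs_integrable/bfs2_bfs.
rewrite mulN1r; congr (- _).
rewrite bfs_RintegralD; [|exact: bfs2_bfs|exact: bfs2_bfs].
(* [F2] is integrated in [w] first, where the equation for A applies; [F1], below, in [z] first, for
   the equation for B. *)
have -> : \int[leb22]_x F2 x = 0.
  rewrite -bfs2_fubini1//.
  rewrite (@eq_Rintegral _ _ _ _ _ (cst 0)) ?Rintegral_cst ?mul0r// => z _.
  transitivity (c z * \int[leb2]_w (A1 w * dt2 eta (w - z - s *: v) +
    A2 w * dx2 eta (w - z - s *: v))); last first.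
    by rewrite /c mulrAC divA_shift// mul0r.
  by rewrite -[RHS](RintegralZl (c z) measurableT (bfs_integrable (bA_shift z s))).
rewrite addr0 -bfs2_fubini2// -[RHS]bfs2_fubini2//.
apply: eq_Rintegral => w _.
have bphiB := bfsM bphi (bB_refl w s).
have [me he] := mrefl w s beta.
have bbe := bfsMl bb me he.
transitivity (a w * \int[leb2]_z (phi z *
    (B1 z * dt2 eta (w - z - s *: v) + B2 z * dx2 eta (w - z - s *: v)))).
  rewrite -[RHS](RintegralZl (a w) measurableT (bfs_integrable bphiB)).
  by apply: eq_Rintegral => z _; rewrite /F1 /= mulrA (mulrC (a w)).
rewrite divB_shift -[LHS](RintegralZl (a w) measurableT (bfs_integrable bbe)).
by apply: eq_Rintegral => z _; rewrite /F3 /= mulrA (mulrC (a w)).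
Qed.

(** [2 * M * |v|] bounds [a], and by translation invariance the integral in [w] of the shifted
    [|eta|] is the same for every [z]. *)
Let slope_bound s :
  `|\int[leb22]_x (b x.1 * a x.2 * eta (x.2 - x.1 - s *: v))| <=
  2 * M * `|v| * \int[leb2]_z `|b z| * \int[leb2]_z `|eta z|.
Proof.
have bF := bk s bb ba beta.
apply: le_trans (le_normr_Rintegral measurableT (bfs_integrable (bfs2_bfs bF))) _.
have bnF := bfs2_norm bF.
rewrite -[leLHS](bfs2_fubini1 bnF).
have aM w : `|a w| <= 2 * M * `|v|.
  have [v1 v2] : `|v.1| <= `|v| /\ `|v.2| <= `|v|.
    by rewrite prod_normE !le_max !lexx orbT.
  rewrite (le_trans (ler_normB _ _))// !normrM.
  rewrite [leRHS](_ : _ = `|v| * M + `|v| * M); last by ring.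
  by apply: lerD; apply: ler_pM.
have K0 : 0 <= 2 * M * `|v|.
  by rewrite !mulr_ge0//; exact: le_trans (A1M (0, 0)).
have bnb := bfs_norm bb; have bne := bfs_norm beta.
set K := 2 * M * `|v|; set I := \int[leb2]_z `|eta z|.
rewrite (_ : K * _ * I = \int[leb2]_z ((K * I) * `|b z|)); last first.
  by rewrite (RintegralZl (K * I) measurableT (bfs_integrable bnb)) mulrAC.
apply: bfs_le.
- exact: bfs2_int bnF.
- exact: bfsZ.
move=> z /=.
have [me he] := mshift z s beta.
have E w : w - z - s *: v = (- z - s *: v) + w by rewrite -addrA addrC.
have bes : bfs leb2 (fun w : R * R => `|eta (w - z - s *: v)|).
  have [? [L bbx]] := test_function_bbox teta.
  have := bbox_bfs (bbox_shift (- z - s *: v) bbx).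
  move/bfs_norm; congr bfs; apply/funext => w; by rewrite E.
rewrite (_ : K * I * `|b z| = \int[leb2]_w ((K * `|b z|) * `|eta (w - z - s *: v)|)); last first.
  rewrite (RintegralZl (K * `|b z|) measurableT (bfs_integrable bes)) mulrAC.
  congr (_ * _); rewrite /I -[LHS](Rintegral_leb2_shift (- z - s *: v) bne).
  by apply: eq_Rintegral => w _; rewrite E.
apply: bfs_le.
- exact: bfs2_l bnF.
- exact: bfsZ.
move=> w /=; rewrite !normrM ler_wpM2r// mulrC ler_wpM2r//; exact: aM.
Qed.

(** The mean value theorem on [[0, 1]] for the integral as a function of [s]. Since [eta] enters the
    bound only through its L1 norm, the estimate survives concentration of the mollifier. *)
Lemma slope : `|\int[leb22]_x moll 1 x - \int[leb22]_x moll 0 x| <=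
  2 * M * `|v| * \int[leb2]_z `|b z| * \int[leb2]_z `|eta z|.
Proof.
(* [K] involves the gradient of [eta]; it serves to dominate the integrand for differentiation under
   the integral and does not enter the estimate. *)
have [? [K hK] _] := bdeta (- v).
pose G (x : mplane R * mplane R) : R :=
  `|phi x.1 * (A1 x.2 * B2 x.1 - A2 x.2 * B1 x.1) * K|.
have K0 : 0 <= K by exact: le_trans (hK (0, 0)).
have bG : bfs2 leb2 leb2 G.
  apply: bfs2_norm; apply: (bcross (k := cst K)); first exact: measurable_cst.
  by exists `|K|.
have Ib (s : R) : `]-1, 2[%classic s -> `|s| <= 2.
  rewrite /= in_itv/= ler_norml => /andP[/ltW s1 /ltW ->].
  by rewrite andbT (le_trans _ s1)// lerN2 ler1n.
have intf (s : R) : `]-1, 2[%classic s -> (leb22).-integrable setT (EFin \o moll s).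
  by move=> _; exact/bfs_integrable/bfs2_bfs/bfs2_moll.
have derf (s : R) x : `]-1, 2[%classic s -> setT x -> derivable (moll ^~ x) s 1.
  by move=> _ _; have [] := moll_deriv s x.
have pE (s : R) x : partial1of2 moll s x = dmoll s x.
  by rewrite partial1of2E; have [_ ->] := moll_deriv s x.
have G0 x : 0 <= G x by exact: normr_ge0.
have G_ub (s : R) x : `]-1, 2[%classic s -> setT x -> `|partial1of2 moll s x| <= G x.
  by move=> _ _; rewrite pE /dmoll /G !normrM ler_wpM2l// (le_trans (hK _))// ler_norm.
have iG := bfs_integrable (bfs2_bfs bG).
pose H (s : R) := \int[leb22]_x moll s x.
have dH (s : R) : `]-1, 2[%classic s -> is_derive s (1 : R) H (\int[leb22]_x dmoll s x).
  move=> Is; apply: DeriveDef.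
    exact: (derivable_under_integral measurableT Is intf derf G0 iG G_ub).
  rewrite -derive1E (differentiation_under_integral measurableT Is intf derf G0 iG G_ub).
  by apply: eq_Rintegral => x _; rewrite -pE.
have sub (s : R) : s \in `[0, 1] -> `]-1, 2[%classic s.
  rewrite /= !in_itv/= => /andP[s0 s1].
  by rewrite (lt_le_trans _ s0) ?ltrN10// (le_lt_trans s1)// ltr1n.
pose H' (s : R) := \int[leb22]_x dmoll s x.
have dH' (s : R) : s \in `]0, 1[ -> is_derive s (1 : R) H (H' s).
  by move=> s01; apply/dH/sub/subset_itv_oo_cc.
have cH : {within `[0, 1], continuous H}.
  apply: derivable_within_continuous => s s01.
  by have [] := dH s (sub _ s01).
have [c c01 HE] := MVT ltr01 dH' cH.
have c2 : `|c| <= 2 by apply/Ib/sub/subset_itv_oo_cc.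
have HE' : H 1 - H 0 = - \int[leb22]_x (b x.1 * a x.2 * eta (x.2 - x.1 - c *: v)).
  by rewrite HE subr0 mulr1 -(slopeE c2).
change (`|H 1 - H 0| <= 2 * M * `|v| * \int[leb2]_z `|b z| * \int[leb2]_z `|eta z|).
rewrite HE' normrN; exact: slope_bound.
Qed.

End Slope.
End Interaction.

(** * Removal of the mollifier: the correlation is Lipschitz *)

Section Interaction_limit.
Context {R : realType}.
Local Notation leb2 := (@leb2 R).
Local Notation leb22 := ((@Defs.leb2 R) \x (@Defs.leb2 R))%E.

Lemma Rintegral_leb2_affine (f : mplane R -> R) (c : R * R) (e : R) : 0 < e ->
  bfs leb2 f -> \int[leb2]_z f z = e ^+ 2 * \int[leb2]_z f (c + e *: z).
Proof.
move=> e0.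
have bcomp g : bfs leb2 g -> bfs leb2 (fun z => g (c + e *: z)).
  move=> [mg [M gM] [S [mS Soo] gS]]; split.
  - have -> : (fun z => g (c + e *: z)) = g \o aff2 c e by [].
    by apply: measurableT_comp => //; exact: measurable_aff2.
  - by exists M.
  - exists (aff2 c e @^-1` S); last by move=> z; exact: gS.
    split; first by rewrite -[X in measurable X]setTI; exact: measurable_aff2.
    have e2 : 0 < e ^+ 2 by rewrite exprn_gt0.
    have HS : (Defs.leb2 S < +oo)%E by exact: Soo.
    rewrite (leb2_affine c e0 mS) in HS.
    rewrite ltey; apply/eqP => Hoo.
    have : ((e ^+ 2)%:E * Defs.leb2 (aff2 c e @^-1` S) < +oo)%E by exact: HS.
    have -> : Defs.leb2 (aff2 c e @^-1` S) = +oo%E by exact: Hoo.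
    by rewrite gt0_muley ?lte_fin// ltxx.
have ge0 g : bfs leb2 g -> (forall z, 0 <= g z) ->
    \int[leb2]_z g z = e ^+ 2 * \int[leb2]_z g (c + e *: z).
  move=> bg g0; have bgc := bcomp _ bg.
  have [mg _ _] := bg.
  have mg' : measurable_fun setT (EFin \o g) by exact/measurable_EFinP.
  have H := ge0_integral_leb2_affine c e0 mg' (fun z => g0 z).
  apply: EFin_inj; rewrite bfs_EFin// EFinM bfs_EFin//.
move=> bf.
(* [f] is the difference of the nonnegative functions [|f|] and [|f| - f], both in [bfs], to which
   the substitution rule for nonnegative integrands applies. *)
pose f1 z := `|f z|; pose f2 z := `|f z| - f z.
have b1 : bfs leb2 f1 by exact: bfs_norm.
have b2 : bfs leb2 f2 by exact: bfsB.
have -> : f = (fun z => f1 z - f2 z) by apply/funext => z; rewrite /f1 /f2; ring.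
rewrite (bfs_RintegralB b1 b2) (bfs_RintegralB (bcomp _ b1) (bcomp _ b2)).
rewrite mulrBr -(ge0 _ b1) => [|z]; last exact: normr_ge0.
by rewrite -(ge0 _ b2) => // z; rewrite /f2 subr_ge0 ler_norm.
Qed.

Lemma measurable_sum_shift (f : mplane R -> R) (c : R * R) (e : R) :
  measurable_fun setT f ->
  measurable_fun setT (fun x : mplane R * mplane R => f (c + e *: x.1 + x.2)).
Proof.
move=> mf.
have -> : (fun x : mplane R * mplane R => f (c + e *: x.1 + x.2)) =
  f \o (fun x : mplane R * mplane R =>
    ((c.1 + e * x.1.1) + x.2.1, (c.2 + e * x.1.2) + x.2.2) : mplane R) by [].
apply: measurableT_comp => //; apply/measurable_fun_pairP; split.
- apply: (@measurable_funD _ _ _ _ (fun x : mplane R * mplane R => c.1 + e * x.1.1)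
    (fun x => x.2.1)).
  + apply: (measurableT_comp (measurable_aff1 c.1 e)).
    exact: (measurableT_comp measurable_fst measurable_fst).
  + exact: (measurableT_comp measurable_fst measurable_snd).
- apply: (@measurable_funD _ _ _ _ (fun x : mplane R * mplane R => c.2 + e * x.1.2)
    (fun x => x.2.2)).
  + apply: (measurableT_comp (measurable_aff1 c.2 e)).
    exact: (measurableT_comp measurable_snd measurable_fst).
  + exact: (measurableT_comp measurable_snd measurable_snd).
Qed.

Lemma Rintegral_sqr_eq0 (f g : R * R -> R) : bfs leb2 f -> measurable_fun setT g ->
  \int[leb2]_z (f z * f z) = 0 -> \int[leb2]_z (f z * g z) = 0.
Proof.
move=> bf mg; have [mf _ _] := bf; have bff := bfsM bf bf.
have [mff _ _] := bff.
move=> I0.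
have : (\int[leb2]_z `|(f z * f z)%:E| = 0)%E.
  transitivity (\int[leb2]_z (f z * f z)%:E)%E.
    by apply: eq_integral => z _; rewrite abse_EFin ger0_norm// -expr2 sqr_ge0.
  by rewrite -bfs_EFin// I0.
move/(ae_eq_integral_abs leb2 measurableT (proj2 (measurable_EFinP _ _) mff)) => ae0.
rewrite /Rintegral (_ : (\int[leb2]_z (f z * g z)%:E = \int[leb2]_z (cst 0 z))%E).
  by rewrite integral0.
apply: ae_eq_integral => //.
- by apply/measurable_EFinP; exact: measurable_funM.
- apply: filterS ae0 => z /(_ I) /= [] /eqP; rewrite mulf_eq0 orbb => /eqP fz _.
  by rewrite fz mul0r.
Qed.

End Interaction_limit.

Lemma itv_widen {R : realType} (a b d w : R) : 0 < d -> a - 0 <= w <= b + 0 ->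
  a - 2 * d <= w <= b + 2 * d.
Proof. by lra. Qed.

Lemma bfs2_intr d1 d2 (T1 : measurableType d1) (T2 : measurableType d2) {R : realType}
  (m1 : {sigma_finite_measure set T1 -> \bar R})
  (m2 : {sigma_finite_measure set T2 -> \bar R}) (F : T1 * T2 -> R) :
  bfs2 m1 m2 F -> bfs m2 (fun y => \int[m1]_x F (x, y)).
Proof.
move=> bF; have [mF [M FM] [S1 [S2 [mS1 mS2 oo1 oo2 FS]]]] := bF; split.
- apply/measurable_EFinP.
  rewrite (_ : _ \o _ = fubini_G m1 (EFin \o F)).
    exact: measurable_fubini_G (bfs_integrable (bfs2_bfs bF)).
  by apply/funext => x; exact: bfs2_EFin_r bF.
- exists (M * fine (m1 S1)) => y; apply: bfs_Rintegral => //.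
  + exact: measurable_fun_pair1.
  + by move=> x S1x; apply: FS => -[].
- exists S2 => // y S2y; rewrite (@eq_Rintegral _ _ _ _ _ (cst 0)).
    by rewrite Rintegral_cst// mul0r.
  by move=> x _; apply: FS => -[].
Qed.

Lemma itv_add2 {R : realType} (a b d w z t : R) : a <= z <= b ->
  `|w - z - t| <= d -> `|t| <= d -> a - 2 * d <= w <= b + 2 * d.
Proof. by rewrite !ler_norml; lra. Qed.

Section Interaction_lipschitz.
Context {R : realType}.
Local Notation leb2 := (@leb2 R).
Local Notation leb22 := ((@Defs.leb2 R) \x (@Defs.leb2 R))%E.
Variables (a L d M N : R) (A1 A2 B1 B2 phi : R * R -> R).
Hypotheses (d0 : 0 < d) (bA1 : bbox M N A1) (bA2 : bbox M N A2).
Hypotheses (bB1 : bbox M N B1) (bB2 : bbox M N B2).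
Hypotheses (divA : weak_div_free (box a L (2 * d)) A1 A2).
Hypotheses (divB : weak_div_free (box a L (2 * d)) B1 B2).
Hypothesis tphi : test_function (box a L 0) phi.

Definition cross (w z : R * R) := A1 w * B2 z - A2 w * B1 z.

Definition corr (y : R * R) := \int[leb2]_z (phi z * cross (y + z) z).

Let bfA1 : bfs leb2 A1. Proof. exact: bbox_bfs bA1. Qed.
Let bfA2 : bfs leb2 A2. Proof. exact: bbox_bfs bA2. Qed.
Let bfB1 : bfs leb2 B1. Proof. exact: bbox_bfs bB1. Qed.
Let bfB2 : bfs leb2 B2. Proof. exact: bbox_bfs bB2. Qed.

Let bphi : bfs leb2 phi.
Proof. by have [? [? /bbox_bfs]] := test_function_bbox tphi. Qed.

Let bphi2 : bfs leb2 (fun z => phi z * phi z).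
Proof. exact: bfsM. Qed.

Let bcrossc y : bfs leb2 (fun z => phi z * cross (y + z) z).
Proof.
have bs (f : R * R -> R) : bbox M N f -> measurable_fun setT (fun z => f (y + z)) /\
    exists K, forall z, `|f (y + z)| <= K.
  by move=> [mf fM _]; split; [exact: measurable_shift2|exists M].
have [m1 h1] := bs _ bA1; have [m2 h2] := bs _ bA2.
have := bfsB (bfsMl (bfsM bphi bfB2) m1 h1) (bfsMl (bfsM bphi bfB1) m2 h2).
by congr bfs; apply/funext => z; rewrite /cross; ring.
Qed.

Let crossM w z : `|cross w z| <= 2 * M ^+ 2.
Proof.
have [_ a1 _] := bA1; have [_ a2 _] := bA2.
have [_ b1 _] := bB1; have [_ b2 _] := bB2.
rewrite (le_trans (ler_normB _ _))// !normrM.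
rewrite [leRHS](_ : _ = M * M + M * M); last by ring.
by apply: lerD; apply: ler_pM.
Qed.

Let corr_diff y y' :
  `|corr y - corr y'| <= \int[leb2]_z (`|phi z| * `|cross (y + z) z - cross (y' + z) z|).
Proof.
rewrite /corr -bfs_RintegralB//.
apply: le_trans (le_normr_Rintegral measurableT _) _.
  exact: bfs_integrable (bfsB _ _).
apply: bfs_le => [||z].
- by apply: bfs_norm; exact: bfsB.
- have := bfs_norm (bfsB (bcrossc y) (bcrossc y')).
  by congr bfs; apply/funext => z; rewrite -mulrBr normrM.
- by rewrite -mulrBr normrM.
Qed.

Let corrM : exists K, forall y, `|corr y| <= K.
Proof.
exists (\int[leb2]_z (2 * M ^+ 2 * `|phi z|)) => y.
apply: le_trans (le_normr_Rintegral measurableT (bfs_integrable (bcrossc y))) _.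
apply: bfs_le => [||z].
- exact: bfs_norm.
- by apply: bfsZ; exact: bfs_norm.
- by rewrite normrM mulrC ler_wpM2r//; exact: crossM.
Qed.

(** Only A is shifted in [corr], while [phi] and B stay fixed and bounded, so continuity of
    translations in L1, applied to [A1] and [A2], suffices. *)
Let corr_cvg y (u : nat -> R * R) : (forall n, `|u n| <= 1) ->
  (u n).1 @[n --> \oo] --> 0 -> (u n).2 @[n --> \oo] --> 0 ->
  corr (y + u n) @[n --> \oo] --> corr y.
Proof.
move=> u1 c1 c2.
have I1 := shift_L1 bA1 u1 c1 c2; have I2 := shift_L1 bA2 u1 c1 c2.
have [_ [P phiP] _] := bphi.
have P0 : 0 <= P by exact: le_trans (phiP (0, 0)).
have M0 : 0 <= M by have [_ a1 _] := bA1; exact: le_trans (a1 (0, 0)).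
have I12 := cvgD I1 I2; rewrite addr0 in I12.
have I3 : P * M * (\int[leb2]_z `|A1 (u n + z) - A1 z| +
    \int[leb2]_z `|A2 (u n + z) - A2 z|) @[n --> \oo] --> P * M * 0.
  by apply: cvgM; [exact: cvg_cst|exact: I12].
rewrite mulr0 in I3.
apply/subr_cvg0; apply: norm_cvg0; apply: squeeze_cvgr; [|exact: (@cvg_cst _ 0)|exact: I3].
apply: nearW => n; apply/andP; split; first exact: normr_ge0.
have bd (f : R * R -> R) : bbox M N f -> bfs leb2 (fun z => `|f (u n + z) - f z|).
  by move=> bf; apply/bfs_norm/bfsB; [exact: bbox_bfs (bbox_shift _ bf)|exact: bbox_bfs bf].
have bdy (f : R * R -> R) : bbox M N f ->
    bfs leb2 (fun z => `|f (y + u n + z) - f (y + z)|).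
  by move=> bf; apply/bfs_norm/bfsB; exact: bbox_bfs (bbox_shift _ bf).
have E (f : R * R -> R) : bbox M N f -> \int[leb2]_z `|f (u n + z) - f z| =
    \int[leb2]_z `|f (y + u n + z) - f (y + z)|.
  move=> bf; rewrite -(Rintegral_leb2_shift y (bd _ bf)).
  by apply: eq_Rintegral => z _; rewrite addrA (addrC (u n)).
rewrite /= (E _ bA1) (E _ bA2) -bfs_RintegralD; [|exact: bdy|exact: bdy].
rewrite -(RintegralZl (P * M) measurableT); last first.
  by apply: bfs_integrable; apply: bfsD; exact: bdy.
apply: le_trans (corr_diff _ _) _; apply: bfs_le => [||z].
- have := bfs_norm (bfsB (bcrossc (y + u n)) (bcrossc y)).
  by congr bfs; apply/funext => z; rewrite -mulrBr normrM.
- by apply: bfsZ; apply: bfsD; exact: bdy.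
- rewrite -mulrA ler_pM// /cross.
  have [_ b1 _] := bB1; have [_ b2 _] := bB2.
  rewrite [X in `|X|](_ : _ = B2 z * (A1 (y + u n + z) - A1 (y + z)) -
    B1 z * (A2 (y + u n + z) - A2 (y + z))); last by ring.
  by rewrite (le_trans (ler_normB _ _))// [leRHS]mulrDr !normrM lerD// ler_wpM2r.
Qed.

(* phi ^+ 2 itself serves as mollifier: if its integral is 0, then phi = 0 almost
   everywhere and there is nothing to prove. *)
Definition etae (e : R) (h : R * R) := phi (0 + e^-1 *: h) * phi (0 + e^-1 *: h).

Let I2 := \int[leb2]_h (phi h * phi h).

Let I2_ge0 : 0 <= I2.
Proof. by apply: Rintegral_ge0 => z _; rewrite -expr2 sqr_ge0. Qed.

Let etae_scale e h : 0 < e -> etae e (e *: h) = phi h * phi h.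
Proof. by move=> e0; rewrite /etae add0r scalerA mulVf ?gt_eqF// scale1r. Qed.

Let smooth_etae e : smooth (etae e).
Proof.
by apply: smoothM; apply: smooth_affine; case: tphi.
Qed.

Let etae_supp Lm e h : 0 < e -> (forall z, ~ (`|z.1| <= Lm /\ `|z.2| <= Lm) -> phi z = 0) ->
  etae e h != 0 -> `|h.1| <= e * Lm /\ `|h.2| <= e * Lm.
Proof.
move=> e0 pL; rewrite /etae add0r mulf_eq0 orbb => ph.
have [h1 h2] : `|e^-1 * h.1| <= Lm /\ `|e^-1 * h.2| <= Lm.
  by apply: contrapT => nh; move: ph; rewrite (pL (e^-1 *: h) nh) eqxx.
by split; [move: h1|move: h2]; rewrite normrM gtr0_norm ?invr_gt0// ler_pdivrMl.
Qed.

Let etae_test e Lm : 0 < e -> (forall z, ~ (`|z.1| <= Lm /\ `|z.2| <= Lm) -> phi z = 0) ->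
  test_function setT (etae e).
Proof.
move=> e0 pL; apply: (@test_functionI _ _ (box (- (e * Lm)) (e * Lm) 0)) => //.
- exact: compact_box.
- move=> z /(etae_supp e0 pL) [z1 z2].
  by rewrite /box /= !subr0 !addr0 -!ler_norml.
Qed.

(** A point [w] of the support differs from [z] by [s *: v], of norm at most [2 * (d / 2)], plus a
    vector of norm at most [e * Lm <= d]: this is the origin of the margin [2 * d]. *)
Let etae_shift_test e Lm v z s : 0 < e -> e * Lm <= d -> `|v| < d / 2 ->
  (forall z, ~ (`|z.1| <= Lm /\ `|z.2| <= Lm) -> phi z = 0) ->
  phi z != 0 -> `|s| <= 2 ->
  test_function (box a L (2 * d)) (fun w => etae e (w - z - s *: v)).
Proof.
move=> e0 ed vd pL phiz s2.
have zb := test_function_neq0 tphi phiz.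
have sm : smooth (fun w => etae e (w - z - s *: v)).
  have -> : (fun w => etae e (w - z - s *: v)) =
      (fun w => etae e ((- z - s *: v) + 1 *: w)).
    by apply/funext => w; rewrite scale1r -addrA addrC.
  by apply: smooth_affine; exact: smooth_etae.
refine (@test_functionI _ _ _ _ sm (@compact_box R a L (2 * d)) _ _) => //.
move=> w /(etae_supp e0 pL) [/= w1 w2].
have sv : `|s *: v| <= d.
  rewrite normrZ [leRHS](_ : d = 2 * (d / 2)); last by field.
  by rewrite ler_pM// ltW.
move: sv; rewrite prod_normE ge_max => /andP[/= sv1 sv2].
move: zb; rewrite /box /= !subr0 !addr0 => -[z1 z2].
split; first exact: itv_add2 z1 (le_trans w1 ed) sv1.
exact: itv_add2 z2 (le_trans w2 ed) sv2.
Qed.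

(** An average of [corr] around [y] at scale [e], of total weight [I2]; it is not normalised, as
    [I2] may be 0. *)
Let J (e : R) (y : R * R) := \int[leb2]_h (phi h * phi h * corr (y + e *: h)).

Let bF (e : R) (y : R * R) : bfs2 leb2 leb2
  (fun x => phi x.1 * phi x.1 * phi x.2 * cross (y + e *: x.1 + x.2) x.2).
Proof.
have bs (f : R * R -> R) : bbox M N f ->
    measurable_fun setT (fun x : mplane R * mplane R => f (y + e *: x.1 + x.2)) /\
    exists K, forall x : (R * R) * (R * R), `|f (y + e *: x.1 + x.2)| <= K.
  by move=> [mf fM _]; split; [exact: measurable_sum_shift|exists M].
have [m1 h1] := bs _ bA1; have [m2 h2] := bs _ bA2.
have := bfs2D (bfs2M bphi2 (bfsM bphi bfB2) m1 h1)
  (bfs2M bphi2 (bfsZ (-1) (bfsM bphi bfB1)) m2 h2).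
by congr bfs2; apply/funext => x; rewrite /cross /=; ring.
Qed.

Let JE e y : J e y = \int[leb2]_h \int[leb2]_z
  (phi h * phi h * phi z * cross (y + e *: h + z) z).
Proof.
apply: eq_Rintegral => h _.
rewrite /corr -(RintegralZl (phi h * phi h) measurableT); last first.
  exact/bfs_integrable/bcrossc.
by apply: eq_Rintegral => z _; rewrite mulrA.
Qed.

Let bJ e y : bfs leb2 (fun h => phi h * phi h * corr (y + e *: h)).
Proof.
have := bfs2_int (bF e y); congr bfs; apply/funext => h.
rewrite /corr -(RintegralZl (phi h * phi h) measurableT); last first.
  exact/bfs_integrable/bcrossc.
by apply: eq_Rintegral => z _; rewrite mulrA.
Qed.

(** Substitution [w = z + s *: v + e *: h] for fixed [z], with Jacobian [e ^+ 2], and an exchange of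
    the integrals in [z] and [h]. *)
Let mollE e v s Lm : 0 < e ->
  (forall z, ~ (`|z.1| <= Lm /\ `|z.2| <= Lm) -> phi z = 0) ->
  \int[leb22]_x moll A1 A2 B1 B2 phi (etae e) v s x = e ^+ 2 * J e (s *: v).
Proof.
move=> e0 pL; have te := etae_test e0 pL.
have bm := bfs2_moll v bfA1 bfA2 bfB1 bfB2 tphi te s.
rewrite -(bfs2_fubini1 bm).
transitivity (\int[leb2]_z (e ^+ 2 * \int[leb2]_h
  (phi h * phi h * phi z * cross (s *: v + e *: h + z) z))).
  apply: eq_Rintegral => z _.
  rewrite (Rintegral_leb2_affine (z + s *: v) e0 (bfs2_l z bm)).
  congr (_ * _); apply: eq_Rintegral => h _.
  rewrite /moll /= (_ : z + s *: v + e *: h - z - s *: v = e *: h); last first.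
    by rewrite -addrA -opprD addrAC subrr add0r.
  rewrite etae_scale// /cross (_ : z + s *: v + e *: h = s *: v + e *: h + z); last first.
    by rewrite -addrA addrC.
  by ring.
have bsw := bF e (s *: v).
have H := bfs2_swap bsw.
rewrite JE.
transitivity (e ^+ 2 * \int[leb2]_z \int[leb2]_h
  (phi h * phi h * phi z * cross (s *: v + e *: h + z) z)); last first.
  by congr (_ * _); exact: esym H.
apply: RintegralZl => //; apply: bfs_integrable.
exact: bfs2_intr bsw.
Qed.

(** Dominated convergence in [h]. On the support of [phi] the bound [u n * Lm <= 1] keeps [u n *: h]
    of norm at most 1, as [corr_cvg] demands. *)
Let J_cvg (u : nat -> R) Lm y :
  (forall z, ~ (`|z.1| <= Lm /\ `|z.2| <= Lm) -> phi z = 0) ->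
  (forall n, 0 < u n /\ u n * Lm <= 1) -> u n @[n --> \oo] --> 0 ->
  J (u n) y @[n --> \oo] --> I2 * corr y.
Proof.
move=> pL u1 u0.
have [K cK] := corrM.
have E n : J (u n) y - I2 * corr y =
    \int[leb2]_h (phi h * phi h * (corr (y + u n *: h) - corr y)).
  rewrite /I2 -(RintegralZr (corr y) measurableT (bfs_integrable bphi2)).
  rewrite -bfs_RintegralB//.
    by apply: eq_Rintegral => h _; rewrite mulrBr.
  have := bfsZ (corr y) bphi2.
  by congr bfs; apply/funext => h; rewrite mulrC.
apply/subr_cvg0; under eq_fun do rewrite E.
apply: (@bfs_cvg0 _ _ _ leb2 _ (fun h => (K + K) * (phi h * phi h))).
- move=> n; have [mJ _ _] := bJ (u n) y; have [mp _ _] := bphi2.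
  have -> : (fun h => phi h * phi h * (corr (y + u n *: h) - corr y)) =
    (fun h => phi h * phi h * corr (y + u n *: h) - phi h * phi h * corr y).
    by apply/funext => h; rewrite mulrBr.
  apply: measurable_funB => //; apply: measurable_funM => //.
- exact: bfsZ.
- move=> n h; have p0 : 0 <= phi h * phi h by rewrite -expr2 sqr_ge0.
  rewrite normrM (ger0_norm p0) [leRHS]mulrC ler_wpM2l//.
  by rewrite (le_trans (ler_normB _ _))// lerD.
- move=> h; have [hL|/pL ph] := pselect (`|h.1| <= Lm /\ `|h.2| <= Lm); last first.
    by under eq_fun do rewrite ph !mul0r; exact: cvg_cst.
  rewrite -[X in _ --> X](mulr0 (phi h * phi h)); apply: cvgM; first exact: cvg_cst.
  apply/subr_cvg0; apply: corr_cvg.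
  + move=> n; have [un0 unL] := u1 n.
    have hl : `|h| <= Lm by rewrite prod_normE ge_max; apply/andP.
    rewrite normrZ (gtr0_norm un0); apply: le_trans unL.
    by apply: ler_wpM2l => //; exact: ltW.
  + by rewrite -(mul0r h.1); apply: cvgM => //; exact: cvg_cst.
  + by rewrite -(mul0r h.2); apply: cvgM => //; exact: cvg_cst.
Qed.

(** Both [mollE] and the L1 norm of [etae e] carry the factor [e ^+ 2], so [slope] gives a Lipschitz
    bound for [J] that is uniform in [e]. In the limit both sides carry [I2], which cancels. *)
Lemma corr_lipschitz : exists K, forall v, `|v| < d / 2 ->
  `|corr v - corr 0| <= K * `|v|.
Proof.
have [I0|I0] := eqVneq I2 0.
  exists 0 => v vd; suff c0 y : corr y = 0 by rewrite !c0 subrr normr0 mul0r.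
  apply: Rintegral_sqr_eq0 => //.
  have bs (f : R * R -> R) : bbox M N f -> measurable_fun setT (fun z => f (y + z)).
    by move=> [mf _ _]; exact: measurable_shift2.
  have [mb1 _ _] := bB1; have [mb2 _ _] := bB2.
  by apply: measurable_funB; apply: measurable_funM => //; exact: bs.
have I2_gt0 : 0 < I2 by rewrite lt_neqAle eq_sym I0 I2_ge0.
pose b z := B1 z * dt2 phi z + B2 z * dx2 phi z.
exists (2 * M * \int[leb2]_z `|b z|) => v vd.
have tphi2 : test_function (box a L (2 * d)) phi.
  have [sf cf fb] := tphi; split => //; apply: subset_trans fb _.
  by move=> z [z1 z2]; split; exact: itv_widen.
have [? [Lm [_ _ pL]]] := test_function_bbox tphi.
have [_ A1M _] := bA1; have [_ A2M _] := bA2.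
(* Starting the harmonic sequence at [N0] makes [u n * Lm] at most 1 and at most [d] for every
   [n]. *)
pose N0 := (Num.truncn (Num.max (Lm / d) Lm)).+1.
have N0L : Lm / d <= N0%:R /\ Lm <= N0%:R.
  have : Num.max (Lm / d) Lm < N0%:R by exact: truncnS_gt.
  by rewrite gt_max => /andP[/ltW ? /ltW].
pose u n : R := ((n + N0).+1%:R)^-1.
have u_gt0 n : 0 < u n by rewrite invr_gt0.
have leN n : N0%:R <= (n + N0).+1%:R :> R by rewrite ler_nat ltnW// ltnS leq_addl.
have u1 n : u n * Lm <= 1.
  by rewrite ler_pdivrMl// mulr1 (le_trans N0L.2).
have ud n : u n * Lm <= d.
  rewrite ler_pdivrMl// -ler_pdivrMr//; exact: le_trans N0L.1 (leN n).
have u0 : u n @[n --> \oo] --> 0.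
  have := @cvg_harmonic R; rewrite -(@cvg_shiftn N0 _ (@harmonic R)).
  exact.
have C1 := @J_cvg u Lm v pL (fun n => conj (u_gt0 n) (u1 n)) u0.
have C0 := @J_cvg u Lm 0 pL (fun n => conj (u_gt0 n) (u1 n)) u0.
have C : `|J (u n) v - J (u n) 0| @[n --> \oo] --> `|I2 * corr v - I2 * corr 0|.
  exact: cvg_norm (cvgB C1 C0).
have bnd n : `|J (u n) v - J (u n) 0| <= 2 * M * `|v| * \int[leb2]_z `|b z| * I2.
  have e0 := u_gt0 n; have te := etae_test e0 pL.
  have e2 : 0 < u n ^+ 2 by rewrite exprn_gt0.
  have := @slope R _ M A1 A2 B1 B2 phi (etae (u n)) v bfA1 bfA2 bfB1 bfB2
    A1M A2M divA divB tphi2 te (fun z s => etae_shift_test e0 (ud n) vd pL).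
  rewrite !(mollE _ _ e0 pL) scale1r scale0r.
  have -> : \int[leb2]_z `|etae (u n) z| = u n ^+ 2 * I2.
    have bet : bfs leb2 (etae (u n)).
      by have [? [? /bbox_bfs]] := test_function_bbox te.
    rewrite (Rintegral_leb2_affine 0 e0 (bfs_norm bet)); congr (_ * _).
    apply: eq_Rintegral => h _; rewrite add0r etae_scale// ger0_norm//.
    by rewrite -expr2 sqr_ge0.
  by rewrite -mulrBr normrM gtr0_norm// mulrCA ler_pM2l.
have : `|I2 * corr v - I2 * corr 0| <= 2 * M * `|v| * \int[leb2]_z `|b z| * I2.
  by apply: (cvgr_to_le C); exact: nearW.
rewrite -mulrBr normrM gtr0_norm// mulrC ler_pM2r// => H.
by apply: le_trans H _; rewrite mulrAC.
Qed.

End Interaction_lipschitz.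

(** * The cross product of the increments of both fields *)

Section Energy.
Context {R : realType}.
Local Notation leb2 := (@leb2 R).

Lemma test_function_lipschitz Q (phi : R * R -> R) : test_function Q phi ->
  exists K, 0 <= K /\ forall z y, `|phi (z + y) - phi z| <= K * `|y|.
Proof.
move=> tphi.
have [K1 [L1 [_ h1 _]]] := test_function_bbox (test_function_derive (1, 0) tphi).
have [K2 [L2 [_ h2 _]]] := test_function_bbox (test_function_derive (0, 1) tphi).
have K1_ge0 : 0 <= K1 by exact: le_trans (h1 (0, 0)).
have K2_ge0 : 0 <= K2 by exact: le_trans (h2 (0, 0)).
have dphi z : differentiable phi z by case: tphi => /smooth_differentiable.
exists (K1 + K2); split => [|z y]; first exact: addr_ge0.
pose g (s : R) := phi (z + s *: y).
have dg (s : R) : is_derive s (1 : R) g ('D_y phi (z + s *: y)).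
  exact: derive_line.
have dg01 (s : R) : s \in `]0, 1[ -> is_derive s (1 : R) g ('D_y phi (z + s *: y)) by [].
have cg : {within `[0, 1], continuous g}.
  by apply: derivable_within_continuous => s _; have [] := dg s.
have [c _] := MVT ltr01 dg01 cg.
rewrite /g scale1r scale0r addr0 subr0 mulr1 => ->.
have [y1 y2] : `|y.1| <= `|y| /\ `|y.2| <= `|y|.
  by rewrite prod_normE !le_max !lexx orbT.
rewrite derive_dir//; apply: le_trans (ler_normD _ _) _; rewrite !normrM mulrDl.
apply: lerD; rewrite mulrC; apply: ler_pM => //; [exact: h1|exact: h2].
Qed.

Variables (a L d M N : R) (A1 A2 B1 B2 phi : R * R -> R).
Hypotheses (d0 : 0 < d) (bA1 : bbox M N A1) (bA2 : bbox M N A2).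
Hypotheses (bB1 : bbox M N B1) (bB2 : bbox M N B2).
Hypotheses (divA : weak_div_free (box a L (2 * d)) A1 A2).
Hypotheses (divB : weak_div_free (box a L (2 * d)) B1 B2).
Hypothesis tphi : test_function (box a L 0) phi.

Let X w z := cross A1 A2 B1 B2 w z.

Let bphi : bfs leb2 phi.
Proof. by have [? [? /bbox_bfs]] := test_function_bbox tphi. Qed.

Let bX y y' : bfs leb2 (fun z => phi z * X (y + z) (y' + z)).
Proof.
have bs (f : R * R -> R) c : bbox M N f -> bfs leb2 (fun z => f (c + z)).
  by move=> bf; exact: bbox_bfs (bbox_shift _ bf).
apply: bfsM => //; apply: bfsB; apply: bfsM; exact: bs.
Qed.

(** Both arguments move together, so translation invariance puts the shift on [phi], which is
    Lipschitz. *)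
Let diag_lipschitz : exists K, forall y,
  `|\int[leb2]_z (phi z * X (y + z) (y + z)) - \int[leb2]_z (phi z * X (0 + z) (0 + z))|
    <= K * `|y|.
Proof.
have [K [K0 hK]] := test_function_lipschitz tphi.
have bXd : bfs leb2 (fun z => X z z).
  by apply: bfsB; apply: bfsM; [exact: bbox_bfs bA1|exact: bbox_bfs bB2|
    exact: bbox_bfs bA2|exact: bbox_bfs bB1].
exists (\int[leb2]_z (K * `|X z z|)) => y.
have -> : \int[leb2]_z (phi z * X (y + z) (y + z)) =
    \int[leb2]_z (phi (- y + z) * X z z).
  have bf : bfs leb2 (fun z => phi (- y + z) * X z z).
    have [? [? /(bbox_shift (- y)) /bbox_bfs bs]] := test_function_bbox tphi.
    exact: bfsM.
  rewrite -(Rintegral_leb2_shift y bf).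
  by apply: eq_Rintegral => z _; rewrite addrA addNr add0r.
have bf : bfs leb2 (fun z => phi (- y + z) * X z z).
  have [? [? /(bbox_shift (- y)) /bbox_bfs bs]] := test_function_bbox tphi.
  exact: bfsM.
rewrite -bfs_RintegralB//.
have bd : bfs leb2 (fun z => phi (- y + z) * X z z - phi z * X (0 + z) (0 + z)).
  exact: bfsB.
apply: le_trans (le_normr_Rintegral measurableT (bfs_integrable bd)) _.
have bn := bfsZ K (bfs_norm bXd).
rewrite -(RintegralZr `|y| measurableT (bfs_integrable bn)).
apply: bfs_le => [||z].
- exact: bfs_norm.
- have := bfsZ `|y| bn; congr bfs; apply/funext => z; exact: mulrC.
- rewrite !add0r -mulrBl normrM mulrAC ler_wpM2r//.
  by have := hK z (- y); rewrite normrN (addrC z).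
Qed.

(** Bilinearity splits the product of increments into four integrals: two mixed ones, equal up to
    sign to [corr] for (A, B) and for (B, A), and two unmixed ones, whose difference is covered by
    [diag_lipschitz]. *)
Lemma energy : exists K, forall y, `|y| < d / 2 ->
  `|\int[leb2]_z (phi z * ((A1 (y + z) - A1 z) * (B2 (y + z) - B2 z) -
      (A2 (y + z) - A2 z) * (B1 (y + z) - B1 z)))| <= K * `|y|.
Proof.
have [K1 h1] := corr_lipschitz d0 bA1 bA2 bB1 bB2 divA divB tphi.
have [K2 h2] := corr_lipschitz d0 bB1 bB2 bA1 bA2 divB divA tphi.
have [K3 h3] := diag_lipschitz.
exists (K1 + K2 + K3) => y yd.
have := h1 y yd; have := h2 y yd; have := h3 y.
have E1 c : corr A1 A2 B1 B2 phi c = \int[leb2]_z (phi z * X (c + z) (0 + z)).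
  by apply: eq_Rintegral => z _; rewrite add0r.
have E2 c : corr B1 B2 A1 A2 phi c = - \int[leb2]_z (phi z * X (0 + z) (c + z)).
  rewrite -mulN1r -(RintegralZl (-1) measurableT (bfs_integrable (bX 0 c))).
  by apply: eq_Rintegral => z _; rewrite add0r /X /cross; ring.
rewrite !E1 !E2.
have -> : \int[leb2]_z (phi z * ((A1 (y + z) - A1 z) * (B2 (y + z) - B2 z) -
      (A2 (y + z) - A2 z) * (B1 (y + z) - B1 z))) =
  (\int[leb2]_z (phi z * X (y + z) (y + z)) - \int[leb2]_z (phi z * X (y + z) (0 + z))) -
  (\int[leb2]_z (phi z * X (0 + z) (y + z)) - \int[leb2]_z (phi z * X (0 + z) (0 + z))).
  rewrite -(bfs_RintegralB (bX y y) (bX y 0)) -(bfs_RintegralB (bX 0 y) (bX 0 0)).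
  rewrite -(bfs_RintegralB (bfsB (bX y y) (bX y 0)) (bfsB (bX 0 y) (bX 0 0))).
  by apply: eq_Rintegral => z _; rewrite !add0r /X /cross; ring.
move: (\int[leb2]_z (phi z * X (y + z) (y + z))) (\int[leb2]_z (phi z * X (y + z) (0 + z)))
  (\int[leb2]_z (phi z * X (0 + z) (y + z))) (\int[leb2]_z (phi z * X (0 + z) (0 + z))).
move=> p q r s.
move=> H3 H2 H1.
(* Regrouped into three differences, each vanishing at [y = 0]. *)
rewrite [X in `|X|](_ : _ = (p - s) + (- r - - s) - (q - s)); last by ring.
rewrite (le_trans (ler_normB _ _))//.
rewrite [leRHS](_ : _ = K3 * `|y| + K2 * `|y| + K1 * `|y|); last by ring.
by rewrite lerD// (le_trans (ler_normD _ _))// lerD.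
Qed.

End Energy.

(** * The integrable kernel *)

Section Power_integrals.
Context {R : realType}.
Local Notation leb1 := (@leb1 R).
Local Notation leb2 := (@leb2 R).

Lemma integral_powR (p a b : R) : p != 0 -> 0 < a -> a < b ->
  (\int[leb1]_(x in `[a, b]) (x `^ (p - 1))%:E)%E = ((b `^ p - a `^ p) / p)%:E.
Proof.
move=> p0 a0 ab.
pose F (x : R) := p^-1 * x `^ p.
have dF (x : R) : 0 < x -> is_derive x (1 : R) F (x `^ (p - 1)).
  move=> x0; have := @is_deriveZ _ _ _ (fun x : R => x `^ p) p^-1 x 1 _ (is_derive1_powR p x0).
  by rewrite /GRing.scale/= mulKf.
have cp (x : R) : 0 < x -> {for x, continuous (fun y : R => y `^ (p - 1))}.
  move=> x0; apply: differentiable_continuous; apply/derivable1_diffP.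
  by have [] := is_derive1_powR (p - 1) x0.
have cF (x : R) : 0 < x -> {for x, continuous F}.
  move=> x0; apply: differentiable_continuous; apply/derivable1_diffP.
  by have [] := dF x x0.
rewrite [LHS](@continuous_FTC2 R _ F a b ab).
- by rewrite -EFinB /F -mulrBr mulrC.
- apply: continuous_in_subspaceT => x /set_mem /=; rewrite in_itv/= => /andP[ax _].
  exact/cp/lt_le_trans/ax.
- split.
  + by move=> x; rewrite in_itv/= => /andP[ax _]; have [] := dF x (lt_trans a0 ax).
  + exact/cvg_at_right_filter/cF.
  + exact/cvg_at_left_filter/cF/lt_trans/ab.
- move=> x; rewrite in_itv/= => /andP[ax _]; rewrite derive1E.
  by have [_ ->] := dF x (lt_trans a0 ax).
Qed.

Lemma integral_bigcup_le (f : measurableTypeR R -> \bar R)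
    (A : nat -> set (measurableTypeR R)) (C : \bar R) :
  measurable_fun setT f -> (forall x, (0 <= f x)%E) ->
  (forall n, measurable (A n)) -> nondecreasing_seq A ->
  (forall n, (\int[leb1]_(x in A n) f x <= C)%E) ->
  (\int[leb1]_(x in \bigcup_n A n) f x <= C)%E.
Proof.
move=> mf f0 mA ndA fC.
have := @ge0_nondecreasing_set_cvg_integral _ _ _ A f leb1 ndA mA
  (fun n => measurable_funTS mf) (fun n x _ => f0 x).
by move=> H; apply: (cvge_to_le H); exact: nearW.
Qed.

Lemma integral_powR_near0 (t : R) : 0 < t ->
  (\int[leb1]_(x in `]0%R, 1%R]) (x `^ (t - 1))%:E <= (t^-1)%:E)%E.
Proof.
(* [n.+2] rather than [n.+1]: the left end must be strictly below 1 for [integral_powR]. *)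
move=> t0; pose A n : set (measurableTypeR R) := [set` `[n.+2%:R^-1 : R, 1]].
have -> : `]0%R, 1%R]%classic = \bigcup_n A n.
  apply/seteqP; split=> x; rewrite /A /= in_itv/=.
    move=> /andP[x0 x1]; exists (Num.truncn x^-1) => //=; rewrite in_itv/= x1 andbT.
    rewrite invf_ple ?posrE// (le_trans (ltW (truncnS_gt _)))// ler_nat//.
  move=> [n _]; rewrite /= in_itv/= => /andP[nx ->]; rewrite andbT.
  by apply: lt_le_trans nx; rewrite invr_gt0.
apply: integral_bigcup_le => //.
- apply/measurable_EFinP; exact: measurable_powR.
- by move=> x; rewrite lee_fin powR_ge0.
- by move=> n; exact: measurable_itv.
- move=> m n mn; apply/subsetPset => x; rewrite /A /= !in_itv/= => /andP[mx ->].
  by rewrite andbT (le_trans _ mx)// lef_pV2 ?posrE// ler_nat !ltnS.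
- move=> n; rewrite /A integral_powR ?gt_eqF ?invr_gt0//; last first.
    by rewrite invf_lt1// ltr1n.
  rewrite lee_fin powR1 ler_pdivrMr// mulVf ?gt_eqF// gerBl powR_ge0.
Qed.

Lemma integral_powR_infty (t : R) : 0 < t ->
  (\int[leb1]_(x in `[1%R, +oo[) (x `^ (- t - 1))%:E <= (t^-1)%:E)%E.
Proof.
move=> t0; pose A n : set (measurableTypeR R) := [set` `[1 : R, n.+2%:R]].
have -> : `[1%R, +oo[%classic = \bigcup_n A n.
  apply/seteqP; split=> x; rewrite /A /= in_itv/= ?andbT.
    move=> x1; exists (Num.truncn x) => //=; rewrite in_itv/= x1/=.
    by rewrite (le_trans (ltW (truncnS_gt _)))// ler_nat.
  by move=> [n _]; rewrite /= in_itv/= => /andP[].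
apply: integral_bigcup_le => //.
- apply/measurable_EFinP; exact: measurable_powR.
- by move=> x; rewrite lee_fin powR_ge0.
- by move=> n; exact: measurable_itv.
- move=> m n mn; apply/subsetPset => x; rewrite /A /= !in_itv/= => /andP[->] /=.
  by move/le_trans; apply; rewrite ler_nat !ltnS.
- move=> n; rewrite /A integral_powR ?oppr_eq0 ?gt_eqF// ?ltr1n//.
  rewrite lee_fin powR1 invrN mulrN -mulNr opprB ler_pdivrMr// mulVf ?gt_eqF//.
Qed.

(* [wker b y] is dominated by the product [gker (b / 4) y.1 * gker (b / 4) y.2],
   which avoids polar coordinates. *)
Definition gker (t x : R) := if `|x| <= 1 then `|x| `^ (t - 1) else `|x| `^ (- t - 1).

Lemma gker_ge0 t x : 0 <= gker t x.
Proof. by rewrite /gker; case: ifP => _; exact: powR_ge0. Qed.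

Lemma measurable_gker t : measurable_fun setT (gker t : measurableTypeR R -> R).
Proof.
have mn : measurable_fun setT (fun x : measurableTypeR R => `|x|).
  exact: normr_measurable.
rewrite /gker; apply: measurable_fun_ifT.
- by apply: measurable_fun_ler => //; exact: measurable_cst.
- exact: (measurableT_comp (measurable_powR _) mn).
- exact: (measurableT_comp (measurable_powR _) mn).
Qed.

Lemma ge0_integral_leb1N (f : measurableTypeR R -> \bar R) :
  measurable_fun setT f -> (forall x, (0 <= f x)%E) ->
  (\int[leb1]_x f (- x)%R = \int[leb1]_x f x)%E.
Proof.
move=> mf f0; have mN : measurable_fun setT (-%R : measurableTypeR R -> measurableTypeR R).
  exact: oppr_measurable.
transitivity (\int[pushforward leb1 (-%R : measurableTypeR R -> measurableTypeR R)]_x f x)%E.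
  by rewrite ge0_integral_pushforward.
apply: eq_measure_integral => A mA _.
exact: lebesgue_measureN.
Qed.

Lemma integral_gker (t : R) : 0 < t -> t < 1 ->
  (\int[leb1]_x (gker t x)%:E < +oo)%E.
Proof.
move=> t0 t1.
pose h (x : measurableTypeR R) : \bar R :=
  ((fun x => (x `^ (t - 1))%:E) \_ `]0%R, 1%R] x +
   (fun x => (x `^ (- t - 1))%:E) \_ `[1%R, +oo[ x)%E.
have h0 x : (0 <= h x)%E.
  by apply: adde_ge0; rewrite patchE; case: ifP => // _; rewrite lee_fin powR_ge0.
have mp p (i : interval R) : measurable_fun setT
    ((fun x : measurableTypeR R => (x `^ p)%:E) \_ [set` i]).
  have m0 : measurable_fun setT (fun x : measurableTypeR R => (x `^ p)%:E).
    by apply/measurable_EFinP; exact: measurable_powR.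
  apply/(measurable_restrictT _ (measurable_itv _)); exact: measurable_funTS m0.
have mh : measurable_fun setT h by apply: emeasurable_funD; exact: mp.
have hoo : (\int[leb1]_x h x < +oo)%E.
  rewrite ge0_integralD//; last 4 first.
  - by move=> x _; rewrite patchE; case: ifP => // _; rewrite lee_fin powR_ge0.
  - exact: mp.
  - by move=> x _; rewrite patchE; case: ifP => // _; rewrite lee_fin powR_ge0.
  - exact: mp.
  rewrite -!integral_mkcond lte_add_pinfty//.
  - exact: le_lt_trans (integral_powR_near0 t0) (ltry _).
  - exact: le_lt_trans (integral_powR_infty t0) (ltry _).
have mhN : measurable_fun setT (fun x : measurableTypeR R => h (- x)%R).
  by apply: measurableT_comp => //; exact: oppr_measurable.
apply: (@le_lt_trans _ _ (\int[leb1]_x (h x + h (- x)%R))%E).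
  apply: ge0_le_integral => //.
  - by move=> x _; rewrite lee_fin gker_ge0.
  - by apply/measurable_EFinP; exact: measurable_gker.
  - by apply: emeasurable_funD.
  move=> x _.
  have hpos y : 0 < y -> ((gker t y)%:E <= h y)%E.
    move=> y0; rewrite /gker gtr0_norm//; case: ifPn => [y1|]; last rewrite -ltNge => y1.
      rewrite /h !patchE mem_set; last by rewrite /= in_itv/= y0 y1.
      by rewrite leeDl//; case: ifP => // _; rewrite lee_fin powR_ge0.
    rewrite /h !patchE [X in (_ + X)%E]ifT; last first.
      by rewrite mem_set//= in_itv/= andbT ltW.
    by rewrite leeDr//; case: ifP => // _; rewrite lee_fin powR_ge0.
  have [x0|x0|<-] := ltgtP 0 x.
  - by rewrite (le_trans (hpos _ x0))// leeDl.
  - rewrite (_ : gker t x = gker t (- x)); last by rewrite /gker normrN.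
    by rewrite (le_trans (hpos _ _))// ?oppr_gt0// leeDr.
  (* By convention 0 to a nonzero power is 0, so [gker t 0 = 0]; [t < 1] rules out the exponent
     0. *)
  - have tN0 : t - 1 != 0 by rewrite subr_eq0 lt_eqF.
    by rewrite /gker normr0 ler01 powR0// adde_ge0.
rewrite ge0_integralD//.
have -> : (\int[leb1]_x h (- x)%R = \int[leb1]_x h x)%E by exact: ge0_integral_leb1N.
by rewrite lte_add_pinfty.
Qed.

End Power_integrals.

(** * Elementary inequalities for real powers *)

Section Power_inequalities.
Context {R : realType}.
Implicit Types a b x y p q : R.

Lemma le0_powR_le x y p : p <= 0 -> 0 < x -> x <= y -> y `^ p <= x `^ p.
Proof.
move=> p0 x0 xy; have y0 := lt_le_trans x0 xy.
rewrite -[p]opprK powRN [leRHS]powRN lef_pV2 ?posrE ?powR_gt0//.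
by apply: ge0_ler_powR; rewrite ?oppr_ge0// nnegrE ltW.
Qed.

(** By homogeneity [a] may be scaled to 1; on the unit interval a power [p >= 1] of a number is at
    most that number, and the two fractions add up to 1. *)
Lemma powR_superadd a b p : 1 <= p -> 0 <= b -> b <= a ->
  b `^ p + (a - b) `^ p <= a `^ p.
Proof.
move=> p1 b0 ba; have [a0|a0] := eqVneq a 0.
  have pn0 : p != 0 by rewrite gt_eqF// (lt_le_trans ltr01).
  rewrite a0 in ba *; have -> : b = 0 by apply/eqP; rewrite eq_le ba b0.
  by rewrite subrr powR0// addr0.
have {}a0 : 0 < a by rewrite lt_neqAle eq_sym a0 (le_trans b0).
have H x : 0 <= x -> x <= 1 -> x `^ p <= x.
  move=> x0 x1; have [->|xn0] := eqVneq x 0.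
    by rewrite powR0// gt_eqF// (lt_le_trans ltr01).
  by apply: ge1r_powR => //; rewrite x1 lt_neqAle eq_sym xn0 x0.
have E x : 0 <= x -> x `^ p = (x / a) `^ p * a `^ p.
  by move=> x0; rewrite -powRM ?divfK ?gt_eqF// ?divr_ge0// ltW.
rewrite (E b b0) (E (a - b)) ?subr_ge0// -mulrDl.
rewrite -[leRHS]mul1r ler_wpM2r ?powR_ge0//.
have -> : 1 = b / a + (a - b) / a by rewrite -mulrDl addrC subrK divff// gt_eqF.
by apply: lerD; apply: H; rewrite ?divr_ge0 ?subr_ge0// ?ler_pdivrMr ?mul1r ?gerBl// ltW.
Qed.

(** Quantitative monotonicity of the pressure law when [p = gamma]; it sets the integrability
    exponent [gamma + 1]. Once [a] and [b] are ordered, it is superadditivity of the power,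
    multiplied by [a - b]. *)
Lemma powR_monotone_diff a b p : 1 <= p -> 0 <= a -> 0 <= b ->
  `|a - b| `^ (p + 1) <= (a - b) * (a `^ p - b `^ p).
Proof.
move=> p1; wlog ba : a b / b <= a => [hw a0 b0|a0 b0].
  have [/hw|/ltW/hw] := leP b a; first exact.
  by move=> /(_ b0 a0); rewrite distrC -[leRHS]mulrNN !opprB.
have p0 : 0 < p by exact: lt_le_trans p1.
rewrite ger0_norm ?subr_ge0//.
have -> : (a - b) `^ (p + 1) = (a - b) * (a - b) `^ p.
  by rewrite -(@mulr_powRB1 _ (a - b) (p + 1)) ?subr_ge0 ?addrK// addr_gt0.
by rewrite ler_wpM2l ?subr_ge0// lerBrDl powR_superadd.
Qed.

Lemma powRD_le a b q : 0 <= q -> 0 <= a -> 0 <= b ->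
  (a + b) `^ q <= 2 `^ q * (a `^ q + b `^ q).
Proof.
move=> q0; wlog ba : a b / b <= a => [hw a0 b0|a0 b0].
  have [/hw|/ltW/hw] := leP b a; first exact.
  by move=> /(_ b0 a0); rewrite addrC (addrC (b `^ q)).
apply: (@le_trans _ _ ((2 * a) `^ q)).
  by apply: ge0_ler_powR; rewrite ?nnegrE ?addr_ge0 ?mulr_ge0// mulr2n mulrDl !mul1r lerD2l.
by rewrite powRM// ler_wpM2l ?powR_ge0// lerDl powR_ge0.
Qed.

End Power_inequalities.

Section Plane_kernel.
Context {R : realType}.
Local Notation leb1 := (@leb1 R).
Local Notation leb2 := (@leb2 R).

(** The Gagliardo kernel uses the Euclidean distance, whereas shifts are measured in the max norm of
    pairs; [norm_le_enorm] and [enorm_le] compare the two. *)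
Definition enorm (y : R * R) : R := Num.sqrt (y.1 ^+ 2 + y.2 ^+ 2).

Lemma enorm_ge0 y : 0 <= enorm y.
Proof. exact: sqrtr_ge0. Qed.

Lemma enorm_ge (y : R * R) : `|y.1| <= enorm y /\ `|y.2| <= enorm y.
Proof.
by split; rewrite -sqrtr_sqr ler_wsqrtr// ?lerDl ?lerDr sqr_ge0.
Qed.

Lemma norm_le_enorm (y : R * R) : `|y| <= enorm y.
Proof. by rewrite prod_normE ge_max; have [-> ->] := enorm_ge y. Qed.

Lemma enorm_le (y : R * R) : enorm y <= 2 * `|y|.
Proof.
rewrite -(ler_pXn2r (n := 2))// ?nnegrE ?enorm_ge0 ?mulr_ge0//.
rewrite sqr_sqrtr ?addr_ge0 ?sqr_ge0// exprMn.
have [y1 y2] : `|y.1| <= `|y| /\ `|y.2| <= `|y|.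
  by rewrite prod_normE !le_max !lexx orbT.
have H (c : R) : `|c| <= `|y| -> c ^+ 2 <= `|y| ^+ 2.
  by move=> cy; rewrite -real_normK ?num_real// ler_pXn2r ?nnegrE.
apply: (@le_trans _ _ (`|y| ^+ 2 + `|y| ^+ 2)); first by rewrite lerD// H.
rewrite [leLHS](_ : _ = 2 * `|y| ^+ 2); last by ring.
by rewrite ler_wpM2r ?sqr_ge0// expr2 ler_peMl// ler1n.
Qed.

Lemma edistE (z y : R * R) : Defs.edist z (y + z) = enorm y.
Proof.
rewrite /Defs.edist /enorm; congr Num.sqrt; rewrite /=; ring.
Qed.

Lemma measurable_enorm : measurable_fun setT (enorm : mplane R -> R).
Proof.
have m2 : measurable_fun setT (fun y : mplane R => y.1 ^+ 2 + y.2 ^+ 2).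
  by apply: measurable_funD; apply: measurable_funX;
    [exact: measurable_fst|exact: measurable_snd].
exact: (measurableT_comp (continuous_measurable_fun (@sqrt_continuous R)) m2).
Qed.

(** One integrable weight for all harmless terms. The minimum of 1 and |y|^b dominates, up to
    constants, |y| for bounded [y] and the increments of the cut-off; it leaves the powers -2 + b/2
    at 0 and -2 - b/2 at infinity, both integrable in the plane. *)
Definition wker (b : R) (y : R * R) :=
  Num.min 1 (enorm y `^ b) * enorm y `^ (- 2 - b / 2).

Lemma wker_ge0 b y : 0 <= wker b y.
Proof. by rewrite mulr_ge0 ?powR_ge0// le_min ler01 powR_ge0. Qed.

Lemma measurable_wker b : measurable_fun setT (wker b : mplane R -> R).
Proof.
apply: measurable_funM.
- apply: measurable_minr; first exact: measurable_cst.
  exact: (measurableT_comp (measurable_powR _) measurable_enorm).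
- exact: (measurableT_comp (measurable_powR _) measurable_enorm).
Qed.

(** A negative power of [enorm y] is shared evenly by the coordinates, each of size at most
    [enorm y]: twice [b / 4 - 1] is -2 + b/2, and twice [- (b / 4) - 1] is -2 - b/2. *)
Lemma wker_le_gker (b : R) (y : R * R) : 0 < b -> b < 1 -> y.1 != 0 -> y.2 != 0 ->
  wker b y <= gker (b / 4) y.1 * gker (b / 4) y.2.
Proof.
move=> b0 b1 y1 y2; have [e1 e2] := enorm_ge y.
have y1_gt0 : 0 < `|y.1| by rewrite normr_gt0.
have y2_gt0 : 0 < `|y.2| by rewrite normr_gt0.
have e0 : 0 < enorm y := lt_le_trans y1_gt0 e1.
have t0 : b / 4 - 1 <= 0 by lra.
have t0' : - (b / 4) - 1 <= 0 by lra.
have pD (p q : R) : enorm y `^ (p + q) = enorm y `^ p * enorm y `^ q.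
  by rewrite powRD ?(gt_eqF e0) ?implybT.
have [ele|elt] := leP (enorm y) 1.
  apply: (@le_trans _ _ (enorm y `^ (b / 4 - 1) * enorm y `^ (b / 4 - 1))).
    rewrite -pD (_ : b / 4 - 1 + (b / 4 - 1) = b + (- 2 - b / 2)); last by field.
    rewrite [leRHS]pD /wker.
    by rewrite ler_wpM2r ?powR_ge0// ge_min lexx orbT.
  rewrite /gker (le_trans e1 ele) (le_trans e2 ele).
  by rewrite ler_pM ?powR_ge0// le0_powR_le.
apply: (@le_trans _ _ (enorm y `^ (- (b / 4) - 1) * enorm y `^ (- (b / 4) - 1))).
  rewrite -pD (_ : - (b / 4) - 1 + (- (b / 4) - 1) = - 2 - b / 2); last by field.
  by rewrite /wker ler_piMl ?powR_ge0// ge_min lexx.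
(* With [enorm y > 1] a coordinate may still be small; then the number 1 separates the two
   powers. *)
have H (c : R) : 0 < `|c| -> `|c| <= enorm y -> enorm y `^ (- (b / 4) - 1) <= gker (b / 4) c.
  move=> c0 ce; rewrite /gker; case: ifPn => [c1|_]; last exact: le0_powR_le.
  apply: (@le_trans _ _ 1).
    by have := le0_powR_le t0' ltr01 (ltW elt); rewrite powR1.
  by have := le0_powR_le t0 c0 c1; rewrite powR1.
by rewrite ler_pM ?powR_ge0// H.
Qed.

Lemma integral_wker (b : R) : 0 < b -> b < 1 -> (\int[leb2]_y (wker b y)%:E < +oo)%E.
Proof.
move=> b0 b1.
have mw : measurable_fun setT (fun y : mplane R => (wker b y)%:E).
  by apply/measurable_EFinP; exact: measurable_wker.
have w0 (y : mplane R) : (0 <= (wker b y)%:E)%E by rewrite lee_fin wker_ge0.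
pose g := gker (b / 4) : measurableTypeR R -> R.
have g0 x : 0 <= g x by exact: gker_ge0.
have mg : measurable_fun setT (fun x : measurableTypeR R => (g x)%:E).
  by apply/measurable_EFinP; exact: measurable_gker.
have goo : (\int[leb1]_x (g x)%:E < +oo)%E by apply: integral_gker; lra.
have ig0 : (0 <= \int[leb1]_x (g x)%:E)%E by apply: integral_ge0 => x _; rewrite lee_fin.
(* On the axes [gker] takes the default value 0 and the comparison may fail; they are null sets. *)
have ae0 (P : R -> Prop) : (forall x, x != 0 -> P x) -> {ae leb1, forall x, setT x -> P x}.
  move=> H; exists [set 0]; split; [exact: measurable_set1|exact: lebesgue_measure_set1|].
  by move=> x /= nP; apply: contrapT => /eqP x0; apply: nP => _; exact: H.
have -> : (\int[leb2]_y (wker b y)%:E =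
    \int[leb1]_t \int[leb1]_x (wker b (t, x))%:E)%E.
  exact: (@fubini_tonelli1 _ _ _ _ R leb1 leb1 (fun y => (wker b y)%:E) mw w0).
have mF := @measurable_fun_fubini_tonelli_F _ _ _ _ R leb1 _ mw w0.
apply: (@le_lt_trans _ _ (\int[leb1]_t ((g t)%:E * \int[leb1]_x (g x)%:E))%E).
  apply: ae_ge0_le_integral => //.
  - by move=> t _; apply: integral_ge0 => x _.
  - by move=> t _; rewrite mule_ge0// lee_fin.
  - apply: emeasurable_funM => //; exact: measurable_cst.
  apply: (ae0) => t tn0.
  rewrite -ge0_integralZl//; [|by move=> x _; rewrite lee_fin|by rewrite lee_fin].
  apply: ae_ge0_le_integral => //.
  - exact: (measurableT_comp mw (pair1_measurable t)).
  - by move=> x _; rewrite mule_ge0// lee_fin.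
  - by apply: emeasurable_funM => //; exact: measurable_cst.
  by apply: (ae0) => x xn0; rewrite -EFinM lee_fin; exact: wker_le_gker.
rewrite ge0_integralZr//; last by move=> x _; rewrite lee_fin.
by rewrite lte_mul_pinfty// ge0_fin_numE.
Qed.

End Plane_kernel.

Section Bounded_boxes.
Context {R : realType}.
Local Notation leb1 := (@leb1 R).
Local Notation leb2 := (@leb2 R).

Lemma bbox_le (M M' N : R) (f : R * R -> R) : M <= M' -> bbox M N f -> bbox M' N f.
Proof. by move=> MM [mf fM fN]; split => // z; exact: le_trans (fM z) MM. Qed.

Lemma bboxM (M M' N : R) (f g : R * R -> R) : bbox M N f -> bbox M' N g ->
  bbox (M * M') N (fun z => f z * g z).
Proof.
move=> [mf fM fN] [mg gM gN]; split.
- exact: measurable_funM.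
- by move=> z; rewrite normrM ler_pM.
- by move=> z /fN ->; rewrite mul0r.
Qed.

Lemma bboxD (M M' N : R) (f g : R * R -> R) : bbox M N f -> bbox M' N g ->
  bbox (M + M') N (fun z => f z + g z).
Proof.
move=> [mf fM fN] [mg gM gN]; split.
- exact: measurable_funD.
- by move=> z; rewrite (le_trans (ler_normD _ _))// lerD.
- by move=> z nz; rewrite fN// gN// addr0.
Qed.

Lemma bfs_powR (f : R * R -> R) (q : R) : 0 < q -> bfs leb2 f ->
  bfs leb2 (fun z => `|f z| `^ q).
Proof.
move=> q0 [mf [M fM] [S ? fS]]; split.
- by apply: (measurableT_comp (measurable_powR _)); exact: measurableT_comp.
- exists (M `^ q) => z; rewrite ger0_norm ?powR_ge0//.
  have M0 : 0 <= M by exact: le_trans (fM z).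
  by apply: ge0_ler_powR; rewrite ?nnegrE// ltW.
- by exists S => // z /fS ->; rewrite normr0 powR0// gt_eqF.
Qed.

Lemma measurable_box (a L d : R) : measurable (box a L d : set (mplane R)).
Proof.
rewrite (_ : box a L d = `[a - d, L + d] `*` `[- L - d, L + d]); last first.
  by apply/seteqP; split => -[t x] /=; rewrite !in_itv.
by apply: measurableX; exact: measurable_itv.
Qed.

Lemma bbox_indic_box (a L d : R) : exists N, bbox 1 N (\1_(box a L d) : mplane R -> R).
Proof.
exists (`|a| + `|L| + `|d|); split.
- exact: measurable_indic (measurable_box _ _ _).
- by move=> z; rewrite indicE; case: (_ \in _); rewrite ?normr1 ?normr0.
- move=> z nz; rewrite indicE memNset// => -[z1 z2]; apply: nz.
  have H (b c x : R) : b - d <= x <= c + d -> `|b| <= `|a| + `|L| -> `|c| <= `|a| + `|L| ->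
      `|x| <= `|a| + `|L| + `|d|.
    have := ler_norm d; have := ler_norm (- d); rewrite normrN.
    by rewrite !ler_norml; lra.
  split; [apply: H z1 _ _|apply: H z2 _ _]; rewrite ?normrN ?lerDl ?lerDr//.
Qed.

(* If t <= e^b the first term of the right-hand side dominates, otherwise
   t^(1 - r) <= e^(b (1 - r)) and the second one does. *)
Lemma sqr_young_powR (K d b r e t : R) : 0 < b -> 1 < r -> 0 <= e -> e <= d ->
  0 <= t -> t <= K ->
  t ^+ 2 * e `^ (- 2 - b / 2) <=
  (K * (K + 1) + K * d `^ (b / 2)) *
  (Num.min 1 (e `^ b) * e `^ (- 2 - b / 2) + t `^ r * e `^ (- 2 - b * r)).
Proof.
move=> b0 r1 e0 ed t0 tM.
have K0 : 0 <= K by exact: le_trans tM.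
have C1 : 0 <= K * (K + 1) by rewrite mulr_ge0// addr_ge0.
have C2 : 0 <= K * d `^ (b / 2) by rewrite mulr_ge0// powR_ge0.
have k0 : 0 <= Num.min 1 (e `^ b) * e `^ (- 2 - b / 2).
  by rewrite mulr_ge0 ?powR_ge0// le_min ler01 powR_ge0.
have w0 : 0 <= t `^ r * e `^ (- 2 - b * r) by rewrite mulr_ge0 ?powR_ge0.
have [te|et] := leP t (e `^ b).
  apply: (@le_trans _ _ (K * (K + 1) *
      (Num.min 1 (e `^ b) * e `^ (- 2 - b / 2)))); last first.
    by apply: ler_pM => //; [rewrite lerDl|rewrite lerDl].
  rewrite mulrA ler_wpM2r ?powR_ge0// expr2 -[leRHS]mulrA ler_pM//.
  have [e1|e1] := leP 1 (e `^ b); first by rewrite mulr1 (le_trans tM)// lerDl.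
  by rewrite (le_trans te)// ler_peMl ?powR_ge0// lerDr.
(* At [e = 0] the left side is 0, its exponent being nonzero; for [e > 0] exponents may be added. *)
have [e00|en0] := eqVneq e 0.
  by rewrite {1}e00 powR0 ?mulr0 ?mulr_ge0 ?addr_ge0// lt_eqF//; lra.
have {}e0 : 0 < e by rewrite lt_neqAle eq_sym en0.
have tp : 0 < t by apply: le_lt_trans et; exact: powR_ge0.
apply: (@le_trans _ _ (K * d `^ (b / 2) * (t `^ r * e `^ (- 2 - b * r)))); last first.
  by apply: ler_pM => //; [rewrite lerDr|rewrite lerDr].
have tE : t = t `^ r * t `^ (1 - r).
  by rewrite -powRD ?(gt_eqF tp) ?implybT// addrC subrK powRr1// ltW.
have tb : t `^ (1 - r) <= e `^ (b * (1 - r)).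
  by rewrite powRrM; apply: le0_powR_le; [lra|exact: powR_gt0|exact: ltW].
have eD p q' : e `^ (p + q') = e `^ p * e `^ q' by rewrite powRD ?(gt_eqF e0) ?implybT.
apply: (@le_trans _ _ (K * (t `^ r * e `^ (b * (1 - r))) * e `^ (- 2 - b / 2))).
  rewrite ler_wpM2r ?powR_ge0// expr2 ler_pM// {1}tE.
  by rewrite ler_wpM2l ?powR_ge0.
rewrite -!mulrA ler_wpM2l// [leRHS]mulrCA ler_wpM2l ?powR_ge0//.
rewrite -eD (_ : b * (1 - r) + (- 2 - b / 2) = b / 2 + (- 2 - b * r)); last by field.
rewrite eD ler_wpM2r ?powR_ge0//.
apply: ge0_ler_powR => //; first lra.
- by rewrite nnegrE ltW.
- by rewrite nnegrE (le_trans (ltW e0)).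
Qed.

End Bounded_boxes.

(** * Double integrals as integrals over increments *)

Section Tonelli_shift.
Context {R : realType}.
Local Notation leb2 := (@leb2 R).
Local Notation leb4 := (@leb4 R).

Lemma measurable_shear : measurable_fun setT
  (fun x : mplane R * mplane R => (x.2, x.1 + x.2) : mplane R * mplane R).
Proof.
apply/measurable_fun_pairP; split; first exact: measurable_snd.
have -> : snd \o (fun x : mplane R * mplane R => (x.2, x.1 + x.2)) =
  (fun x : mplane R * mplane R => (x.1.1 + x.2.1, x.1.2 + x.2.2) : mplane R) by [].
apply/measurable_fun_pairP; split.
- apply: (@measurable_funD _ _ _ _ (fun x : mplane R * mplane R => x.1.1) (fun x => x.2.1)).
  + exact: (measurableT_comp measurable_fst measurable_fst).
  + exact: (measurableT_comp measurable_fst measurable_snd).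
- apply: (@measurable_funD _ _ _ _ (fun x : mplane R * mplane R => x.1.2) (fun x => x.2.2)).
  + exact: (measurableT_comp measurable_snd measurable_fst).
  + exact: (measurableT_comp measurable_snd measurable_snd).
Qed.

(** Tonelli and the substitution [w = y + z] at fixed [z]. A Gagliardo double integral thus becomes
    an integral over the increment [y] of quantities that can be estimated for each [y]. *)
Lemma integral_leb4_shear (F : mplane R * mplane R -> \bar R) :
  measurable_fun setT F -> (forall x, (0 <= F x)%E) ->
  (\int[leb4]_x F x = \int[leb2]_y \int[leb2]_z F (z, (y + z)%R))%E.
Proof.
move=> mF F0.
pose G (x : mplane R * mplane R) := F (x.2, x.1 + x.2).
have mG : measurable_fun setT G by exact: (measurableT_comp mF measurable_shear).
have -> : (\int[leb2]_y \int[leb2]_z F (z, (y + z)%R) =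
    \int[leb2]_z \int[leb2]_y F (z, (y + z)%R))%E.
  exact: (@fubini_tonelli _ _ _ _ R leb2 leb2 G mG (fun x => F0 _)).
transitivity (\int[leb2]_z \int[leb2]_w F (z, w))%E.
  exact: (@fubini_tonelli1 _ _ _ _ R leb2 leb2 F mF F0).
apply: eq_integral => z _.
have mFz : measurable_fun setT (fun w => F (z, w)).
  exact: (measurableT_comp mF (pair1_measurable z)).
rewrite -(ge0_integral_leb2_shift z mFz (fun w => F0 _)).
apply: eq_integral => y _.
by have -> : ((z.1 + y.1)%R, (z.2 + y.2)%R) = (y + z)%R by rewrite [RHS]addrC.
Qed.

Lemma measurable_enorm_diff (p : R) : measurable_fun setT
  (fun x : mplane R * mplane R => enorm (x.2 - x.1) `^ p).
Proof.
apply: (measurableT_comp (measurable_powR _)).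
have := measurable_diff_shift 0 (@measurable_enorm R).
by congr measurable_fun; apply/funext => x; rewrite subr0.
Qed.

Lemma measurable_powR_diff (p : R) (f g : R * R -> R) :
  measurable_fun setT f -> measurable_fun setT g ->
  measurable_fun setT (fun x : mplane R * mplane R => `|f x.1 - g x.2| `^ p).
Proof.
move=> mf mg; apply: (measurableT_comp (measurable_powR _)).
apply: measurableT_comp => //; apply: measurable_funB.
- exact: (measurableT_comp mf measurable_fst).
- exact: (measurableT_comp mg measurable_snd).
Qed.

End Tonelli_shift.

(** * From the regularity of u to that of rho *)

Section Gain.
Context {R : realType}.
Local Notation leb1 := (@leb1 R).
Local Notation leb2 := (@leb2 R).
Variables (gamma b r a L d M N : R) (rho u phi : R * R -> R).
Hypotheses (gamma1 : 1 < gamma) (b0 : 0 < b) (b1 : b < 1) (r1 : 1 < r) (d0 : 0 < d).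
Hypotheses (brho : bbox M N rho) (bu : bbox M N u) (rho0 : forall z, 0 <= rho z).
Let Q := box a L (2 * d).
Hypothesis rhoQ : forall z, ~ Q z -> rho z = 0.
Hypothesis mass : weak_div_free Q rho (fun z => rho z * u z).
Hypothesis momentum : weak_div_free Q (fun z => rho z * u z)
  (fun z => rho z * u z ^+ 2 + pressure gamma (rho z)).
Hypothesis tphi : test_function (box a L 0) phi.

Let q := gamma + 1.

Let q_gt0 : 0 < q. Proof. by rewrite addr_gt0// (lt_trans ltr01). Qed.

Let M_ge0 : 0 <= M. Proof. by have [_ h _] := brho; exact: le_trans (h (0, 0)). Qed.

Let kappa_gt0 : 0 < kappa gamma.
Proof. by rewrite divr_gt0 ?exprn_gt0 ?subr_gt0// mulr_gt0// (lt_trans ltr01). Qed.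

Let bphi : bfs leb2 phi.
Proof. by have [? [? /bbox_bfs]] := test_function_bbox tphi. Qed.

Let bfr : bfs leb2 rho. Proof. exact: bbox_bfs brho. Qed.
Let bfu : bfs leb2 u. Proof. exact: bbox_bfs bu. Qed.

Let bshift (f : R * R -> R) y : bbox M N f -> bfs leb2 (fun z => f (y + z)).
Proof. by move=> bf; exact: bbox_bfs (bbox_shift _ bf). Qed.

Let bpressure : bbox (kappa gamma * M `^ gamma) N (fun z => pressure gamma (rho z)).
Proof.
have [mr rM rN] := brho; split.
- rewrite /pressure; apply: measurable_funM; first exact: measurable_cst.
  exact: (measurableT_comp (measurable_powR _) mr).
- move=> z; rewrite /pressure normrM !ger0_norm ?powR_ge0 ?(ltW kappa_gt0)//.
  rewrite ler_wpM2l ?(ltW kappa_gt0)//; apply: ge0_ler_powR.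
  + by rewrite (le_trans ler01)// ltW.
  + by rewrite nnegrE.
  + by rewrite nnegrE.
  + exact: le_trans (ler_norm _) (rM z).
- move=> z /rN ->; rewrite /pressure powR0 ?mulr0//.
  by rewrite gt_eqF// (lt_trans ltr01).
Qed.

Let drho y z := `|rho (y + z) - rho z| `^ q.

Let bdrho y : bfs leb2 (drho y).
Proof. exact: bfs_powR q_gt0 (bfsB (bshift _ brho) bfr). Qed.

Let du2 y z := (u (y + z) - u z) ^+ 2.

Let bdu2 y : bfs leb2 (du2 y).
Proof.
have bdiff : bfs leb2 (fun z => u (y + z) - u z) by exact: bfsB (bshift _ bu) bfu.
exact: (bfsM bdiff bdiff).
Qed.

Let bphi2 : bfs leb2 (fun z => phi z * phi z). Proof. exact: bfsM. Qed.

(* The cross product of the increments of the two fluxes is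
   drho dp - rho rho' (du)^2, in which only increments of u come with the bad sign. *)
Lemma density_gain : exists K, 0 <= K /\ forall y, `|y| < d / 2 ->
  \int[leb2]_z (phi z * phi z * drho y z) <=
  K * (`|y| + \int[leb2]_z (phi z * phi z * du2 y z)).
Proof.
pose M' := M + M * M + (M * M * M + kappa gamma * M `^ gamma).
have P0 : 0 <= kappa gamma * M `^ gamma by rewrite mulr_ge0 ?powR_ge0// ltW.
have M0 : 0 <= M := M_ge0.
have MM0 : 0 <= M * M by exact: mulr_ge0.
have MMM0 : 0 <= M * M * M by exact: mulr_ge0.
have bm := bboxM brho bu.
have bm' : bbox M' N (fun z => rho z * u z).
  by apply: bbox_le bm; rewrite /M'; lra.
have br' : bbox M' N rho by apply: bbox_le brho; rewrite /M'; lra.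
have bp' : bbox M' N (fun z => rho z * u z ^+ 2 + pressure gamma (rho z)).
  have := bboxD (bboxM bm bu) bpressure.
  have -> : (fun z => rho z * u z * u z + pressure gamma (rho z)) =
    (fun z => rho z * u z ^+ 2 + pressure gamma (rho z)).
    by apply/funext => z; rewrite expr2 mulrA.
  by apply: bbox_le; rewrite /M'; lra.
have tphi2 : test_function (box a L 0) (fun z => phi z * phi z).
  by apply: test_functionM => //; case: tphi.
have [K hK] := energy d0 br' bm' bm' bp' mass momentum tphi2.
pose K1 := (kappa gamma)^-1 * (`|K| + M ^+ 2).
have K1_ge0 : 0 <= K1 by rewrite mulr_ge0 ?addr_ge0 ?sqr_ge0// invr_ge0 ltW.
exists K1; split => // y yd.
have := hK y yd.
set E := fun z => _ * (_ - _).
have bE : bfs leb2 E.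
  have bs (f : R * R -> R) : bbox M' N f -> bfs leb2 (fun z => f (y + z) - f z).
    move=> bf; apply: bfsB; last exact: bbox_bfs bf.
    exact: bbox_bfs (bbox_shift _ bf).
  by apply: bfsM => //; apply: bfsB; apply: bfsM; exact: bs.
move=> hE.
have pw z : kappa gamma * (phi z * phi z * drho y z) <=
    E z + M ^+ 2 * (phi z * phi z * du2 y z).
  have [_ rM _] := brho.
  have p0 : 0 <= phi z * phi z by rewrite -expr2 sqr_ge0.
  rewrite /E mulrCA (mulrCA (M ^+ 2)) -mulrDr ler_wpM2l//.
  rewrite [X in _ <= X + _](_ : _ = (rho (y + z) - rho z) *
      (pressure gamma (rho (y + z)) - pressure gamma (rho z)) -
      rho (y + z) * rho z * du2 y z); last by rewrite /du2; ring.
  have H1 : kappa gamma * drho y z <= (rho (y + z) - rho z) *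
      (pressure gamma (rho (y + z)) - pressure gamma (rho z)).
    rewrite /pressure -mulrBr mulrCA ler_wpM2l ?(ltW kappa_gt0)//.
    by apply: powR_monotone_diff => //; exact: ltW.
  have H2 : rho (y + z) * rho z * du2 y z <= M ^+ 2 * du2 y z.
    rewrite ler_wpM2r ?sqr_ge0// expr2 ler_pM//; exact: le_trans (ler_norm _) (rM _).
  move: H1 H2; move: (kappa gamma * drho y z) (rho (y + z) * rho z * du2 y z).
  move: (M ^+ 2 * du2 y z) ((rho (y + z) - rho z) * _).
  move=> s t v w h1 h2; rewrite (le_trans h1)//.
  by rewrite -addrA lerDl addrC subr_ge0.
have bL := bfsM bphi2 (bdrho y); have bU := bfsM bphi2 (bdu2 y).
have IL : kappa gamma * \int[leb2]_z (phi z * phi z * drho y z) <=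
    \int[leb2]_z E z + M ^+ 2 * \int[leb2]_z (phi z * phi z * du2 y z).
  rewrite -(RintegralZl (kappa gamma) measurableT (bfs_integrable bL)).
  rewrite -(RintegralZl (M ^+ 2) measurableT (bfs_integrable bU)).
  rewrite -(bfs_RintegralD bE (bfsZ (M ^+ 2) bU)).
  apply: bfs_le => //; first exact: bfsZ.
  by apply: bfsD => //; exact: bfsZ.
have U0 : 0 <= \int[leb2]_z (phi z * phi z * du2 y z).
  by apply: Rintegral_ge0 => z _; rewrite mulr_ge0 -?expr2 ?sqr_ge0.
rewrite /K1 -mulrA ler_pdivlMl// (le_trans IL)//.
rewrite mulrDl lerD//.
- rewrite (le_trans (ler_norm _))// (le_trans hE)//.
  apply: (@le_trans _ _ (`|K| * `|y|)); first by rewrite ler_wpM2r// ler_norm.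
  by rewrite ler_wpM2l// lerDl.
- by rewrite ler_wpM2l ?sqr_ge0// lerDr.
Qed.

(** The part of the Gagliardo integral of [u] over [Q] that belongs to the increment [y]. The
    indicators keep both points in [Q], since a cut-off [u] may jump across the boundary. *)
Let U y := \int[leb2]_z (\1_Q z * \1_Q (y + z) * (`|u (y + z) - u z| `^ r) *
  enorm y `^ (- 2 - b * r)).

Let bQ : bfs leb2 (\1_Q : R * R -> R).
Proof. by have [? /bbox_bfs] := bbox_indic_box a L (2 * d). Qed.

Let bQs y : bfs leb2 (fun z => \1_Q (y + z) : R).
Proof. by have [? /(bbox_shift y) /bbox_bfs] := bbox_indic_box a L (2 * d). Qed.

Let bdu y : bfs leb2 (fun z => `|u (y + z) - u z| `^ r).
Proof. exact: (bfs_powR (lt_trans ltr01 r1) (bfsB (bshift _ bu) bfu)). Qed.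

Let bU y : bfs leb2 (fun z => \1_Q z * \1_Q (y + z) * (`|u (y + z) - u z| `^ r) *
  enorm y `^ (- 2 - b * r)).
Proof.
have := bfsZ (enorm y `^ (- 2 - b * r)) (bfsM (bfsM bQ (bQs y)) (bdu y)).
by congr bfs; apply/funext => z; rewrite mulrC.
Qed.

Let I1 := \int[leb2]_z (\1_Q z : R).

Let I1_ge0 : 0 <= I1.
Proof. by apply: Rintegral_ge0 => z _; rewrite indicE. Qed.

Let U_ge0 y : 0 <= U y.
Proof.
by apply: Rintegral_ge0 => z _; rewrite !mulr_ge0 ?powR_ge0// indicE.
Qed.

Let phi_Q z y : phi z != 0 -> `|y| < d / 2 -> Q z /\ Q (y + z).
Proof.
move=> /(test_function_neq0 tphi) [z1 z2].
rewrite prod_normE gt_max => /andP[y1 y2].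
have H (c e s t : R) : c - 0 <= s <= e + 0 -> `|t| < d / 2 ->
    c - 2 * d <= s <= e + 2 * d /\ c - 2 * d <= t + s <= e + 2 * d.
  by have := d0; rewrite ltr_norml => ? ? ?; lra.
have [? ?] := H _ _ _ _ z1 y1; have [? ?] := H _ _ _ _ z2 y2.
by split; split.
Qed.

(** [density_gain] multiplied by the weight: |y| goes into [wker], and [sqr_young_powR], applied
    under the integral with [t = |du|], splits the remaining term between [wker] and [U]. *)
Lemma density_gain_weighted : exists C, 0 <= C /\ forall y, `|y| < d / 2 ->
  \int[leb2]_z (phi z * phi z * drho y z) * enorm y `^ (- 2 - b / 2) <=
  C * (wker b y + U y).
Proof.
have [K [K0 hK]] := density_gain.
have [_ [P hP] _] := bphi.
have P0 : 0 <= P by exact: le_trans (hP (0, 0)).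
have M0 : 0 <= M := M_ge0.
pose C1 := 2 * M * (2 * M + 1) + 2 * M * d `^ (b / 2).
have C1_ge0 : 0 <= C1.
  by rewrite addr_ge0// !mulr_ge0// ?powR_ge0// addr_ge0// mulr_ge0.
have dd : 0 < d := d0.
pose C := K * ((1 + d) + P ^+ 2 * C1 * (I1 + 1)).
have I10 : 0 <= I1 + 1 by apply: addr_ge0 => //; exact: I1_ge0.
have C2_ge0 : 0 <= P ^+ 2 * C1 by rewrite mulr_ge0 ?sqr_ge0.
exists C; split.
  by rewrite mulr_ge0// addr_ge0 ?(mulr_ge0 C2_ge0)// addr_ge0// ltW.
move=> y yd.
have e0 := enorm_ge0 y.
have ed : enorm y <= d.
  by rewrite (le_trans (enorm_le y))// mulrC -ler_pdivlMr// ltW.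
set w := enorm y `^ (- 2 - b / 2).
have w0 : 0 <= w by exact: powR_ge0.
have k0 := wker_ge0 b y.
(* When the minimum in [wker] is 1, [|y| < d / 2] suffices; otherwise [enorm y <= 1], and [b < 1]
   makes [enorm y] at most its power [b]. *)
have H1 : `|y| * w <= (1 + d) * wker b y.
  rewrite mulrA ler_wpM2r//.
  have ye := norm_le_enorm y.
  have [e1|e1] := leP 1 (enorm y `^ b).
    by rewrite mulr1 (le_trans (ltW yd))//; lra.
  have e1' : enorm y <= 1.
    rewrite leNgt; apply/negP => e2.
    have : 1 `^ b <= enorm y `^ b by apply: ge0_ler_powR; rewrite ?nnegrE//; exact: ltW.
    by rewrite powR1 leNgt e1.
  rewrite (le_trans ye)//.
  apply: (@le_trans _ _ (enorm y `^ b)); last by rewrite ler_peMl ?powR_ge0// lerDl ltW.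
  have [->|en0] := eqVneq (enorm y) 0; first by rewrite powR_ge0.
  apply: ger1_powR; last exact: ltW.
  by rewrite e1' lt_neqAle eq_sym en0 e0.
have bU2 := bfsM bphi2 (bdu2 y).
have H2 : \int[leb2]_z (phi z * phi z * du2 y z) * w <=
    P ^+ 2 * C1 * (I1 * wker b y + U y).
  rewrite -(RintegralZr w measurableT (bfs_integrable bU2)).
  have bw := bfsZ (wker b y) bQ.
  have -> : P ^+ 2 * C1 * (I1 * wker b y + U y) =
    \int[leb2]_z (P ^+ 2 * C1 * (wker b y * \1_Q z +
      \1_Q z * \1_Q (y + z) * (`|u (y + z) - u z| `^ r) * enorm y `^ (- 2 - b * r))).
    rewrite (RintegralZl (P ^+ 2 * C1) measurableT (bfs_integrable (bfsD bw (bU y)))).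
    rewrite (bfs_RintegralD bw (bU y)) [I1 * _]mulrC.
    by rewrite (RintegralZl (wker b y) measurableT (bfs_integrable bQ)).
  apply: bfs_le.
  - by have := bfsZ w bU2; congr bfs; apply/funext => z; rewrite mulrC.
  - by apply: bfsZ; apply: bfsD.
  move=> z; have [->|phiz] := eqVneq (phi z) 0.
    have i0 x : 0 <= \1_Q x :> R by rewrite indicE.
    rewrite !mul0r; apply: mulr_ge0 => //; apply: addr_ge0; first exact: mulr_ge0.
    by do !apply: mulr_ge0 => //; exact: powR_ge0.
  have [Qz Qyz] := phi_Q phiz yd.
  rewrite !indicE !mem_set// !mulr1 mul1r -mulrA -[leRHS]mulrA.
  have [_ uM _] := bu.
  apply: ler_pM.
  - by rewrite -expr2 sqr_ge0.
  - by rewrite mulr_ge0// sqr_ge0.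
  - by rewrite -expr2 -real_normK ?num_real// ler_pXn2r ?nnegrE.
  - rewrite /du2 -real_normK ?num_real//.
    apply: sqr_young_powR => //.
    by rewrite (le_trans (ler_normB _ _))// mulr2n mulrDl mul1r lerD.
apply: (@le_trans _ _ (K * (`|y| + \int[leb2]_z (phi z * phi z * du2 y z)) * w)).
  by rewrite ler_wpM2r// hK.
rewrite /C -[leLHS]mulrA -[leRHS]mulrA ler_wpM2l// mulrDl.
apply: le_trans (lerD H1 H2) _; rewrite -subr_ge0.
have I0 : 0 <= I1 := I1_ge0; have U0 := U_ge0 y.
move: I0 U0; move: I1 (U y) => I U' I0 U0.
rewrite [X in 0 <= X](_ : _ = (1 + d) * U' + P ^+ 2 * C1 * (wker b y + I * U')); last by ring.
have d1 : 0 <= 1 + d by rewrite addr_ge0// ltW.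
by apply: addr_ge0; apply: mulr_ge0 => //; apply: addr_ge0 => //; exact: mulr_ge0.
Qed.

(** For [|y| >= d / 2] sup bounds are enough: the integral is bounded, and the weight is at most
    [wker] divided by the constant [c]. *)
Let density_gain_all : exists C, 0 <= C /\ forall y,
  \int[leb2]_z (phi z * phi z * drho y z) * enorm y `^ (- 2 - b / 2) <=
  C * (wker b y + U y).
Proof.
have [C [C0 hC]] := density_gain_weighted.
have [_ [P hP] _] := bphi.
have P0 : 0 <= P by exact: le_trans (hP (0, 0)).
have M0 : 0 <= M := M_ge0.
have dd : 0 < d := d0.
pose c := Num.min 1 ((d / 2) `^ b).
have c0 : 0 < c by rewrite lt_min ltr01 powR_gt0// divr_gt0.
pose C' := P ^+ 2 * (2 * M) `^ q * I1 / c.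
have C'0 : 0 <= C'.
  by rewrite divr_ge0 ?(ltW c0)// !mulr_ge0 ?sqr_ge0 ?powR_ge0//; exact: I1_ge0.
exists (C + C'); split => [|y]; first exact: addr_ge0.
have k0 := wker_ge0 b y; have U0 := U_ge0 y.
have [yd|yd] := ltP `|y| (d / 2).
  by rewrite (le_trans (hC y yd))// ler_wpM2r ?addr_ge0// lerDl.
have w0 : 0 <= enorm y `^ (- 2 - b / 2) by exact: powR_ge0.
have cw : c * enorm y `^ (- 2 - b / 2) <= wker b y.
  rewrite ler_wpM2r// le_min ge_min lexx/= ge_min; apply/orP; right.
  have de : d / 2 <= enorm y by exact: le_trans yd (norm_le_enorm y).
  have d2 : 0 <= d / 2 by rewrite divr_ge0// ltW.
  apply: ge0_ler_powR => //; first exact: ltW.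
  by rewrite nnegrE enorm_ge0.
have bL := bfsM bphi2 (bdrho y).
have IL : \int[leb2]_z (phi z * phi z * drho y z) <= P ^+ 2 * (2 * M) `^ q * I1.
  rewrite -(RintegralZl (P ^+ 2 * (2 * M) `^ q) measurableT (bfs_integrable bQ)).
  apply: bfs_le => //; first exact: bfsZ.
  move=> z; have [->|phiz] := eqVneq (phi z) 0.
    by rewrite !mul0r !mulr_ge0 ?sqr_ge0 ?powR_ge0// indicE.
  have Qz : Q z.
    have dd2 : `|0 : R * R| < d / 2 by rewrite normr0 divr_gt0.
    by have [] := phi_Q phiz dd2.
  have [_ rM _] := brho.
  rewrite indicE mem_set// mulr1; apply: ler_pM; rewrite ?powR_ge0//.
  - by rewrite -expr2 sqr_ge0.
  - by rewrite -expr2 -real_normK ?num_real// ler_pXn2r ?nnegrE.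
  - apply: ge0_ler_powR; rewrite ?nnegrE// ?mulr_ge0//; first exact: ltW.
    by rewrite (le_trans (ler_normB _ _))// mulr2n mulrDl mul1r lerD.
apply: (@le_trans _ _ (C' * wker b y)).
  rewrite /C' -mulrA (mulrC c^-1).
  rewrite (le_trans (ler_wpM2r w0 IL))// ler_wpM2l//.
    by rewrite !mulr_ge0 ?sqr_ge0 ?powR_ge0//; exact: I1_ge0.
  by rewrite ler_pdivlMr// mulrC.
by apply: ler_pM => //; [rewrite lerDr|rewrite lerDl].
Qed.

Let F (x : (R * R) * (R * R)) :=
  `|phi x.1 * rho x.1 - phi x.2 * rho x.2| `^ q * enorm (x.2 - x.1) `^ (- 2 - b / 2).

Let bF y : bfs leb2 (fun z => F (z, y + z)).
Proof.
have bp : bfs leb2 (fun z => phi (y + z)).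
  by have [? [? /(bbox_shift y) /bbox_bfs]] := test_function_bbox tphi.
have := bfsZ (enorm y `^ (- 2 - b / 2))
  (bfs_powR q_gt0 (bfsB (bfsM bphi bfr) (bfsM bp (bshift y brho)))).
by congr bfs; apply/funext => z; rewrite /F /= addrK mulrC.
Qed.

(** The Leibniz rule for the increment of [phi * rho]: one term carries the increment of [rho],
    already estimated, and the other the increment of [phi], which [wker] absorbs. *)
Lemma density_slice : exists C, 0 <= C /\ forall y,
  \int[leb2]_z F (z, y + z) <= C * (wker b y + U y).
Proof.
have [C [C0 hC]] := density_gain_all.
have [_ [P hP] _] := bphi.
have P0 : 0 <= P by exact: le_trans (hP (0, 0)).
have M0 : 0 <= M := M_ge0.
have [K [K0 hK]] := test_function_lipschitz tphi.
pose C2 := (2 * P) `^ q + K `^ q.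
have C2_ge0 : 0 <= C2 by rewrite addr_ge0 ?powR_ge0.
have I0 : 0 <= I1 := I1_ge0.
pose C' := 2 `^ q * (P `^ (q - 2) * C + M `^ q * C2 * I1).
exists C'; split => [|y].
  by rewrite mulr_ge0 ?powR_ge0// addr_ge0// !mulr_ge0 ?powR_ge0.
have k0 := wker_ge0 b y; have U0 := U_ge0 y.
set w := enorm y `^ (- 2 - b / 2).
have w0 : 0 <= w by exact: powR_ge0.
have q0 : 0 <= q by exact: ltW.
have q2 : 0 <= q - 2 by rewrite /q; move: gamma1; lra.
(* [q - 2 = gamma - 1] is nonnegative, so the surplus power of [|phi|] beyond the square is
   bounded. *)
have phiq z : `|phi z| `^ q <= P `^ (q - 2) * (phi z * phi z).
  have [->|pz] := eqVneq (phi z) 0.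
    by rewrite normr0 powR0 ?gt_eqF// !mulr0.
  rewrite {1}(_ : q = (q - 2) + 2); last by ring.
  rewrite powRD; last by rewrite normr_eq0 pz implybT.
  have -> : `|phi z| `^ 2 = phi z * phi z.
    by rewrite -[2]/(2%:R) powR_mulrn// real_normK ?num_real// expr2.
  rewrite ler_wpM2r -?expr2 ?sqr_ge0//.
  by apply: ge0_ler_powR; rewrite ?nnegrE.
(* If the minimum in [wker] is 1, the sup bound of [phi] suffices. Otherwise the Lipschitz bound
   gives the power [q] of [enorm y <= 1], at most its power [b] because [b < q]. *)
have dphi z : `|phi z - phi (y + z)| `^ q * w <= C2 * wker b y.
  rewrite mulrA ler_wpM2r//.
  have e0 := enorm_ge0 y.
  have [e1|e1] := leP 1 (enorm y `^ b).
    rewrite mulr1; apply: (@le_trans _ _ ((2 * P) `^ q)); last by rewrite lerDl powR_ge0.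
    apply: ge0_ler_powR; rewrite ?nnegrE// ?mulr_ge0//.
    by rewrite (le_trans (ler_normB _ _))// mulr2n mulrDl mul1r lerD.
  have e1' : enorm y <= 1.
    rewrite leNgt; apply/negP => e2.
    have : 1 `^ b <= enorm y `^ b by apply: ge0_ler_powR; rewrite ?nnegrE//; exact: ltW.
    by rewrite powR1 leNgt e1.
  apply: (@le_trans _ _ (K `^ q * enorm y `^ b)); last first.
    by rewrite ler_wpM2r ?powR_ge0// lerDr powR_ge0.
  apply: (@le_trans _ _ ((K * enorm y) `^ q)).
    apply: ge0_ler_powR; rewrite ?nnegrE// ?mulr_ge0//.
    have := hK z y; rewrite (addrC z) distrC => h; rewrite (le_trans h)// ler_wpM2l//.
    exact: norm_le_enorm.
  rewrite powRM// ler_wpM2l ?powR_ge0//.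
  have [->|en0] := eqVneq (enorm y) 0.
    by rewrite powR0 ?gt_eqF// powR_ge0.
  apply: ger_powR; first by rewrite e1' lt_neqAle eq_sym en0 e0.
  by rewrite /q; move: gamma1 b1; lra.
have bL := bfsM bphi2 (bdrho y).
pose G z := 2 `^ q * (P `^ (q - 2) * w * (phi z * phi z * drho y z) +
    M `^ q * C2 * wker b y * \1_Q (y + z)).
have pw z : F (z, y + z) <= G z.
  rewrite /F /= addrK -/w /G.
  apply: (@le_trans _ _ (2 `^ q * (`|phi z| `^ q * drho y z * w +
      `|rho (y + z)| `^ q * (`|phi z - phi (y + z)| `^ q * w)))).
    rewrite [leRHS](_ : _ = 2 `^ q * ((`|phi z| * `|rho (y + z) - rho z|) `^ q +
      (`|rho (y + z)| * `|phi z - phi (y + z)|) `^ q) * w); last first.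
      by rewrite !powRM// /drho; ring.
    rewrite ler_wpM2r//.
    have A0 : 0 <= `|phi z| * `|rho (y + z) - rho z| by exact: mulr_ge0.
    have B0 : 0 <= `|rho (y + z)| * `|phi z - phi (y + z)| by exact: mulr_ge0.
    apply: le_trans (powRD_le q0 A0 B0).
    apply: ge0_ler_powR; rewrite ?nnegrE// ?addr_ge0// ?mulr_ge0//.
    rewrite -!normrM [X in `|X|](_ : _ = - (phi z * (rho (y + z) - rho z)) +
      rho (y + z) * (phi z - phi (y + z))); last by ring.
    by rewrite (le_trans (ler_normD _ _))// normrN.
  rewrite ler_wpM2l ?powR_ge0// lerD//.
  - apply: (@le_trans _ _ (P `^ (q - 2) * (phi z * phi z) * drho y z * w)).
      by rewrite ler_wpM2r// ler_wpM2r ?powR_ge0.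
    by rewrite le_eqVlt; apply/orP; left; apply/eqP; ring.
  (* Since [rho] vanishes outside [Q], the indicator of [Q] at [y + z] may be inserted; without it
     the majorant would not be integrable in [z]. *)
  - rewrite indicE; have [Qz|nQ] := pselect (Q (y + z)); last first.
      by rewrite rhoQ// normr0 powR0 ?gt_eqF// mul0r memNset// mulr0.
    rewrite mem_set// mulr1 -[leRHS]mulrA; apply: ler_pM; rewrite ?powR_ge0 ?mulr_ge0 ?powR_ge0//.
    have [_ rM _] := brho.
    by apply: ge0_ler_powR; rewrite ?nnegrE.
have bG : bfs leb2 G.
  by apply: bfsZ; apply: bfsD; apply: bfsZ.
apply: le_trans (bfs_le (bF y) bG pw) _.
have bG1 := bfsZ (P `^ (q - 2) * w) bL.
have bG2 := bfsZ (M `^ q * C2 * wker b y) (bQs y).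
rewrite (RintegralZl (2 `^ q) measurableT (bfs_integrable (bfsD bG1 bG2))).
rewrite (bfs_RintegralD bG1 bG2).
rewrite (RintegralZl (P `^ (q - 2) * w) measurableT (bfs_integrable bL)).
rewrite (RintegralZl (M `^ q * C2 * wker b y) measurableT (bfs_integrable (bQs y))).
rewrite (Rintegral_leb2_shift y bQ) -/I1 /C' -[leRHS]mulrA ler_wpM2l ?powR_ge0//.
have := hC y; rewrite -/w.
move: (\int[leb2]_z (phi z * phi z * drho y z)) => X HX.
have p0 : 0 <= P `^ (q - 2) by exact: powR_ge0.
have m0 : 0 <= M `^ q * C2 * I1 by rewrite !mulr_ge0 ?powR_ge0.
rewrite mulrDl; apply: lerD.
  by rewrite -!mulrA ler_wpM2l// mulrC (le_trans HX).
by rewrite mulrAC ler_wpM2l// lerDl.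
Qed.

Let G (x : (R * R) * (R * R)) := \1_Q x.1 * \1_Q x.2 * (`|u x.2 - u x.1| `^ r) *
  enorm (x.2 - x.1) `^ (- 2 - b * r).

(** Both double integrals are rewritten over increments. Integrating [density_slice] in [y] leaves
    the integral of [wker], which is finite, and that of [U], which is the integral of [G]. *)
Lemma gagliardo_finite :
  (\int[@leb4 R]_x (G x)%:E < +oo)%E -> (\int[@leb4 R]_x (F x)%:E < +oo)%E.
Proof.
have [mr _ _] := brho; have [mu _ _] := bu; have [mp _ _] := bphi.
have mrp : measurable_fun setT (fun z => phi z * rho z) by exact: measurable_funM.
have mF : measurable_fun setT (fun x : mplane R * mplane R => (F x)%:E).
  apply/measurable_EFinP.
  exact: measurable_funM (measurable_powR_diff q mrp mrp) (measurable_enorm_diff _).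
have F0 x : (0 <= (F x)%:E)%E by rewrite lee_fin mulr_ge0 ?powR_ge0.
have mi : measurable_fun setT (\1_Q : mplane R -> R).
  exact: measurable_indic (measurable_box _ _ _).
have mG : measurable_fun setT (fun x : mplane R * mplane R => (G x)%:E).
  apply/measurable_EFinP; apply: measurable_funM; last exact: measurable_enorm_diff.
  apply: measurable_funM; first apply: measurable_funM.
  - exact: (measurableT_comp mi measurable_fst).
  - exact: (measurableT_comp mi measurable_snd).
  - have := measurable_powR_diff r mu mu; congr measurable_fun.
    by apply/funext => x; rewrite distrC.
have G0 x : (0 <= (G x)%:E)%E by rewrite lee_fin !mulr_ge0 ?powR_ge0// indicE.
have GU y : (\int[leb2]_z (G (z, (y + z)%R))%:E = (U y)%:E)%E.
  rewrite /U (bfs_EFin (bU y)); apply: eq_integral => z _.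
  by rewrite /G /= addrK.
have FD y : (\int[leb2]_z (F (z, (y + z)%R))%:E = (\int[leb2]_z F (z, (y + z)%R))%:E)%E.
  by rewrite (bfs_EFin (bF y)).
have msl (H : mplane R * mplane R -> \bar R) : measurable_fun setT H ->
    (forall x, (0 <= H x)%E) ->
    measurable_fun setT (fun y : mplane R => \int[leb2]_z H (z, (y + z)%R))%E.
  move=> mH H0.
  exact: (@measurable_fun_fubini_tonelli_F _ _ _ _ R leb2 _
    (measurableT_comp mH measurable_shear) (fun x => H0 _)).
have mU : measurable_fun setT (fun y => (U y)%:E).
  have := msl _ mG G0; by congr measurable_fun; apply/funext => y; rewrite GU.
have mD := msl _ mF F0.
rewrite (integral_leb4_shear mG G0) (integral_leb4_shear mF F0) => Goo.
have [C [C0 hC]] := density_slice.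
have mw : measurable_fun setT (fun y : mplane R => (wker b y)%:E).
  by apply/measurable_EFinP; exact: measurable_wker.
have w0 y : (0 <= (wker b y)%:E)%E by rewrite lee_fin wker_ge0.
have U0 y : (0 <= (U y)%:E)%E by rewrite lee_fin; exact: U_ge0.
apply: (@le_lt_trans _ _ (\int[leb2]_y (C%:E * ((wker b y)%:E + (U y)%:E)))%E).
  apply: ge0_le_integral => //.
  - by move=> y _; apply: integral_ge0.
  - by apply: emeasurable_funM; [exact: measurable_cst|exact: emeasurable_funD].
  - by move=> y _; rewrite FD -EFinD -EFinM lee_fin.
have mwU : measurable_fun setT (fun y => ((wker b y)%:E + (U y)%:E)%E).
  exact: emeasurable_funD.
rewrite ge0_integralZl//; last by move=> y _; rewrite adde_ge0.
rewrite ge0_integralD//.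
have UE : (\int[leb2]_y (U y)%:E < +oo)%E.
  by move: Goo; under eq_integral do rewrite GU.
have woo := integral_wker b0 b1.
by rewrite lte_mul_pinfty// lte_add_pinfty.
Qed.

End Gain.

(** * Localization *)

Section Localization.
Context {R : realType}.
Local Notation leb1 := (@leb1 R).
Local Notation leb2 := (@leb2 R).
Local Notation leb4 := (@leb4 R).

Lemma measurable_halfplane : measurable (halfplane : set (mplane R)).
Proof.
have -> : (halfplane : set (R * R)) = `]0, +oo[ `*` setT.
  by apply/seteqP; split => -[t x] /=; rewrite /halfplane /= in_itv/= andbT => // -[].
by apply: measurableX => //; exact: measurable_itv.
Qed.

Lemma measurable_rect (T L : R) : measurable (rect T L : set (mplane R)).
Proof.
have -> : (rect T L : set (R * R)) = `]0, T[ `*` `]- L, L[.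
  by apply/seteqP; split => -[t x] /=; rewrite /rect /= !in_itv.
by apply: measurableX; exact: measurable_itv.
Qed.

(** The projection of the compact support to the [t] axis is compact and misses 0, hence stays at a
    positive distance from it. *)
Lemma test_function_halfplane_box (phi : R * R -> R) : test_function halfplane phi ->
  exists a L, 0 < a /\ test_function (box a L 0) phi.
Proof.
move=> [sf cK KH].
have [L [_ hL]] := compact_bounded cK.
have c1 : compact (fst @` supp phi).
  by apply: continuous_compact => //; apply: continuous_subspaceT => z; exact: cvg_fst.
have cl1 : closed (fst @` supp phi) by apply: compact_closed => //; exact: Rhausdorff.
have : nbhs (0 : R) (~` (fst @` supp phi)).
  apply: open_nbhs_nbhs; split; first exact: closed_openC.
  by move=> [z /KH]; rewrite /halfplane /= => z0 zE; rewrite zE ltxx in z0.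
rewrite -nbhs_ballE => -[a /= a0 ha].
exists a, (L + 1); split => //; split => // z sz.
have zL : `|z| <= L + 1 by apply: hL => //; rewrite ltrDl.
move: zL; rewrite prod_normE ge_max => /andP[z1 z2].
have z0 : 0 < z.1 by exact: KH.
rewrite /box /= !subr0 !addr0 -ler_norml z2; split => //.
rewrite (le_trans (ler_norm _) z1) andbT leNgt; apply/negP => za.
apply: (ha z.1); last by exists z.
by rewrite /ball/= sub0r normrN gtr0_norm.
Qed.

Lemma ae_leb4 (P : R * R -> Prop) : {ae leb2, forall z, P z} ->
  {ae leb4, forall x, P x.1 /\ P x.2}.
Proof.
move=> [N [mN N0 hN]].
exists ((N `*` setT) `|` (setT `*` N)); split.
- by apply: measurableU; exact: measurableX.
- apply/eqP; rewrite eq_le measure_ge0 andbT.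
  have M1 : (leb2 \x leb2)%E (N `*` setT) = 0%E.
    by rewrite product_measure1E// [X in (X * _)%E]N0 mul0e.
  have M2 : (leb2 \x leb2)%E (setT `*` N) = 0%E.
    by rewrite product_measure1E// [X in (_ * X)%E]N0 mule0.
  apply: le_trans (measureU2 _ _ _) _; [exact: measurableX|exact: measurableX|].
  by rewrite [X in (X + _)%E]M1 [X in (_ + X)%E]M2 adde0.
- move=> x /= nP; have [P1|P1] := pselect (P x.1).
    by right; split => //; apply: hN => P2; exact: nP.
  by left; split => //; exact: hN.
Qed.

Lemma ae_mono d (T : measurableType d) (mu : {measure set T -> \bar R})
  (P P' : T -> Prop) : (forall x, P x -> P' x) ->
  {ae mu, forall x, P x} -> {ae mu, forall x, P' x}.
Proof.
move=> PP' [N [mN N0 hN]]; exists N; split => // x /= nP'.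
by apply: hN => /PP'.
Qed.

Lemma ae_Rintegral_halfplane (f g : R * R -> R) :
  measurable_fun halfplane f -> measurable_fun setT g ->
  {ae leb2, forall z, halfplane z -> f z = g z} ->
  (forall z, ~ halfplane z -> g z = 0) ->
  \int[leb2]_(z in halfplane) f z = \int[leb2]_z g z.
Proof.
move=> mf mg fg g0; rewrite Rintegral_mkcond; congr fine.
apply: ae_eq_integral => //.
- apply/measurable_EFinP.
  by apply/(measurable_restrictT _ measurable_halfplane).
- exact/measurable_EFinP.
- apply: ae_mono fg => z fgz _ /=; rewrite patchE.
  case: ifPn => [/set_mem /fgz ->//|/negP nz].
  by rewrite g0// => hz; apply: nz; exact/mem_set.
Qed.

Lemma ae_and d (T : measurableType d) (mu : {measure set T -> \bar R})
  (P P' : T -> Prop) : {ae mu, forall x, P x} -> {ae mu, forall x, P' x} ->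
  {ae mu, forall x, P x /\ P' x}.
Proof. exact: (@filterI _ _ (ae_filter_ringOfSetsType mu)). Qed.

(** Turns almost-everywhere bounds into bounds at every point: clipping does not change values that
    already lie between [lo] and [hi]. *)
Lemma bbox_clip (f : R * R -> R) (Q : set (R * R)) (lo hi M N : R) :
  measurable (Q : set (mplane R)) -> measurable_fun Q f ->
  (forall z, Q z -> `|z.1| <= N /\ `|z.2| <= N) ->
  (forall x, `|Num.max lo (Num.min x hi)| <= M) ->
  bbox M N ((fun z => Num.max lo (Num.min (f z) hi)) \_ Q).
Proof.
move=> mQ mf QN hM; have M0 : 0 <= M by exact: le_trans (hM 0).
split.
- apply/(measurable_restrictT _ mQ); apply: measurable_maxr.
    exact: measurable_cst.
  by apply: measurable_minr => //; exact: measurable_cst.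
- by move=> z; rewrite patchE; case: ifPn => // _; rewrite normr0.
- by move=> z nz; rewrite patchE memNset// => /QN.
Qed.

(** Passes from the seminorm of [u] on an open rectangle to that of its modified copy on the smaller
    box [Q], in the form with indicators that [gagliardo_finite] takes. *)
Lemma gagliardo_patch (Q S : set (R * R)) (p e : R) (f g : R * R -> R) :
  measurable (Q : set (mplane R)) -> measurable (S : set (mplane R)) -> Q `<=` S ->
  measurable_fun S f -> measurable_fun setT g ->
  {ae leb2, forall z, Q z -> f z = g z} ->
  (\int[leb4]_(x in S `*` S)
     (`|f x.1 - f x.2| `^ p * Defs.edist x.1 x.2 `^ e)%:E < +oo)%E ->
  (\int[leb4]_x (\1_Q x.1 * \1_Q x.2 * `|g x.2 - g x.1| `^ p *
     enorm (x.2 - x.1) `^ e)%:E < +oo)%E.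
Proof.
move=> mQ mS QS mf mg fg; apply: le_lt_trans.
have ed (z w : R * R) : Defs.edist z w = enorm (w - z) by rewrite -(edistE z) subrK.
have mSS : measurable (S `*` S : set (mplane R * mplane R)) by exact: measurableX.
pose h := f \_ S.
have mh : measurable_fun setT (h : mplane R -> R).
  by apply/(measurable_restrictT _ mS).
have -> : (\int[leb4]_(x in S `*` S)
     (`|f x.1 - f x.2| `^ p * Defs.edist x.1 x.2 `^ e)%:E)%E =
   (\int[leb4]_(x in S `*` S)
     (`|h x.1 - h x.2| `^ p * enorm (x.2 - x.1) `^ e)%:E)%E.
  apply: eq_integral => x /set_mem[S1 S2].
  by rewrite ed /h !patchE !mem_set.
have mi : measurable_fun setT (\1_Q : mplane R -> R) by exact: measurable_indic.
have m1 : measurable_fun setT (fun x : mplane R * mplane R =>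
    (`|h x.1 - h x.2| `^ p * enorm (x.2 - x.1) `^ e)%:E).
  apply/measurable_EFinP.
  exact: measurable_funM (measurable_powR_diff p mh mh) (measurable_enorm_diff _).
rewrite [leRHS]integral_mkcond; apply: ae_ge0_le_integral => //.
- by move=> x _; rewrite lee_fin !mulr_ge0 ?powR_ge0// indicE.
- apply/measurable_EFinP; apply: measurable_funM; last exact: measurable_enorm_diff.
  apply: measurable_funM; first apply: measurable_funM.
  + exact: (measurableT_comp mi measurable_fst).
  + exact: (measurableT_comp mi measurable_snd).
  + have := measurable_powR_diff p mg mg; congr measurable_fun.
    by apply/funext => x; rewrite distrC.
- by move=> y _; apply: erestrict_ge0 => x _; rewrite lee_fin mulr_ge0 ?powR_ge0.
- by apply/(measurable_restrictT _ mSS); exact: measurable_funTS.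
- apply: ae_mono (ae_leb4 fg) => x [f1 f2] _.
  have S0 : (0 <= ((fun x => (`|h x.1 - h x.2| `^ p * enorm (x.2 - x.1) `^ e)%:E) \_
      (S `*` S)) x)%E.
    by apply: erestrict_ge0 => y _; rewrite lee_fin mulr_ge0 ?powR_ge0.
  have [Q1|Q1] := pselect (Q x.1); last first.
    by rewrite (indicE _ Q x.1) memNset// !mul0r.
  have [Q2|Q2] := pselect (Q x.2); last first.
    by rewrite (indicE _ Q x.2) memNset// mulr0 !mul0r.
  have SS : (S `*` S) x by split; exact: QS.
  rewrite patchE mem_set// /h !patchE !mem_set//; [|exact: QS|exact: QS].
  by rewrite !indicE !mem_set// !mul1r f1// f2// distrC.
Qed.

(** The way back from the modified function to the original one: the integrals in [sobolev] see only
    classes up to null sets. *)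
Lemma sobolev_ae (s q : R) (f g : R * R -> R) : 0 < q ->
  measurable_fun setT (f : mplane R -> R) -> bfs leb2 g -> {ae leb2, forall z, f z = g z} ->
  (\int[leb4]_x (`|g x.1 - g x.2| `^ q *
     enorm (x.2 - x.1) `^ (- 2 - s * q))%:E < +oo)%E ->
  sobolev s q setT f.
Proof.
move=> q0 mf bg fg I; have [mg _ _] := bg.
have ed (z w : R * R) : Defs.edist z w = enorm (w - z) by rewrite -(edistE z) subrK.
split; first exact: mf.
- have bgq := bfs_powR q0 bg.
  have -> : (\int[leb2]_z (`|f z| `^ q)%:E = \int[leb2]_z (`|g z| `^ q)%:E)%E.
    apply: ae_eq_integral.
    + exact: measurableT.
    + apply/measurable_EFinP; apply: (measurableT_comp (measurable_powR _)).
      exact: measurableT_comp.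
    + by apply/measurable_EFinP; have [] := bgq.
    + by apply: ae_mono fg => z -> _.
  by rewrite -(bfs_EFin bgq) ltry.
- rewrite setXTT; apply: le_lt_trans I; rewrite le_eqVlt; apply/orP; left; apply/eqP.
  apply: ae_eq_integral.
  + exact: measurableT.
  + apply/measurable_EFinP; have := measurable_funM
      (measurable_powR_diff q mf mf) (measurable_enorm_diff (- 2 - s * q)).
    by congr measurable_fun; apply/funext => x; rewrite /= ed.
  + apply/measurable_EFinP.
    exact: measurable_funM (measurable_powR_diff q mg mg) (measurable_enorm_diff _).
  + by apply: ae_mono (ae_leb4 fg) => x [f1 f2] _; rewrite f1 f2 ed.
Qed.

End Localization.

(** * Cut-off of the solution and choice of the constants *)

Theorem theorem4p5 (R : realType) (gamma : R) (rho u : R * R -> R)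
    (beta r : R)
    (hgamma : 1 < gamma) (hgamma3 : gamma != 3)
    (hsol : entropy_solution gamma rho u)
    (hrho : locally_bounded rho) (hu : locally_bounded u)
    (hbeta : 0 < beta < 1) (hr : 1 < r)
    (hsob : forall T : R, 0 < T -> sobolev_loc_strip T beta r u) :
  exists betabar rbar : R,
    [/\ 0 < betabar < 1, 1 < rbar & sobolev_loc betabar rbar rho].
Proof.
have /andP[b0 b1] := hbeta.
have q0 : 0 < gamma + 1 by rewrite addr_gt0// (lt_trans ltr01).
exists (beta / 2 / (gamma + 1)), (gamma + 1); split.
- rewrite !divr_gt0//= ltr_pdivrMr// mul1r; lra.
- lra.
move=> phi tphiH.
have [a [L [a0 tphi]]] := test_function_halfplane_box tphiH.
(* With [a = 4 * d] the box enlarged by [2 * d] keeps [t >= 2 * d > 0], inside the half-plane. *)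
have [d [d0 da]] : exists d, 0 < d /\ a = 4 * d.
  by exists (a / 4); split; [rewrite divr_gt0|field].
pose Q := box a L (2 * d).
have QH : Q `<=` halfplane.
  by move=> z [/andP[z1 _] _]; rewrite /halfplane /=; move: z1; rewrite da; lra.
have mQ : measurable (Q : set (mplane R)) by exact: measurable_box.
have [N [_ _ QN0]] := bbox_indic_box a L (2 * d).
have QN z : Q z -> `|z.1| <= N /\ `|z.2| <= N.
  move=> Qz; apply: contrapT => /QN0 /eqP; rewrite indicE mem_set//.
  by rewrite oner_eq0.
have [mrho /(_ Q (@compact_box R a L (2 * d)) QH) [M1 hM1]] := hrho.
have [mu /(_ Q (@compact_box R a L (2 * d)) QH) [M2 hM2]] := hu.
have [M [M0 M1M M2M]] : exists M, [/\ 0 <= M, M1 <= M & M2 <= M].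
  exists (Num.max 0 (Num.max M1 M2)).
  by split; rewrite !le_max ?lexx ?orbT.
(* Clipping at the local bound [M] and cutting off outside [Q] make the bounds, and the sign of the
   density, valid at every point and not only almost everywhere. *)
pose rho' : R * R -> R := (fun z => Num.max 0 (Num.min (rho z) M)) \_ Q.
pose u' : R * R -> R := (fun z => Num.max (- M) (Num.min (u z) M)) \_ Q.
have brho : bbox M N rho'.
  apply: bbox_clip => //; first exact: (measurable_funS (@measurable_halfplane R) QH mrho).
  by move=> x; rewrite ger0_norm ?le_max ?lexx// ge_max M0 ge_min lexx orbT.
have bu : bbox M N u'.
  apply: bbox_clip => //; first exact: (measurable_funS (@measurable_halfplane R) QH mu).
  by move=> x; rewrite ler_norml le_max lexx/= ge_max ge_min lexx orbT andbT; lra.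
have rho'0 z : 0 <= rho' z.
  by rewrite /rho' patchE; case: ifPn => // _; rewrite le_max lexx.
have rho'Q z : ~ Q z -> rho' z = 0 by move=> nz; rewrite /rho' patchE memNset.
have u'Q z : ~ Q z -> u' z = 0 by move=> nz; rewrite /u' patchE memNset.
have aeQ : {ae @leb2 R, forall z, Q z -> rho z = rho' z /\ u z = u' z}.
  have := ae_and (ae_and hM1 hM2) (es_rho_ge0 hsol); apply: ae_mono => z [[h1 h2] h3] Qz.
  have {}h1 : `|rho z| <= M.
    exact: le_trans (h1 Qz) M1M.
  have {}h2 : `|u z| <= M.
    exact: le_trans (h2 Qz) M2M.
  have {}h3 := h3 (QH _ Qz).
  rewrite /rho' /u' !patchE mem_set//; split.
    by rewrite (min_l (le_trans (ler_norm _) h1)) (max_r h3).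
  by move: h2; rewrite ler_norml => /andP[h4 h5]; rewrite (min_l h5) (max_r h4).
have [mr' _ _] := brho; have [mu' _ _] := bu.
(* Test functions supported in [Q] have derivatives vanishing outside [Q], so altering the fields
   there, and on a null set inside, does not affect the weak equations. *)
have weak (c1 c2 c1' c2' : R * R -> R) :
    measurable_fun halfplane c1 -> measurable_fun halfplane c2 ->
    measurable_fun setT c1' -> measurable_fun setT c2' ->
    (forall z, rho z = rho' z -> u z = u' z -> c1 z = c1' z /\ c2 z = c2' z) ->
    (forall psi, test_function halfplane psi ->
      \int[@leb2 R]_(z in halfplane) (c1 z * dt2 psi z + c2 z * dx2 psi z) = 0) ->
    weak_div_free Q c1' c2'.
  move=> m1 m2 m1' m2' cc H psi tpsi.
  have tpsiH : test_function halfplane psi.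
    by case: tpsi => sf cf fQ; split => //; exact: subset_trans QH.
  have mD v : measurable_fun setT ('D_v psi : mplane R -> R).
    by have [? [? []]] := test_function_bbox (test_function_derive v tpsi).
  have nQ z v : ~ Q z -> 'D_v psi z = 0.
    by move=> nz; apply: derive_supp => sz; apply: nz; case: tpsi => _ _; exact.
  rewrite -(H psi tpsiH); apply/esym/ae_Rintegral_halfplane.
  - by apply: measurable_funD; apply: measurable_funM => //;
      apply: measurable_funTS; exact: mD.
  - by apply: measurable_funD; apply: measurable_funM => //; exact: mD.
  - apply: ae_mono aeQ => z hz _; have [Qz|nz] := pselect (Q z).
      by have [r1 r2] := hz Qz; have [-> ->] := cc z r1 r2.
    by rewrite /dt2 /dx2 !nQ// !mulr0.
  - move=> z nz; have nQz : ~ Q z by move/QH.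
    by rewrite /dt2 /dx2 !nQ// !mulr0 addr0.
have mp (D : set (mplane R)) (f : mplane R -> R) : measurable_fun D f ->
    measurable_fun D (fun z => pressure gamma (f z)).
  move=> mf; rewrite /pressure; apply: measurable_funM; first exact: measurable_cst.
  exact: (measurableT_comp (measurable_powR _) mf).
have mH := @measurable_halfplane R.
have mass : weak_div_free Q rho' (fun z => rho' z * u' z).
  apply: (weak rho (fun z => rho z * u z)) => //.
  - exact: measurable_funM.
  - exact: measurable_funM.
  - by move=> z -> ->.
  - by move=> psi tpsi; have [] := es_weak hsol tpsi.
have momentum : weak_div_free Q (fun z => rho' z * u' z)
    (fun z => rho' z * u' z ^+ 2 + pressure gamma (rho' z)).
  apply: (weak (fun z => rho z * u z) (fun z => rho z * u z ^+ 2 + pressure gamma (rho z))).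
  - exact: measurable_funM.
  - apply: measurable_funD; last exact: mp.
    by apply: measurable_funM => //; exact: measurable_funX.
  - exact: measurable_funM.
  - apply: measurable_funD; last exact: mp.
    by apply: measurable_funM => //; exact: measurable_funX.
  - by move=> z -> ->.
  - by move=> psi tpsi; have [] := es_weak hsol tpsi.
have gag := gagliardo_finite hgamma b0 b1 hr d0 brho bu rho'0 rho'Q mass momentum tphi.
(* [Lr] exceeds the absolute value of every coordinate in [Q], so one number serves both as [T] and
   as half-width; [t > 0] on [Q] comes from [a = 4 * d]. *)
set Lr := `|L| + 2 * d + 1.
have Lr0 : 0 < Lr by rewrite /Lr; have := normr_ge0 L; lra.
have Qrect : Q `<=` rect Lr Lr.
  move=> z [/andP[z1 z2] /andP[z3 z4]]; rewrite /rect /= /Lr.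
  have Ln := ler_norm L; split; apply/andP; split; move: z1 z2 z3 z4 Ln; rewrite da; lra.
have [_ _ /(gagliardo_patch mQ (@measurable_rect R _ _) Qrect)] := hsob _ Lr0 _ Lr0.
have rectH : rect Lr Lr `<=` halfplane by move=> z [/andP[]].
move=> /(_ u' (measurable_funS mH rectH mu) mu') gp.
have aeu : {ae @leb2 R, forall z, Q z -> u z = u' z}.
  by apply: ae_mono aeQ => z h /h[].
have {gp gag} := gag (gp aeu).
have -> : - 2 - beta / 2 = - 2 - beta / 2 / (gamma + 1) * (gamma + 1).
  by rewrite divfK// gt_eqF.
have bphi : bfs (@leb2 R) phi.
  by have [? [? /bbox_bfs]] := test_function_bbox tphi.
have phiQ z : phi z != 0 -> Q z.
  move=> /(test_function_neq0 tphi)[/andP[z1 z2] /andP[z3 z4]].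
  by split; apply/andP; split; lra.
apply: (sobolev_ae q0 _ (bfsM bphi (bbox_bfs brho))).
(* [rho] is measurable on the half-plane only; as [phi] vanishes outside, it may be replaced there
   by 0. *)
- have -> : (fun z => phi z * rho z) = (fun z => phi z * (rho \_ halfplane) z).
    apply/funext => z; have [->|/phiQ /QH pz] := eqVneq (phi z) 0.
      by rewrite !mul0r.
    by rewrite patchE mem_set.
  apply: measurable_funM; first by have [] := bphi.
  by apply/(measurable_restrictT _ mH).
- apply: ae_mono aeQ => z h; have [->|/phiQ /h[-> _]//] := eqVneq (phi z) 0.
  by rewrite !mul0r.
Qed.
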